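(* Let $s\in[0,1]$, $N\in\frac12\mathbb Z$, $N\neq0$, and let $J$ be the antilinear isometry on $\mathcal H$ defined by $$J|l,m;\pm N\rangle=(-1)^{m+N}|l,-m;\mp N\rangle .$$ Then $J$ is the antiunitary part of an equivariant antilinear operator, it satisfies $J^2=(-1)^{2N}$, $J\gamma=-\gamma J$, $JD=DJ$, and $$[a,Jb^*J^{-1}]\in\mathrm{OP}^{-\infty},\qquad [[D,a],Jb^*J^{-1}]\in\mathrm{OP}^{-\infty}$$ for all $a,b\in\mathcal A(S^2_{qs})$. Hence $J$ is a (weak) equivariant real structure, with $KO$-dimension $2$ mod $8$ if $2N$ is odd and $6$ mod $8$ if $2N$ is even.
   Context: Fix $0<q<1$; $[x]=(q^x-q^{-x})/(q-q^{-1})$. For $0\le s\le1$, $\mathcal A(S^2_{qs})$ is the unital $*$-algebra generated by $A=A^*,B,B^*$ with relations $AB=q^2BA$, $BB^*+(A+s^2)(A-1)=0$, $B^*B+(q^2A+s^2)(q^2A-1)=0$ (Podle\'s sphere). For nonzero $M\in\frac12\mathbb Z$ let $\mathcal H_M$ be the Hilbert space with orthonormal basis $|l,m;M\rangle$, $l-|M|\in\mathbb N$, $m\in\{-l,-l+1,\dots,l\}$. Put $x_1=(q[2])^{1/2}B$, $x_0=1-s^2-q[2]A$. The $*$-representation of $\mathcal A(S^2_{qs})$ on $\mathcal H_M$ is $$x_1|l,m;M\rangle=q^{-l+m}\sqrt{[l+m+1][l+m+2]}\,\alpha_{M,l+1}|l+1,m+1;M\rangle-q^{m+2}\sqrt{[2][l-m][l+m+1]}\,\beta_{M,l}|l,m+1;M\rangle-q^{l+m+1}\sqrt{[l-m][l-m-1]}\,\alpha_{M,l}|l-1,m+1;M\rangle,$$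 $$x_0|l,m;M\rangle=q^m\sqrt{[2][l-m+1][l+m+1]}\,\alpha_{M,l+1}|l+1,m;M\rangle+\big([2l]-q^{l+m+1}[2][l-m]\big)\beta_{M,l}|l,m;M\rangle+q^m\sqrt{[2][l-m][l+m]}\,\alpha_{M,l}|l-1,m;M\rangle,$$ with terms involving vectors outside the index set omitted, where $$\alpha_{M,l}=\frac1{[2l]}\sqrt{\frac{[2][l+M][l-M]}{[2l-1][2l+1]}}\sqrt{(q^{l+M}+q^{-(l+M)}s^2)(q^{l-M}s^2+q^{-(l-M)})},$$ $$\beta_{M,l}=\frac{([2l]-q^{l+M+1}[2][l-M])(1-s^2)+q[2][2M]s^2}{q^2[2l][2l+2]}.$$ Fix $N\in\frac12\mathbb Z$, $N\ne0$. Let $\mathcal H=\mathcal H_{-N}\oplus\mathcal H_N$, let $\gamma=+1$ on $\mathcal H_{-N}$ and $-1$ on $\mathcal H_N$, and let $D$ be the self-adjoint operator with $D|l,m;\pm N\rangle=(l-|N|+1)|l,m;\mp N\rangle$. $U_q(su(2))$ is the Hopf $*$-algebra generated by $K=K^*,K^{-1},E,E^*$ with $KEK^{-1}=qE$, $[E,E^*]=(K^2-K^{-2})/(q-q^{-1})$, $\Delta K=K\otimes K$, $\Delta E=E\otimes K+K^{-1}\otimes E$, antipode $S(K)=K^{-1}$, $S(E)=-qE$, $S(E^* )=-q^{-1}E^*$. It acts on the linear span of the basis vectors by $K|l,m;\pm N\rangle=q^m|l,m;\pm N\rangle$, $E|l,m;\pm N\rangle=\sqrt{[l-m][l+m+1]}\,|l,m+1;\pm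 N\rangle$, $E^*|l,m;\pm N\rangle=\sqrt{[l+m][l-m+1]}\,|l,m-1;\pm N\rangle$. An antilinear operator $T$ with domain containing this span is equivariant if $Th=S(h)^*T$ on the span for all $h\in U_q(su(2))$. With $\delta(T)=[|D|,T]$, $\mathrm{OP}^0=\bigcap_{j\ge0}\mathrm{dom}\,\delta^j$ and $\mathrm{OP}^{-\infty}=\{T\text{ bounded}:|D|^kT\in\mathrm{OP}^0\ \forall k\in\mathbb N\}$. A weak real structure on an even spectral triple (with respect to the ideal $\mathrm{OP}^{-\infty}$) is an antilinear isometry $J$ with $J^2=\pm1$, $JD=\pm DJ$, $J\gamma=\pm\gamma J$ and $[a,JbJ^{-1}],[[D,a],JbJ^{-1}]\in\mathrm{OP}^{-\infty}$ for all $a,b$ in the algebra; it is equivariant if $J$ is the antiunitary part of an equivariant antilinear operator. $KO$-dimension $2$ corresponds to the signs $J^2=-1$, $JD=DJ$, $J\gamma=-\gamma J$, and $KO$-dimension $6$ to $J^2=1$, $JD=DJ$, $J\gamma=-\gamma J$. *)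

(* Defs.v *)
From HB Require Import structures.
From mathcomp Require Import all_boot all_order all_algebra.
From mathcomp Require Import sesquilinear complex generic_quotient.
From mathcomp Require Import boolp classical_sets reals topology normedtype exp.

Set Implicit Arguments.
Unset Strict Implicit.
Unset Printing Implicit Defensive.

Import Order.TTheory GRing.Theory Num.Theory Num.Def.
Import numFieldNormedType.Exports.

Local Open Scope classical_set_scope.
Local Open Scope quotient_scope.
Local Open Scope complex_scope.
Local Open Scope ring_scope.

Section StarTerms.
Variables (R : realType) (G : Type).

Inductive sterm : Type :=
| SGen of G
| SCst of R[i]
| SAdd of sterm & sterm
| SMul of sterm & sterm
| SStar of sterm.

HB.instance Definition _ := gen_eqMixin sterm.
HB.instance Definition _ := gen_choiceMixin sterm.

Variable rel : sterm -> sterm -> Prop.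

(* The smallest congruence that makes the terms a unital complex *-algebra
   (SCst c being c times the unit) and contains rel. *)
Inductive scong : sterm -> sterm -> Prop :=
| scong_rel t u of rel t u : scong t u
| scong_refl t : scong t t
| scong_sym t u of scong t u : scong u t
| scong_trans t u v of scong t u & scong u v : scong t v
| scong_add t t' u u' of scong t t' & scong u u' :
    scong (SAdd t u) (SAdd t' u')
| scong_mul t t' u u' of scong t t' & scong u u' :
    scong (SMul t u) (SMul t' u')
| scong_star t t' of scong t t' : scong (SStar t) (SStar t')
| scong_addA t u v : scong (SAdd t (SAdd u v)) (SAdd (SAdd t u) v)
| scong_addC t u : scong (SAdd t u) (SAdd u t)
| scong_add0 t : scong (SAdd (SCst 0) t) t
| scong_addN t : scong (SAdd (SMul (SCst (-1)) t) t) (SCst 0)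
| scong_mulA t u v : scong (SMul t (SMul u v)) (SMul (SMul t u) v)
| scong_mul1 t : scong (SMul (SCst 1) t) t
| scong_mulDl t u v :
    scong (SMul (SAdd t u) v) (SAdd (SMul t v) (SMul u v))
| scong_mulDr t u v :
    scong (SMul t (SAdd u v)) (SAdd (SMul t u) (SMul t v))
| scong_cstD c d : scong (SCst (c + d)) (SAdd (SCst c) (SCst d))
| scong_cstM c d : scong (SCst (c * d)) (SMul (SCst c) (SCst d))
| scong_cstC c t : scong (SMul t (SCst c)) (SMul (SCst c) t)
| scong_starD t u : scong (SStar (SAdd t u)) (SAdd (SStar t) (SStar u))
| scong_starM t u : scong (SStar (SMul t u)) (SMul (SStar u) (SStar t))
| scong_starC c : scong (SStar (SCst c)) (SCst c^*)
| scong_starK t : scong (SStar (SStar t)) t.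

Definition scongb (t u : sterm) : bool := `[< scong t u >].

Lemma scongb_refl : reflexive scongb.
Proof. by move=> t; apply/asboolP; exact: scong_refl. Qed.

Lemma scongb_sym : symmetric scongb.
Proof. by move=> t u; apply/asboolP/asboolP; exact: scong_sym. Qed.

Lemma scongb_trans : transitive scongb.
Proof.
by move=> u t v /asboolP tu /asboolP uv; apply/asboolP; exact: scong_trans tu uv.
Qed.

Canonical scong_equiv := EquivRel scongb scongb_refl scongb_sym scongb_trans.

Definition starAlg : Type := {eq_quot scong_equiv}.

HB.instance Definition _ := Choice.on starAlg.
HB.instance Definition _ := Quotient.on starAlg.

Definition sclass (t : sterm) : starAlg := \pi_starAlg t.

Lemma sclassP t u : sclass t = sclass u <-> scong t u.
Proof.
split=> [|tu].
  by move/eqmodP/asboolP.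
by apply/eqmodP/asboolP.
Qed.

Lemma sclass_surj (a : starAlg) : exists t, a = sclass t.
Proof. by exists (repr a); rewrite /sclass reprK. Qed.

Lemma repr_scong t : scong (repr (sclass t)) t.
Proof. by apply/sclassP; rewrite /sclass reprK. Qed.

Definition sadd (a b : starAlg) := sclass (SAdd (repr a) (repr b)).
Definition smul (a b : starAlg) := sclass (SMul (repr a) (repr b)).
Definition sopp (a : starAlg) := sclass (SMul (SCst (-1)) (repr a)).
Definition sscale (c : R[i]) (a : starAlg) := sclass (SMul (SCst c) (repr a)).
Definition star (a : starAlg) := sclass (SStar (repr a)).

Lemma saddE t u : sadd (sclass t) (sclass u) = sclass (SAdd t u).
Proof. by apply/sclassP/scong_add; exact: repr_scong. Qed.

Lemma smulE t u : smul (sclass t) (sclass u) = sclass (SMul t u).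
Proof. by apply/sclassP/scong_mul; exact: repr_scong. Qed.

Lemma sscaleE c t : sscale c (sclass t) = sclass (SMul (SCst c) t).
Proof.
by apply/sclassP/scong_mul; [exact: scong_refl|exact: repr_scong].
Qed.

Lemma soppE t : sopp (sclass t) = sclass (SMul (SCst (-1)) t).
Proof. exact: sscaleE. Qed.

Lemma starE t : star (sclass t) = sclass (SStar t).
Proof. by apply/sclassP/scong_star; exact: repr_scong. Qed.

Let opsE := (saddE, smulE, sscaleE, soppE, starE).

Fact saddA : associative sadd.
Proof.
move=> a b c; have [[t ->] [u ->] [v ->]] :=
  And3 (sclass_surj a) (sclass_surj b) (sclass_surj c).
by rewrite !opsE; apply/sclassP/scong_addA.
Qed.

Fact saddC : commutative sadd.
Proof.
move=> a b; have [[t ->] [u ->]] := conj (sclass_surj a) (sclass_surj b).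
by rewrite !opsE; apply/sclassP/scong_addC.
Qed.

Fact sadd0 : left_id (sclass (SCst 0)) sadd.
Proof.
by move=> a; have [t ->] := sclass_surj a; rewrite opsE; apply/sclassP/scong_add0.
Qed.

Fact saddN : left_inverse (sclass (SCst 0)) sopp sadd.
Proof.
by move=> a; have [t ->] := sclass_surj a; rewrite !opsE; apply/sclassP/scong_addN.
Qed.

HB.instance Definition _ := GRing.isZmodule.Build starAlg saddA saddC sadd0 saddN.

Fact smulA : associative smul.
Proof.
move=> a b c; have [[t ->] [u ->] [v ->]] :=
  And3 (sclass_surj a) (sclass_surj b) (sclass_surj c).
by rewrite !opsE; apply/sclassP/scong_mulA.
Qed.

Fact smul1l : left_id (sclass (SCst 1)) smul.
Proof.
by move=> a; have [t ->] := sclass_surj a; rewrite opsE; apply/sclassP/scong_mul1.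
Qed.

Fact smul1r : right_id (sclass (SCst 1)) smul.
Proof.
move=> a; have [t ->] := sclass_surj a; rewrite opsE; apply/sclassP.
exact: scong_trans (scong_cstC _ _) (scong_mul1 _).
Qed.

Fact smulDl : left_distributive smul sadd.
Proof.
move=> a b c; have [[t ->] [u ->] [v ->]] :=
  And3 (sclass_surj a) (sclass_surj b) (sclass_surj c).
by rewrite !opsE; apply/sclassP/scong_mulDl.
Qed.

Fact smulDr : right_distributive smul sadd.
Proof.
move=> a b c; have [[t ->] [u ->] [v ->]] :=
  And3 (sclass_surj a) (sclass_surj b) (sclass_surj c).
by rewrite !opsE; apply/sclassP/scong_mulDr.
Qed.

HB.instance Definition _ := GRing.Zmodule_isPzRing.Build starAlg
  smulA smul1l smul1r smulDl smulDr.

Fact sscaleA c d (a : starAlg) : sscale c (sscale d a) = sscale (c * d) a.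
Proof.
have [t ->] := sclass_surj a; rewrite !opsE; apply/sclassP.
apply: scong_trans (scong_mulA _ _ _) _.
by apply: scong_mul (scong_refl _); apply/scong_sym/scong_cstM.
Qed.

Fact sscale1 : left_id 1 sscale.
Proof.
by move=> a; have [t ->] := sclass_surj a; rewrite opsE; apply/sclassP/scong_mul1.
Qed.

Fact sscaleDr : right_distributive sscale sadd.
Proof.
move=> c a b; have [[t ->] [u ->]] := conj (sclass_surj a) (sclass_surj b).
by rewrite !opsE; apply/sclassP/scong_mulDr.
Qed.

Fact sscaleDl (a : starAlg) : {morph sscale^~ a : c d / c + d >-> sadd c d}.
Proof.
move=> c d; have [t ->] := sclass_surj a; rewrite !opsE; apply/sclassP.
apply: scong_trans (scong_mulDl _ _ _).
exact: scong_mul (scong_cstD _ _) (scong_refl _).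
Qed.

HB.instance Definition _ := GRing.Zmodule_isLmodule.Build R[i] starAlg
  sscaleA sscale1 sscaleDr sscaleDl.

Definition sgen (g : G) : starAlg := sclass (SGen g).

Lemma sclassC c : sclass (SCst c) = c *: (1 : starAlg).
Proof.
rewrite [RHS]sscaleE; apply/sclassP/scong_sym.
exact: scong_trans (scong_cstC _ _) (scong_mul1 _).
Qed.

Lemma sclassD t u : sclass (SAdd t u) = sclass t + sclass u.
Proof. by rewrite -saddE. Qed.

Lemma sclassM t u : sclass (SMul t u) = sclass t * sclass u.
Proof. by rewrite -smulE. Qed.

Lemma sclassS t : sclass (SStar t) = star (sclass t).
Proof. by rewrite -starE. Qed.

Lemma sscaleAl c (a b : starAlg) : c *: (a * b) = c *: a * b.
Proof.
have [[t ->] [u ->]] := conj (sclass_surj a) (sclass_surj b).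
rewrite -sclassM ![_ *: _]sscaleE -sclassM.
by apply/sclassP/scong_mulA.
Qed.

Lemma sscaleAr c (a b : starAlg) : c *: (a * b) = a * (c *: b).
Proof.
have [[t ->] [u ->]] := conj (sclass_surj a) (sclass_surj b).
rewrite -sclassM ![_ *: _]sscaleE -sclassM; apply/sclassP.
apply: scong_trans (scong_mulA _ _ _) _.
apply: scong_trans (scong_sym (scong_mulA _ _ _)).
exact: scong_mul (scong_sym (scong_cstC _ _)) (scong_refl _).
Qed.

Lemma starK : involutive star.
Proof.
by move=> a; have [t ->] := sclass_surj a; rewrite !starE; apply/sclassP/scong_starK.
Qed.

Lemma starD a b : star (a + b) = star a + star b.
Proof.
have [[t ->] [u ->]] := conj (sclass_surj a) (sclass_surj b).
by rewrite -sclassD !starE -sclassD; apply/sclassP/scong_starD.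
Qed.

Lemma starM a b : star (a * b) = star b * star a.
Proof.
have [[t ->] [u ->]] := conj (sclass_surj a) (sclass_surj b).
by rewrite -sclassM !starE -sclassM; apply/sclassP/scong_starM.
Qed.

Lemma starC c : star (c *: (1 : starAlg)) = c^* *: (1 : starAlg).
Proof. by rewrite -!sclassC starE; apply/sclassP/scong_starC. Qed.

Lemma starZ c a : star (c *: a) = c^* *: star a.
Proof. by rewrite -[a in LHS]mul1r sscaleAl starM starC -sscaleAr mulr1. Qed.

End StarTerms.

Arguments SCst {R G} c.
Arguments SGen {R G} g.
Arguments SAdd {R G} t u.
Arguments SMul {R G} t u.
Arguments SStar {R G} t.

Inductive podles_gen := genA | genB.

Section Podles.
Variables (R : realType) (q s : R).

Local Notation T := (sterm R podles_gen).
Local Notation "t + u" := (SAdd t u).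
Local Notation "t * u" := (SMul t u).
Local Notation cst c := (SCst (c : R)%:C).
Local Notation A := (SGen genA : T).
Local Notation B := (SGen genB : T).
Local Notation Bs := (SStar B).

Inductive podles_rel : T -> T -> Prop :=
| podles_AS : podles_rel (SStar A) A
| podles_AB : podles_rel (A * B) (cst (q ^+ 2) * (B * A))
| podles_BBs :
    podles_rel (B * Bs + (A + cst (s ^+ 2)) * (A + cst (- 1))) (cst 0)
| podles_BsB :
    podles_rel (Bs * B + (cst (q ^+ 2) * A + cst (s ^+ 2))
                         * (cst (q ^+ 2) * A + cst (- 1))) (cst 0).

End Podles.

Notation podles q s := (starAlg (podles_rel q s)).

Definition podA (R : realType) (q s : R) : podles q s := sgen _ genA.
Definition podB (R : realType) (q s : R) : podles q s := sgen _ genB.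

Section PodlesTheory.
Variables (R : realType) (q s : R).

Local Notation cl := (sclass (podles_rel q s)).
Local Notation A := (podA q s).
Local Notation B := (podB q s).

Let clP t u : podles_rel q s t u -> cl t = cl u.
Proof. by move/scong_rel/sclassP. Qed.

Let clZ c t : cl (SMul (SCst c) t) = c *: cl t.
Proof. by rewrite -sscaleE. Qed.

Lemma podAS : star A = A.
Proof. by rewrite starE; exact: clP (podles_AS q s). Qed.

Lemma podAB : A * B = (q ^+ 2)%:C *: (B * A).
Proof. by have := clP (podles_AB q s); rewrite clZ !sclassM. Qed.

Lemma podBBs :
  B * star B + (A + (s ^+ 2)%:C *: (1 : podles q s)) * (A - 1) = 0.
Proof.
have := clP (podles_BBs q s).
rewrite sclassD !sclassM !sclassD !sclassC sclassS rmorphN1 scaleN1r.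
by rewrite scale0r.
Qed.

Lemma podBsB : star B * B +
  ((q ^+ 2)%:C *: A + (s ^+ 2)%:C *: (1 : podles q s))
  * ((q ^+ 2)%:C *: A - 1) = 0.
Proof.
have := clP (podles_BsB q s).
rewrite sclassD !sclassM !sclassD !clZ !sclassC sclassS rmorphN1 scaleN1r.
by rewrite scale0r.
Qed.

End PodlesTheory.

Inductive uq_gen := genK | genKi | genE.

Section Uq.
Variables (R : realType) (q : R).

Local Notation T := (sterm R uq_gen).
Local Notation "t + u" := (SAdd t u).
Local Notation "t * u" := (SMul t u).
Local Notation cst c := (SCst (c : R)%:C).
Local Notation K := (SGen genK : T).
Local Notation Ki := (SGen genKi : T).
Local Notation E := (SGen genE : T).
Local Notation Es := (SStar E).

Inductive uq_rel : T -> T -> Prop :=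
| uq_KS : uq_rel (SStar K) K
| uq_KKi : uq_rel (K * Ki) (cst 1)
| uq_KiK : uq_rel (Ki * K) (cst 1)
| uq_KEKi : uq_rel (K * E * Ki) (cst q * E)
| uq_EEs : uq_rel (E * Es + cst (- 1) * (Es * E))
    (cst ((q - q^-1)^-1) * (K * K + cst (- 1) * (Ki * Ki))).

(* antipode_term q induces the antipode S and antipode_term q^-1 its inverse;
   in a Hopf *-algebra S (star h) = star (S^-1 h), whence the last clause. *)
Fixpoint antipode_term (c : R) (t : T) : T :=
  match t with
  | SGen genK => Ki
  | SGen genKi => K
  | SGen genE => cst (- c) * E
  | SCst k => SCst k
  | SAdd t u => antipode_term c t + antipode_term c u
  | SMul t u => antipode_term c u * antipode_term c t
  | SStar t => SStar (antipode_term c^-1 t)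
  end.

End Uq.

Notation uq q := (starAlg (uq_rel q)).

Section UqAlgebra.
Variables (R : realType) (q : R).

Definition uqK : uq q := sgen _ genK.
Definition uqKi : uq q := sgen _ genKi.
Definition uqE : uq q := sgen _ genE.


Local Notation cl := (sclass (uq_rel q)).
Local Notation T := (sterm R uq_gen).

Let clP t u : uq_rel q t u -> cl t = cl u.
Proof. by move/scong_rel/sclassP. Qed.

Let clZ c t : cl (SMul (SCst c) t) = c *: cl t.
Proof. by rewrite -sscaleE. Qed.

Let clN t : cl (SMul (SCst (-1)%:C) t) = - cl t.
Proof. by rewrite clZ rmorphN1 scaleN1r. Qed.

Let cl1 : cl (SCst 1%:C) = 1.
Proof. by []. Qed.

Lemma uqKKi : uqK * uqKi = 1.
Proof. by rewrite -sclassM; exact: clP (uq_KKi q). Qed.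

Lemma uqKiK : uqKi * uqK = 1.
Proof. by rewrite -sclassM; exact: clP (uq_KiK q). Qed.

Lemma uqKS : star uqK = uqK.
Proof. by rewrite starE; exact: clP (uq_KS q). Qed.

Lemma uqKiS : star uqKi = uqKi.
Proof.
have S1 : star (1 : uq q) = 1 by rewrite -[1 in LHS]scale1r starC conjC1 scale1r.
by rewrite -[LHS]mulr1 -uqKKi mulrA -{1}uqKS -starM uqKKi S1 mul1r.
Qed.

Lemma uqKEKi : uqK * uqE * uqKi = q%:C *: uqE.
Proof. by have := clP (uq_KEKi q); rewrite clZ !sclassM. Qed.

Lemma uqEEs : uqE * star uqE - star uqE * uqE =
  ((q - q^-1)^-1)%:C *: (uqK ^+ 2 - uqKi ^+ 2).
Proof.
have := clP (uq_EEs q).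
by rewrite clZ !sclassD !clN !sclassM sclassS -!expr2.
Qed.

Let antipode_KEKi (k ki e : uq q) c : k * e * ki = q%:C *: e ->
  k * (c *: (1 : uq q) * e * ki) = c *: (1 : uq q) * e * (q%:C *: (1 : uq q)).
Proof.
move=> keki; rewrite -sscaleAl mul1r -sscaleAr mulr1 -sscaleAl -sscaleAr mulrA.
by rewrite keki !scalerA mulrC.
Qed.

Let antipode_EEs (k ki e : uq q) (c : R) : c != 0 ->
  e * star e - star e * e = ((q - q^-1)^-1)%:C *: (k ^+ 2 - ki ^+ 2) ->
  star ((- c^-1)%:C *: (1 : uq q) * e) * ((- c)%:C *: (1 : uq q) * e)
  + (- c)%:C *: (1 : uq q) * e * star ((- c^-1)%:C *: (1 : uq q) * e)
    * ((- 1)%:C *: (1 : uq q))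
  = (ki * ki + k * k * ((- 1)%:C *: (1 : uq q)))
    * (((q - q^-1)^-1)%:C *: (1 : uq q)).
Proof.
move=> c0 ees.
have conjr (x : R) : (x%:C)^* = x%:C by exact: conjc_real.
have Zl d (a b : uq q) : (d *: a) * b = d *: (a * b) by rewrite sscaleAl.
have Zr d (a b : uq q) : a * (d *: b) = d *: (a * b) by rewrite sscaleAr.
do ?rewrite (Zl, Zr, mul1r, mulr1, starZ, conjr, scalerA).
have -> : (- c^-1)%:C * (- c)%:C = 1 by rewrite -rmorphM mulrNN mulVf.
have -> : (- c)%:C * (-1)%:C * (- c^-1)%:C = -1.
  by rewrite -!rmorphM mulrN1 opprK mulrN mulfV// rmorphN1.
rewrite rmorphN1 !scaleN1r scale1r -[LHS]opprB ees -scalerN opprB.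
by rewrite !expr2.
Qed.

Lemma antipode_term_cong (t u : T) : scong (uq_rel q) t u ->
  forall c : R, c != 0 -> cl (antipode_term c t) = cl (antipode_term c u).
Proof.
have alg (a b : T) : cl (SMul a b) = cl a * cl b :> uq q by exact: sclassM.
have alg' (a b : T) : cl (SAdd a b) = cl a + cl b :> uq q by exact: sclassD.
have algS (a : T) : cl (SStar a) = star (cl a) :> uq q by exact: sclassS.
have algC c : cl (SCst c) = c *: (1 : uq q) by exact: sclassC.
have KE : cl (SGen genK) = uqK by [].
have KiE : cl (SGen genKi) = uqKi by [].
have EE : cl (SGen genE) = uqE by [].
have cM (a b : R[i]) : (a * b) *: (1 : uq q) = (b *: (1 : uq q)) * (a *: (1 : uq q)).
  by rewrite -sscaleAr -sscaleAl mulr1 scalerA.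
elim=> {t u} /=.
- move=> t u; case=> /=.
  + by move=> c _; rewrite sclassS KiE uqKiS.
  + by move=> c _; rewrite alg KE KiE uqKKi.
  + by move=> c _; rewrite alg KE KiE uqKiK.
  + move=> c c0; rewrite !alg KE KiE EE !algC.
    exact: antipode_KEKi uqKEKi.
  + move=> c c0; rewrite !(alg', alg, algS) KE KiE EE !algC.
    exact: antipode_EEs uqEEs.
- by [].
- by move=> t u _ IH c c0; rewrite IH.
- by move=> t u v _ IH1 _ IH2 c c0; rewrite IH1 ?IH2.
- by move=> t t' u u' _ IH1 _ IH2 c c0; rewrite !alg' IH1 ?IH2.
- by move=> t t' u u' _ IH1 _ IH2 c c0; rewrite !alg IH1 ?IH2.
- by move=> t t' _ IH c c0; rewrite !algS IH ?invr_eq0.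
- by move=> t u v c _; rewrite !alg' addrA.
- by move=> t u c _; rewrite !alg' addrC.
- by move=> t c _; rewrite !alg' algC scale0r add0r.
- by move=> t c _; rewrite alg' alg !algC -sscaleAr mulr1 scaleN1r addNr scale0r.
- by move=> t u v c _; rewrite !alg mulrA.
- by move=> t c _; rewrite alg algC scale1r mulr1.
- by move=> t u v c _; rewrite !(alg, alg') mulrDr.
- by move=> t u v c _; rewrite !(alg, alg') mulrDl.
- by move=> a b c _; rewrite alg' !algC scalerDl.
- by move=> a b c _; rewrite alg !algC.
- by move=> a t c _; rewrite !alg !algC -sscaleAl -sscaleAr mul1r mulr1.
- by move=> t u c _; rewrite !(alg', algS) starD.
- by move=> t u c _; rewrite !(alg, algS) starM.
- by move=> a c _; rewrite algS !algC starC.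
- by move=> t c _; rewrite !algS starK invrK.
Qed.

Definition antipode (h : uq q) : uq q := cl (antipode_term q (repr h)).

Section AntipodeTheory.
Hypothesis q0 : q != 0.

Lemma antipodeE t : antipode (cl t) = cl (antipode_term q t).
Proof. exact: antipode_term_cong (repr_scong _ _) _ q0. Qed.

Lemma antipodeK : antipode uqK = uqKi.
Proof. by rewrite antipodeE. Qed.

Lemma antipode_E : antipode uqE = (- q%:C) *: uqE.
Proof. by rewrite antipodeE clZ rmorphN. Qed.

Lemma antipode_Es : antipode (star uqE) = (- (q^-1)%:C) *: star uqE.
Proof.
rewrite starE antipodeE /= sclassS clZ starZ -rmorphN.
rewrite [cl (SStar _)]sclassS; congr (_ *: _).
exact: conjc_real.
Qed.

Lemma antipodeD a b : antipode (a + b) = antipode a + antipode b.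
Proof.
have [[t ->] [u ->]] := conj (sclass_surj a) (sclass_surj b).
by rewrite -sclassD !antipodeE -sclassD.
Qed.

Lemma antipodeM a b : antipode (a * b) = antipode b * antipode a.
Proof.
have [[t ->] [u ->]] := conj (sclass_surj a) (sclass_surj b).
by rewrite -sclassM !antipodeE -sclassM.
Qed.

Lemma antipodeZ k a : antipode (k *: a) = k *: antipode a.
Proof.
have [t ->] := sclass_surj a; rewrite -clZ !antipodeE /=.
by rewrite sclassM sclassC -sscaleAr mulr1.
Qed.

End AntipodeTheory.

End UqAlgebra.

(* The inner product is linear in its first argument. *)
Record hilbert (R : realType) := Hilbert {
  hcarrier :> completeNormedModType R[i];
  hdot : {dot hcarrier for conjC};
  hdotE : forall x, `|x| ^+ 2 = hdot x x
}.

Section Operators.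
Variables (R : realType) (H : hilbert R).

Local Notation "<< x , y >>" := (@hdot R H x y) (format "<< x ,  y >>").

Definition antilinear (J : H -> H) :=
  forall (c : R[i]) x y, J (c *: x + y) = c^* *: J x + J y.

Definition isometric (J : H -> H) := forall x, `|J x| = `|x|.

Definition bounded_op (T : H -> H) :=
  linear T /\ exists M : R, forall x, `|T x| <= M%:C * `|x|.

Definition opcomm (S T : H -> H) : H -> H := fun x => S (T x) - T (S x).

Definition opinv (J : H -> H) (y : H) : H := xget 0 [set x | J x = y].

Definition opconj (J T : H -> H) : H -> H := fun x => J (T (opinv J x)).

(* The values of an unbounded operator outside its domain are irrelevant. *)
Record uop := Uop { udom : set H; uapp :> H -> H }.

Definition subspace (V : set H) :=
  V 0 /\ forall (c : R[i]) x y, V x -> V y -> V (c *: x + y).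

Definition linear_uop (T : uop) :=
  subspace (udom T) /\ forall (c : R[i]) x y, udom T x -> udom T y ->
    T (c *: x + y) = c *: T x + T y.

Definition antilinear_uop (T : uop) :=
  subspace (udom T) /\ forall (c : R[i]) x y, udom T x -> udom T y ->
    T (c *: x + y) = c^* *: T x + T y.

(* The graph of the adjoint of a densely defined linear, resp. antilinear,
   operator. *)
Definition adjoint (T : uop) (w y : H) :=
  forall z, udom T z -> << T z, w >> = << z, y >>.

Definition antiadjoint (T : uop) (w y : H) :=
  forall z, udom T z -> << T z, w >> = << y, z >>.

Definition selfadjoint (T : uop) :=
  [/\ linear_uop T, dense (udom T) &
      forall x y, adjoint T x y <-> udom T x /\ T x = y].

Definition positive_uop (T : uop) := forall x, udom T x -> 0 <= << T x, x >>.

(* P = (T^* T)^(1/2), for adj the graph of T^*. *)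
Definition is_abs (adj : H -> H -> Prop) (T P : uop) :=
  [/\ selfadjoint P, positive_uop P &
      forall x y, [/\ udom P x, udom P (P x) & P (P x) = y] <->
                  udom T x /\ adj (T x) y].

Definition absolute_value (T P : uop) := is_abs (adjoint T) T P.

(* J is antiunitary and T = J |T| is the polar decomposition of T; as J has
   trivial kernel, so must T. *)
Definition antiunitary_part (J : H -> H) (T : uop) :=
  [/\ antilinear J, isometric J, (forall y, exists x, J x = y),
      forall x, udom T x -> T x = 0 -> x = 0 &
      exists P, [/\ is_abs (antiadjoint T) T P, udom P = udom T &
                    forall x, udom T x -> T x = J (P x)]].

(* T is bounded, preserves dom D, and [D, T] extends to the bounded
   operator C. *)
Definition bounded_comm (D : uop) (T C : H -> H) :=
  [/\ bounded_op T, bounded_op C, forall x, udom D x -> udom D (T x) &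
      forall x, udom D x -> D (T x) - T (D x) = C x].

(* T lies in the domain of delta^j, where delta = [P, -] and P = |D|. *)
Fixpoint dom_delta (P : uop) (j : nat) (T : H -> H) : Prop :=
  match j with
  | 0 => bounded_op T
  | j'.+1 => exists C, bounded_comm P T C /\ dom_delta P j' C
  end.

Definition OP0 (P : uop) (T : H -> H) := forall j, dom_delta P j T.

Fixpoint upow (P : uop) (k : nat) : uop :=
  match k with
  | 0 => Uop setT id
  | k'.+1 => Uop [set x | udom (upow P k') x /\ udom P (upow P k' x)]
                 (fun x => P (upow P k' x))
  end.

Definition OPminfty (P : uop) (T : H -> H) :=
  bounded_op T /\
  forall k, exists2 S, OP0 P S &
    forall x, udom (upow P k) (T x) /\ upow P k (T x) = S x.

Section RealStructures.
Variables (G : Type) (rel : sterm R G -> sterm R G -> Prop).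
Variables (pi : starAlg rel -> H -> H) (D absD : uop) (gamma J : H -> H).

Definition real_signs (e e' e'' : R[i]) :=
  [/\ forall x, J (J x) = e *: x,
      (forall x, udom D (J x) <-> udom D x) /\
      (forall x, udom D x -> J (D x) = e' *: D (J x)) &
      forall x, J (gamma x) = e'' *: gamma (J x)].

Definition weak_real_structure :=
  [/\ antilinear J, isometric J,
      exists e e' e'' : R[i],
        [/\ e = 1 \/ e = -1, e' = 1 \/ e' = -1, e'' = 1 \/ e'' = -1 &
            real_signs e e' e''] ,
      forall a b, OPminfty absD (opcomm (pi a) (opconj J (pi b))) &
      forall a b, exists2 Da, bounded_comm D (pi a) Da &
                  OPminfty absD (opcomm Da (opconj J (pi b)))].

Definition KO_dimension_2 := real_signs (-1) 1 (-1).
Definition KO_dimension_6 := real_signs 1 1 (-1).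

End RealStructures.

Definition star_rep (G : Type) (rel : sterm R G -> sterm R G -> Prop)
    (pi : starAlg rel -> H -> H) :=
  (forall a, bounded_op (pi a)) /\
  (forall x, pi 1 x = x) /\
  (forall a b x, pi (a * b) x = pi a (pi b x)) /\
  (forall (c : R[i]) a b x, pi (c *: a + b) x = c *: pi a x + pi b x) /\
  (forall a x y, << pi a x, y >> = << x, pi (star a) y >>).

End Operators.

Section Spectral.
Variables (R : realType) (q s : R).

Definition qnum (x : R) : R := (q `^ x - q `^ (- x)) / (q - q^-1).

Local Notation "[[ x ]]" := (qnum x) (format "[[ x ]]").

Definition alpha (M l : R) : R :=
  [[2 * l]]^-1
  * Num.sqrt ([[2]] * [[l + M]] * [[l - M]] / ([[2 * l - 1]] * [[2 * l + 1]]))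
  * Num.sqrt ((q `^ (l + M) + q `^ (- (l + M)) * s ^+ 2)
              * (q `^ (l - M) * s ^+ 2 + q `^ (- (l - M)))).

Definition beta (M l : R) : R :=
  (([[2 * l]] - q `^ (l + M + 1) * [[2]] * [[l - M]]) * (1 - s ^+ 2)
   + q * [[2]] * [[2 * M]] * s ^+ 2)
  / (q ^+ 2 * [[2 * l]] * [[2 * l + 2]]).

Definition x1 : podles q s := (Num.sqrt (q * [[2]]))%:C *: podB q s.

Definition x0 : podles q s :=
  (1 - s ^+ 2)%:C *: (1 : podles q s) - (q * [[2]])%:C *: podA q s.

Variables (N : R) (H : hilbert R).

Local Notation "<< x , y >>" := (@hdot R H x y) (format "<< x ,  y >>").

Definition ket_index (l m M : R) :=
  [/\ exists k : nat, l = `|N| + k%:R,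
      exists2 j : nat, m = - l + j%:R & m <= l &
      M = - N \/ M = N].

Variable ket : R -> R -> R -> H.

Definition ket_span (S : set R) : set H :=
  [set v | exists n (c : 'I_n -> R[i]) (l m M : 'I_n -> R),
     (forall i, S (M i) /\ ket_index (l i) (m i) (M i)) /\
     v = \sum_i c i *: ket (l i) (m i) (M i)].

Definition all_span : set H := ket_span setT.

(* The summand H_M of H = H_{-N} (+) H_N. *)
Definition Hsub (M : R) : set H := closure (ket_span [set M]).

(* ket restricted to the index set is an orthonormal basis of H; ket vanishes
   elsewhere, so that terms outside the index set drop out of formulas. *)
Definition ket_basis :=
  [/\ forall l m M, ~ ket_index l m M -> ket l m M = 0,
      forall l m M l' m' M', ket_index l m M -> ket_index l' m' M' ->
        << ket l m M, ket l' m' M' >> = ((l, m, M) == (l', m', M'))%:R &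
      dense all_span].

Definition podles_rep (pi : podles q s -> H -> H) :=
  [/\ star_rep pi,
      forall l m M, ket_index l m M ->
        pi x1 (ket l m M) =
          (q `^ (- l + m) * Num.sqrt ([[l + m + 1]] * [[l + m + 2]])
           * alpha M (l + 1))%:C *: ket (l + 1) (m + 1) M
          - (q `^ (m + 2) * Num.sqrt ([[2]] * [[l - m]] * [[l + m + 1]])
             * beta M l)%:C *: ket l (m + 1) M
          - (q `^ (l + m + 1) * Num.sqrt ([[l - m]] * [[l - m - 1]])
             * alpha M l)%:C *: ket (l - 1) (m + 1) M &
      forall l m M, ket_index l m M ->
        pi x0 (ket l m M) =
          (q `^ m * Num.sqrt ([[2]] * [[l - m + 1]] * [[l + m + 1]])
           * alpha M (l + 1))%:C *: ket (l + 1) m M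
          + (([[2 * l]] - q `^ (l + m + 1) * [[2]] * [[l - m]])
             * beta M l)%:C *: ket l m M
          + (q `^ m * Num.sqrt ([[2]] * [[l - m]] * [[l + m]])
             * alpha M l)%:C *: ket (l - 1) m M].

Definition grading (gamma : H -> H) :=
  [/\ bounded_op gamma, forall v, Hsub (- N) v -> gamma v = v &
      forall v, Hsub N v -> gamma v = - v].

Definition dirac (D : uop H) :=
  selfadjoint D /\
  forall l m M, ket_index l m M ->
    udom D (ket l m M) /\
    D (ket l m M) = (l - `|N| + 1)%:C *: ket l m (- M).

(* Only the restriction of act h to the span of the basis is relevant. *)
Definition uq_action (act : uq q -> H -> H) :=
  (forall h v, all_span v -> all_span (act h v)) /\
  (forall h (c : R[i]) v w, all_span v -> all_span w ->
     act h (c *: v + w) = c *: act h v + act h w) /\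
  (forall v, all_span v -> act 1 v = v) /\
  (forall g h v, all_span v -> act (g * h) v = act g (act h v)) /\
  (forall (c : R[i]) g h v, all_span v ->
     act (c *: g + h) v = c *: act g v + act h v) /\
  (forall l m M, ket_index l m M ->
     act (uqK q) (ket l m M) = (q `^ m)%:C *: ket l m M) /\
  (forall l m M, ket_index l m M ->
     act (uqE q) (ket l m M) =
       (Num.sqrt ([[l - m]] * [[l + m + 1]]))%:C *: ket l (m + 1) M) /\
  (forall l m M, ket_index l m M ->
     act (star (uqE q)) (ket l m M) =
       (Num.sqrt ([[l + m]] * [[l - m + 1]]))%:C *: ket l (m - 1) M).

Definition equivariant_uop (act : uq q -> H -> H) (T : uop H) :=
  [/\ antilinear_uop T, all_span `<=` udom T,
      forall v, all_span v -> all_span (T v) &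
      forall h v, all_span v -> T (act h v) = act (star (antipode h)) (T v)].

Definition equivariant (act : uq q -> H -> H) (J : H -> H) :=
  exists2 T, equivariant_uop act T & antiunitary_part J T.

End Spectral.

(* Main.v *)
Require Import Defs.
From mathcomp Require Import all_boot all_order all_algebra.
From mathcomp Require Import sesquilinear complex.
From mathcomp Require Import boolp classical_sets reals topology normedtype exp.
From mathcomp Require Import ring lra.

Import Order.TTheory GRing.Theory Num.Theory.
Import numFieldNormedType.Exports.

Local Open Scope classical_set_scope.
Local Open Scope complex_scope.
Local Open Scope ring_scope.

(** Put u = l + m and v = l - m, so that J exchanges u and v.  Since
    alpha_{M,l} and beta_{M,l} are q^(2l) times a constant independent of M, up
    to rapidly decreasing errors, the generators are, modulo operators with
    rapidly decreasing coefficients, sums of translations of u and of shifts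
    whose weights depend on u alone and are O(q^u).  As D has eigenvalues
    affine in l and flips M, taking [D, .] multiplies such a term by the
    constant by which it shifts l and composes it with the flip.  After
    conjugation by J the same holds with v in place of u.
    A u-translation commutes with a v-term except near the boundary of the index
    set, and products of an O(q^u) and an O(q^v) term are O(q^(2l)); hence all
    commutators of generators have rapidly decreasing weights, which makes them
    smoothing, and the Leibniz rule extends this to the whole algebra.

    For equivariance, T = J K satisfies T h = S(h)^* T, and its absolute value
    is the closure of K = q^m. *)

Set Implicit Arguments.
Unset Strict Implicit.
Unset Printing Implicit Defensive.

(** * Hilbert spaces and weighted shifts *)

(** Three difficulties lie beside the asymptotics. The operators D, |D| and |T| are unbounded and
    known only on kets, while their domains enter the claims. Each is therefore replaced by a
    bounded operator (an inverse, or 1 / (1 + |T|)), identities are checked on kets, and closedness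
    of self-adjoint graphs carries them to the whole domain. The representation supplies each
    generator as a whole, not the parts into which it is split (constant, function of u, error).
    Every part has bounded weights, and an orthogonal series turns such weights into a bounded
    operator. Since D exchanges M and -M, a commutator with D is bounded only if the difference of
    the weights at M and at -M decays against l. This is why the leading parts must not depend on M,
    whereas [|D|, .] never sees M. Products are treated through commutants, not through their
    weights: with X fixed on the v side, the a for which pi a and [D, pi a] commute with X up to
    smoothing form an algebra; then a is fixed and b varies. *)

Section HilbertGeneralities.
Context {R : realType} {H : hilbert R}.
Implicit Types (x y z w : H).
Local Notation "<< x , y >>" := (@hdot R H x y) (format "<< x ,  y >>").

Lemma hdotDl x y z : << x + y, z >> = << x, z >> + << y, z >>.
Proof. exact: linearDl. Qed.

Lemma hdotDr x y z : << x, y + z >> = << x, y >> + << x, z >>.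
Proof. exact: linearDr. Qed.

Lemma hdotBl x y z : << x - y, z >> = << x, z >> - << y, z >>.
Proof. exact: linearBl. Qed.

Lemma hdotBr x y z : << x, y - z >> = << x, y >> - << x, z >>.
Proof. exact: linearBr. Qed.

Lemma hdotZl (c : R[i]) x y : << c *: x, y >> = c * << x, y >>.
Proof. exact: linearZl_LR. Qed.

Lemma hdotZr (c : R[i]) x y : << x, c *: y >> = c^* * << x, y >>.
Proof. exact: linearZr_LR. Qed.

Lemma hdot0l x : << 0, x >> = 0. Proof. exact: linear0l. Qed.
Lemma hdot0r x : << x, 0 >> = 0. Proof. exact: linear0r. Qed.

Lemma hdot_suml I (r : seq I) (P : pred I) (F : I -> H) y :
  << \sum_(i <- r | P i) F i, y >> = \sum_(i <- r | P i) << F i, y >>.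
Proof. exact: linear_sumlz. Qed.

Lemma hdot_sumr I (r : seq I) (P : pred I) (F : I -> H) y :
  << y, \sum_(i <- r | P i) F i >> = \sum_(i <- r | P i) << y, F i >>.
Proof. exact: linear_sumr. Qed.

Lemma hdotC x y : << x, y >> = << y, x >>^*.
Proof. by rewrite {1}hermC expr0 mul1r. Qed.

Lemma hnormD_orth x y : << x, y >> = 0 -> `|x + y| ^+ 2 = `|x| ^+ 2 + `|y| ^+ 2.
Proof. by move=> xy; rewrite !hdotE hnormDd. Qed.

Lemma norm_Re (V : normedZmodType R[i]) (x : V) : `|x| = (complex.Re `|x|)%:C.
Proof. by rewrite RRe_real// ger0_real. Qed.

Lemma Re_norm_ge0 (V : normedZmodType R[i]) (x : V) : 0 <= complex.Re `|x|.
Proof. by have := normr_ge0 x; rewrite norm_Re lecR. Qed.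

Lemma normC_Re (c : R[i]) : `|c| = (complex.Re `|c|)%:C.
Proof. exact: norm_Re. Qed.

Lemma realcM (a b : R) : (a * b)%:C = a%:C * b%:C.
Proof. exact: rmorphM. Qed.

Lemma realcD (a b : R) : (a + b)%:C = a%:C + b%:C.
Proof. exact: rmorphD. Qed.

Lemma realcB (a b : R) : (a - b)%:C = a%:C - b%:C.
Proof. exact: rmorphB. Qed.

Lemma realcN (a : R) : (- a)%:C = - a%:C.
Proof. exact: rmorphN. Qed.

Lemma realcV (a : R) : (a^-1)%:C = a%:C^-1.
Proof. exact: fmorphV. Qed.

Lemma conjcR (a : R) : (a%:C)^* = a%:C.
Proof. exact: conjc_real. Qed.

Lemma normcR (a : R) : `|a%:C| = `|a|%:C.
Proof. by rewrite normc_def/= expr0n addr0 sqrtr_sqr. Qed.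

Lemma hdot_cauchy_schwarz x y : `|<< x, y >>| <= `|x| * `|y|.
Proof.
have [->|y0] := eqVneq y 0; first by rewrite hdot0r !normr0 mulr0.
rewrite -(@ler_pXn2r _ 2) ?nnegrE ?mulr_ge0// exprMn.
have yy : 0 < `|y| ^+ 2 by rewrite exprn_gt0// normr_gt0.
pose c := << x, y >> / `|y| ^+ 2.
have o : << x - c *: y, c *: y >> = 0.
  by rewrite hdotZr hdotBl hdotZl -hdotE divfK ?gt_eqF// subrr mulr0.
have := hnormD_orth o; rewrite subrK normrZ exprMn => ->.
rewrite mulrDl ler_wpDl ?mulr_ge0 ?exprn_ge0//.
have -> : << x, y >> = c * `|y| ^+ 2 by rewrite divfK ?gt_eqF.
by rewrite normrM exprMn normrX normr_id -mulrA -expr2.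
Qed.

Lemma norm_small0 (V : normedZmodType R[i]) (x : V) :
  (forall e : R, 0 < e -> `|x| <= e%:C) -> x = 0.
Proof.
move=> h; apply/eqP; rewrite -normr_le0 norm_Re.
suff : complex.Re `|x| <= 0 by move=> ?; rewrite lecR.
apply/ler_addgt0Pr => e e0; rewrite add0r.
by have := h _ e0; rewrite norm_Re lecR.
Qed.

Lemma dense_approx (S : set H) x (e : R) : dense S -> 0 < e ->
  exists2 v, S v & `|x - v| < e%:C.
Proof.
move=> dS e0.
have e0' : 0 < e%:C by rewrite ltcR.
have [|v []] := dS (ball x e%:C)^° _ (open_interior _).
  by exists x; apply: nbhsx_ballx.
move=> /interior_subset; rewrite -ball_normE => xv Sv.
by exists v.
Qed.

(** Only differences and a norm bound are required of [f], so the lemma serves linear maps,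
    antilinear maps and inner products alike. [M] may be negative, hence the constant [|M| + 1] in
    the proof. *)
Lemma dense_ext0 (V : normedZmodType R[i]) (S : set H) (f : H -> V) (M : R) :
    dense S -> (forall x y, f (x - y) = f x - f y) ->
    (forall x, `|f x| <= M%:C * `|x|) -> (forall x, S x -> f x = 0) ->
  forall x, f x = 0.
Proof.
move=> dS fB fM fS x; apply: norm_small0 => e e0.
have [v Sv xv] := dense_approx x dS (divr_gt0 e0 (ltr_pwDr ltr01 (normr_ge0 M))).
have -> : f x = f (x - v) by rewrite fB (fS v)// subr0.
apply: le_trans (fM _) _.
apply: (@le_trans _ _ ((`|M| + 1)%:C * `|x - v|)).
  rewrite ler_wpM2r// lecR; apply: le_trans (ler_norm _) _.
  by rewrite lerDl.
apply: le_trans (ler_wpM2l _ (ltW xv)) _; first by rewrite lecR addr_ge0.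
by rewrite -rmorphM/= lecR mulrC divfK// gt_eqF// ltr_pwDr.
Qed.

Lemma bounded_opP (T : H -> H) : bounded_op T ->
  [/\ (forall (c : R[i]) x y, T (c *: x + y) = c *: T x + T y),
      (forall x y, T (x + y) = T x + T y), (forall x y, T (x - y) = T x - T y),
      (forall (c : R[i]) x, T (c *: x) = c *: T x) &
      T 0 = 0 /\
      (exists2 M : R, 0 <= M & forall x, `|T x| <= M%:C * `|x|)].
Proof.
move=> [lT [M hM]].
have T0 : T 0 = 0 by have := lT (-1) 0 0; rewrite scaler0 addr0 scaleN1r addNr.
have TZ (c : R[i]) x : T (c *: x) = c *: T x.
  by have := lT c x 0; rewrite T0 !addr0.
have TD x y : T (x + y) = T x + T y by have := lT 1 x y; rewrite !scale1r.
split=> //.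
  by move=> x y; rewrite -[- y]scaleN1r TD TZ scaleN1r.
split=> //; exists `|M| => // x; apply: le_trans (hM _) _.
by rewrite ler_wpM2r// lecR ler_norm.
Qed.

(** * Bounded operators from weighted orthogonal families *)

Section WeightedMap.
Variables (e f : nat -> H) (t : nat -> R[i]) (C : R).
Hypotheses (e_orth : forall n m, n <> m -> << e n, e m >> = 0)
           (f_orth : forall n m, n <> m -> << f n, f m >> = 0)
           (e_le1 : forall n, `|e n| <= 1) (f_le1 : forall n, `|f n| <= 1)
           (t_le : forall n, `|t n| <= C%:C).

Lemma orth_sum_norm (g : nat -> H) (c : nat -> R[i]) m n :
    (forall i j, i <> j -> << g i, g j >> = 0) ->
  `|\sum_(m <= i < n) c i *: g i| ^+ 2 = \sum_(m <= i < n) `|c i| ^+ 2 * `|g i| ^+ 2.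
Proof.
move=> go; elim: n => [|n IH]; first by rewrite !big_geq// normr0 expr0n.
have [mn|nm] := leqP m n; last by rewrite !big_geq// normr0 expr0n.
rewrite !big_nat_recr//= hnormD_orth ?IH ?normrZ ?exprMn//.
rewrite hdot_suml big_nat_cond big1// => i /andP[/andP[_ iltn] _].
by rewrite hdotZl hdotZr go ?mulr0// => E; rewrite E ltnn in iltn.
Qed.

Lemma bessel_ineq x n : \sum_(0 <= i < n) `|<< x, e i >>| ^+ 2 <= `|x| ^+ 2.
Proof.
pose y := \sum_(0 <= i < n) << x, e i >> *: e i.
have xy : << x, y >> = \sum_(0 <= i < n) `|<< x, e i >>| ^+ 2.
  by rewrite hdot_sumr; apply: eq_bigr => i _; rewrite hdotZr normCKC.
(* An inequality suffices and is all that holds: [e i] may have norm below 1, in particular be 0. *)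
have yy : `|y| ^+ 2 <= << x, y >>.
  rewrite orth_sum_norm// xy ler_sum// => i _.
  by rewrite ler_piMr ?exprn_ge0// exprn_ile1.
have xy0 : << x, y >>^* = << x, y >>.
  by apply/CrealP/ger0_real; rewrite (le_trans _ yy)// exprn_ge0.
have : 0 <= `|x - y| ^+ 2 by rewrite exprn_ge0.
rewrite !hdotE dnormB xy0 -!hdotE -xy opprD addrACA => h.
rewrite -subr_ge0; apply: le_trans h _.
by rewrite gerDl subr_le0.
Qed.

Let S n x := \sum_(0 <= i < n) (t i * << x, e i >>) *: f i.

Let C0 : 0 <= C.
Proof. by have := le_trans (normr_ge0 _) (t_le 0); rewrite lecR. Qed.

Let S_tail x m n : (m <= n)%N -> `|S n x - S m x| ^+ 2 <=
  (C ^+ 2)%:C * (\sum_(0 <= i < n) `|<< x, e i >>| ^+ 2 -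
                 \sum_(0 <= i < m) `|<< x, e i >>| ^+ 2).
Proof.
move=> mn; have cat (V : zmodType) (F : nat -> V) :
    \sum_(0 <= i < n) F i - \sum_(0 <= i < m) F i = \sum_(m <= i < n) F i.
  by rewrite (big_cat_nat _ mn)//= addrAC subrr add0r.
rewrite /S !cat orth_sum_norm// mulr_sumr ler_sum// => i _.
rewrite normrM exprMn -mulrA rmorphXn/= ler_pM ?exprn_ge0 ?mulr_ge0//.
  by rewrite lerXn2r ?nnegrE ?(le_trans _ (t_le i)).
by rewrite ler_piMr ?exprn_ge0// exprn_ile1.
Qed.

Let S_le n x : `|S n x| <= C%:C * `|x|.
Proof.
rewrite -(@ler_pXn2r _ 2) ?nnegrE ?mulr_ge0 ?lecR// exprMn -rmorphXn.
have := S_tail x (leq0n n); rewrite /S.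
rewrite [\sum_(0 <= i < 0) _ in X in X -> _]big_geq// [\sum_(0 <= i < 0) `|_| ^+ 2]big_geq//.
rewrite !subr0 => /le_trans; apply.
by rewrite ler_wpM2l ?bessel_ineq// lecR exprn_ge0.
Qed.

Let S_lin n (c : R[i]) x y : S n (c *: x + y) = c *: S n x + S n y.
Proof.
rewrite /S scaler_sumr -big_split; apply: eq_bigr => i _ /=.
by rewrite hdotDl hdotZl scalerA -scalerDl mulrDr mulrCA.
Qed.

Let S_cvg x : cvg (S n x @[n --> \oo]).
Proof.
apply: cauchy_cvg; apply/cauchy_exP => eps eps0.
pose b n := complex.Re (\sum_(0 <= i < n) `|<< x, e i >>| ^+ 2).
have bE n : \sum_(0 <= i < n) `|<< x, e i >>| ^+ 2 = (b n)%:C.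
  by rewrite RRe_real// ger0_real// sumr_ge0// => i _; rewrite exprn_ge0.
have epsE : eps = (complex.Re eps)%:C by rewrite RRe_real// gtr0_real.
pose d := complex.Re eps; have d0 : 0 < d by rewrite -ltcR -epsE.
have [m0 hm0] : exists m, forall n, (m <= n)%N -> (C ^+ 2) * (b n - b m) < d ^+ 2.
  have bsup : has_sup (range b).
    split; first by exists (b 0), 0.
    exists (complex.Re (`|x| ^+ 2)) => _ [n _ <-].
    by rewrite -lecR -bE RRe_real ?bessel_ineq// ger0_real// exprn_ge0.
  (* The [+ 1] avoids a vanishing denominator when [C = 0]. The index [m0] is one at which the
     increasing bounded Bessel sums [b] come this close to their supremum. *)
  have d1 : 0 < d ^+ 2 / (C ^+ 2 + 1).
    by rewrite divr_gt0 ?exprn_gt0// ltr_wpDl// exprn_ge0.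
  have [_ [m _ <-] bm] := sup_adherent d1 bsup.
  exists m => n mn.
  have bn : b n <= sup (range b) by apply: ub_le_sup; [case: bsup|exists n].
  have : b n - b m < d ^+ 2 / (C ^+ 2 + 1) by lra.
  rewrite ltr_pdivlMr ?ltr_wpDl ?exprn_ge0//; apply: le_lt_trans.
  rewrite mulrC ler_wpM2l// ?lerDl// subr_ge0 -lecR -!bE.
  by rewrite (big_cat_nat _ mn)//= lerDl sumr_ge0// => i _; rewrite exprn_ge0.
exists (S m0 x); exists m0 => // n /= mn.
rewrite -ball_normE/= distrC.
rewrite -(@ltr_pXn2r _ 2) ?nnegrE ?(ltW eps0)//.
apply: le_lt_trans (S_tail x mn) _.
by rewrite !bE epsE -!rmorphB -rmorphM -rmorphXn/= ltcR; apply: hm0.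
Qed.

(** [T] is the pointwise limit of the partial sums [S n], which are Cauchy because the squared norm
    of a tail is at most C^2 times a tail of the Bessel sums. Norms at most 1 instead of equal to 1
    let a family contain zero vectors, so that kets outside the index set need not be removed from
    an enumeration. *)
Lemma weighted_map : exists2 T : H -> H, bounded_op T &
  forall n, `|e n| = 1 -> T (e n) = t n *: f n.
Proof.
pose T x : H := lim (S n x @[n --> \oo]).
have Sn x : S n x @[n --> \oo] --> T x by exact: S_cvg.
have Se x (d : R) : 0 < d -> exists m, forall n, (m <= n)%N -> `|T x - S n x| < d%:C.
  move=> d0; have d0' : 0 < d%:C by rewrite ltcR.
  by have /cvgrPdist_lt/(_ _ d0')[m _ hm] := Sn x; exists m.
exists T.
  split.
    move=> c x y; apply: cvg_lim => //=.
    rewrite (_ : (fun n => _) = (fun n => c *: S n x + S n y)).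
      by apply: cvgD; [apply: cvgZl_tmp|].
    by apply/funext => n; rewrite S_lin.
  exists C => x; rewrite norm_Re [leRHS](_ : _ = (C * complex.Re `|x|)%:C); last first.
    by rewrite rmorphM/= -norm_Re.
  rewrite lecR; apply/ler_addgt0Pr => d d0.
  have [m /(_ _ (leqnn m)) hm] := Se x d d0.
  rewrite -lecR rmorphD rmorphM/= -!norm_Re.
  rewrite -[T x](subrK (S m x)) addrC; apply: le_trans (ler_normD _ _) _.
  by rewrite lerD// ltW.
move=> n en; apply/eqP; rewrite -subr_eq0; apply/eqP; apply: norm_small0 => d d0.
have [m hm] := Se (e n) d d0.
have := hm _ (leq_addr n.+1 m); rewrite (_ : S _ _ = t n *: f n) => [/ltW//|].
rewrite /S big_mkord.
have nlt : (n < m + n.+1)%N by rewrite addnS ltnS leq_addl.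
rewrite (bigD1 (Ordinal nlt))//= -hdotE en expr1n mulr1 big1 ?addr0// => i ni.
rewrite e_orth ?mulr0 ?scale0r// => E; case/eqP: ni; exact: val_inj.
Qed.

End WeightedMap.

End HilbertGeneralities.

(** * Self-adjoint operators and dense sets *)

Section BoundedAdditive.
Context {R : realType} {H : hilbert R}.
Implicit Types (x y z w : H) (A B T : H -> H) (P : uop H) (S : set H).
Local Notation "<< x , y >>" := (@hdot R H x y) (format "<< x ,  y >>").

(** The common ground of bounded linear and bounded antilinear maps: composites with [J] then obey
    the same density arguments. *)
Definition bounded_additive A :=
  (forall x y, A (x - y) = A x - A y) /\
  exists2 M : R, 0 <= M & forall x, `|A x| <= M%:C * `|x|.

Lemma bounded_op_additive A : bounded_op A -> bounded_additive A.
Proof. by move=> /bounded_opP[_ _ ? _ [_ ?]]. Qed.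

Lemma antilinear_additive A : antilinear A -> isometric A -> bounded_additive A.
Proof.
move=> al iso; split=> [x y|].
  by rewrite -[y]scale1r -scaleNr addrC al rmorphN1 scaleN1r scale1r addrC.
by exists 1 => // x; rewrite mul1r iso.
Qed.

Lemma bounded_additive_comp A B : bounded_additive A -> bounded_additive B ->
  bounded_additive (fun x => A (B x)).
Proof.
move=> [AB [M M0 hM]] [BB [K K0 hK]]; split=> [x y|]; first by rewrite BB AB.
exists (M * K); first exact: mulr_ge0.
move=> x; apply: le_trans (hM _) _.
by rewrite realcM -mulrA ler_wpM2l// lecR.
Qed.

Lemma bounded_additiveD A B : bounded_additive A -> bounded_additive B ->
  bounded_additive (fun x => A x + B x).
Proof.
move=> [AB [M M0 hM]] [BB [K K0 hK]]; split=> [x y|].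
  by rewrite AB BB opprD addrACA.
exists (M + K); first exact: addr_ge0.
move=> x; apply: le_trans (ler_normD _ _) _.
by rewrite realcD mulrDl; apply: lerD; [exact: hM|exact: hK].
Qed.

Lemma bounded_additiveZ A (c : R[i]) : bounded_additive A ->
  bounded_additive (fun x => c *: A x).
Proof.
move=> [AB [M M0 hM]]; split=> [x y|]; first by rewrite AB scalerBr.
exists (complex.Re `|c| * M); first by rewrite mulr_ge0// Re_norm_ge0.
move=> x; rewrite normrZ realcM -normC_Re -mulrA.
by rewrite ler_wpM2l.
Qed.

Lemma bounded_additive_ext S A B : dense S ->
  bounded_additive A -> bounded_additive B ->
  (forall x, S x -> A x = B x) -> forall x, A x = B x.
Proof.
move=> dS bA bB AB x; apply/eqP; rewrite -subr_eq0; apply/eqP.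
have [h [M _ hM]] := bounded_additiveD bA (bounded_additiveZ (-1) bB).
rewrite -scaleN1r.
apply: (@dense_ext0 _ _ _ S (fun x => A x + -1 *: B x) M dS h hM) => y Sy /=.
by rewrite AB// scaleN1r subrr.
Qed.

Lemma hdot_additive_ext S A B w z : dense S ->
  bounded_additive A -> bounded_additive B ->
  (forall x, S x -> << w, A x >> = << z, B x >>) ->
  forall x, << w, A x >> = << z, B x >>.
Proof.
move=> dS [AB [M M0 hM]] [BB [K K0 hK]] E x; apply/eqP; rewrite -subr_eq0; apply/eqP.
pose f x := << w, A x >> - << z, B x >>.
apply: (@dense_ext0 _ _ _ S f (complex.Re `|w| * M + complex.Re `|z| * K)) => //.
- by move=> a b; rewrite /f AB BB !hdotBr; ring.
- move=> a; apply: le_trans (ler_normB _ _) _.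
  rewrite realcD mulrDl !realcM -!norm_Re -!mulrA.
  by rewrite lerD// (le_trans (hdot_cauchy_schwarz _ _))// ler_wpM2l.
- by move=> a Sa; rewrite /f E// subrr.
Qed.

Lemma selfadjoint_sym P : selfadjoint P -> forall x y, udom P x -> udom P y ->
  << P x, y >> = << x, P y >>.
Proof.
move=> [_ _ sa] x y dx dy; have [_ h] := sa y (P y).
exact: (h (conj dy erefl)).
Qed.

(* The graph of a self-adjoint operator is closed, so the identity P A = B
   extends from a dense set. *)
Lemma selfadjoint_closed P S A B : selfadjoint P -> dense S ->
  bounded_additive A -> bounded_additive B ->
  (forall x, S x -> udom P (A x) /\ P (A x) = B x) ->
  forall x, udom P (A x) /\ P (A x) = B x.
Proof.
move=> saP dS bA bB h x; have [_ _ sa] := saP; apply/sa => z dz.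
apply: (hdot_additive_ext dS) => // y Sy; have [dy <-] := h _ Sy.
exact: selfadjoint_sym.
Qed.

(** * Self-adjoint operators with a bounded right inverse *)

Section Inverse.
Variables (P : uop H) (S : set H) (G : H -> H).
Hypotheses (saP : selfadjoint P) (dS : dense S) (bG : bounded_additive G)
           (PG : forall x, S x -> udom P (G x) /\ P (G x) = x).

Lemma right_inverse_dom x : udom P (G x) /\ P (G x) = x.
Proof.
apply: (selfadjoint_closed saP dS bG) => //.
by split=> //; exists 1 => // y; rewrite mul1r.
Qed.

Lemma selfadjoint_ker x : udom P x -> P x = 0 -> x = 0.
Proof.
move=> dx Px; have [dG PGx] := right_inverse_dom x.
have := selfadjoint_sym saP dG dx; rewrite PGx Px hdot0r => /eqP.
by rewrite dnorm_eq0 => /eqP.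
Qed.

Lemma left_inverse_dom x : udom P x -> G (P x) = x.
Proof.
move=> dx; have [[[_ dlin] lin] _ _] := saP.
have [dG PGx] := right_inverse_dom (P x).
apply/eqP; rewrite -subr_eq0 addrC -scaleN1r; apply/eqP.
apply: selfadjoint_ker; first exact: dlin.
by rewrite lin// PGx scaleN1r addNr.
Qed.

(** The domain of [P] is the range of [G], so the commutator may be tested on vectors [G x]. There
    it reads P T G = C G + T, where the right side is bounded; closedness of the graph of [P] then
    reduces everything to the dense set [S], domain membership included. *)
Lemma bounded_commP T C : bounded_op T -> bounded_op C ->
  (forall x, S x -> udom P (T (G x)) /\ P (T (G x)) = C (G x) + T x) ->
  bounded_comm P T C.
Proof.
move=> bT bC h.
have bTa := bounded_op_additive bT; have bCa := bounded_op_additive bC.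
have {}h x : udom P (T (G x)) /\ P (T (G x)) = C (G x) + T x.
  have bCGT := bounded_additiveD (bounded_additive_comp bCa bG) bTa.
  exact: selfadjoint_closed saP dS (bounded_additive_comp bTa bG) bCGT h x.
split=> // x dx; have := h (P x); rewrite left_inverse_dom// => -[] // _ ->.
by rewrite addrK.
Qed.

End Inverse.

End BoundedAdditive.

(** * The orthonormal basis *)

Section KetBasis.
Context {R : realType} {H : hilbert R}.
Variables (N : R) (n : int) (ket : R -> R -> R -> H).
Hypotheses (hN : 2 * N = n%:~R) (hN0 : N != 0) (hket : ket_basis N ket).
Implicit Types (x y z w : H) (A B T : H -> H) (l m M : R).
Local Notation "<< x , y >>" := (@hdot R H x y) (format "<< x ,  y >>").
Local Notation ix := (ket_index N).

Lemma ket_indexP l m M : ix l m M <->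
  exists k j : nat, [/\ l = `|N| + k%:R, m = - l + j%:R,
    (j <= `|n| + k.*2)%N & M = - N \/ M = N].
Proof.
have N2 : 2 * `|N| = `|n|%N%:R.
  by rewrite natr_absz intr_norm -hN normrM ger0_norm.
have jk (k j : nat) : (- (`|N| + k%:R) + j%:R <= `|N| + k%:R) = (j <= `|n| + k.*2)%N.
  by rewrite -(ler_nat R) natrD -N2 -mul2n natrM; apply/idP/idP; lra.
split=> [[[k lk] [j mj ml] MN]|[k [j [lk mj jn MN]]]].
  by exists k, j; split=> //; move: ml; rewrite mj lk jk.
by split=> //; [exists k|exists j => //; rewrite mj lk jk].
Qed.

Section IndexTheory.
Variables (l m M : R).
Hypothesis lmM : ix l m M.

Lemma index_ge : `|N| <= l.
Proof. by have [[k ->] _ _] := lmM; rewrite lerDl. Qed.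

Lemma index_norm_gt0 : 1 <= 2 * `|N|.
Proof.
have n0 : n != 0 by apply: contra_neq hN0 => n0; move: hN; rewrite n0; lra.
rewrite -[2]ger0_norm// -normrM hN -intr_norm ler1z.
by rewrite -gtz0_ge1 normr_gt0.
Qed.

Lemma index_gt0 : 1 <= 2 * l.
Proof. have := index_norm_gt0; have := index_ge; lra. Qed.

Lemma index_u : exists j : nat, l + m = j%:R.
Proof. by have [_ [j -> _] _] := lmM; exists j; rewrite addrA subrr add0r. Qed.

Lemma index_v : exists j : nat, l - m = j%:R.
Proof.
have /ket_indexP[k [j [lk mj jn _]]] := lmM.
exists (`|n| + k.*2 - j)%N; rewrite natrB// natrD -mul2n natrM.
rewrite natr_absz intr_norm -hN normrM ger0_norm// mj lk; lra.
Qed.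

Lemma index_u_ge0 : 0 <= l + m. Proof. by have [j ->] := index_u. Qed.
Lemma index_v_ge0 : 0 <= l - m. Proof. by have [j ->] := index_v. Qed.

Lemma index_lambda : exists k : nat, l - `|N| = k%:R.
Proof. by have [[k ->] _ _] := lmM; exists k; rewrite addrC addKr. Qed.

Lemma index_int : exists z : int, m + N = z%:~R.
Proof.
have /ket_indexP[k [j [-> -> _ _]]] := lmM.
have [N0|N0] := leP 0 N.
  by exists (j%:Z - k%:Z); rewrite ger0_norm// intrB; lra.
by exists (n + j%:Z - k%:Z); rewrite ltr0_norm// intrB intrD -hN; lra.
Qed.

Lemma index_M : M = - N \/ M = N. Proof. by case: lmM. Qed.

Lemma index_flip : ix l m (- M).
Proof. by case: lmM => ? ? [->|->]; split; rewrite ?opprK; auto. Qed.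

Lemma index_opp : ix l (- m) M.
Proof.
have [j vj] := index_v; case: lmM => hl _ hM; split=> //.
by exists j; [rewrite -vj; lra|have := index_u_ge0; lra].
Qed.

Lemma index_floor : Num.floor (- m + N) = n - Num.floor (m + N).
Proof.
have [z mz] := index_int; rewrite mz intrKfloor.
have -> : - m + N = (n - z)%:~R by rewrite intrB -hN -mz; lra.
by rewrite intrKfloor.
Qed.

End IndexTheory.

(* Shifts that stay in the quadrant u = l + m >= 0, v = l - m >= 0 leave the
   index set only through its corner l < |N|. *)
Lemma index_shift l m M (i j : int) : ix l m M ->
  0 <= l + i%:~R + (m + j%:~R) -> 0 <= l + i%:~R - (m + j%:~R) ->
  `|N| <= l + i%:~R -> ix (l + i%:~R) (m + j%:~R) M.
Proof.
move=> lmM u0 v0 l0; have [k lk] := index_lambda lmM; have [a ua] := index_u lmM.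
have pos (z : int) (r : R) : r = z%:~R -> 0 <= r -> exists p : nat, r = p%:R.
  by case: z => p -> //; [exists p|rewrite NegzE mulrNz oppr_ge0 lern0].
split; last exact: index_M lmM.
- have [||p hp] := pos (k%:Z + i) (l + i%:~R - `|N|).
  + by rewrite intrD -pmulrn -lk; lra.
  + by rewrite subr_ge0.
  + by exists p; rewrite -hp; lra.
- have [|p hp] := pos (a%:Z + i + j) (l + i%:~R + (m + j%:~R)) _ u0.
  + by rewrite !intrD -pmulrn -ua; lra.
  + by exists p; [rewrite -hp; lra|lra].
Qed.

Lemma ket_out l m M : ~ ix l m M -> ket l m M = 0.
Proof. by have [h _ _] := hket; exact: h. Qed.

Lemma ket_dot l m M l' m' M' : ix l m M -> ix l' m' M' ->
  << ket l m M, ket l' m' M' >> = ((l, m, M) == (l', m', M'))%:R.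
Proof. by have [_ h _] := hket; exact: h. Qed.

Lemma ket_orth l m M l' m' M' : (l, m, M) <> (l', m', M') ->
  << ket l m M, ket l' m' M' >> = 0.
Proof.
move=> E; have [a|a] := pselect (ix l m M); last by rewrite (ket_out a) hdot0l.
have [b|b] := pselect (ix l' m' M'); last by rewrite (ket_out b) hdot0r.
by rewrite ket_dot//; case: eqP.
Qed.

Lemma ket_norm l m M : ix l m M -> `|ket l m M| = 1.
Proof.
move=> a; apply/eqP; rewrite -sqrp_eq1// hdotE ket_dot//.
by rewrite eqxx.
Qed.

Lemma ket_norm_le1 l m M : `|ket l m M| <= 1.
Proof.
have [a|a] := pselect (ix l m M); first by rewrite ket_norm.
by rewrite ket_out// normr0.
Qed.

Lemma ket_dense : dense (all_span N ket). Proof. by case: hket. Qed.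

Lemma ket_span_ket l m M : ix l m M -> all_span N ket (ket l m M).
Proof.
move=> a; exists 1%N, (fun=> 1), (fun=> l), (fun=> m), (fun=> M); split=> //.
by rewrite big_ord1 scale1r.
Qed.

Lemma all_span_ind (K : H -> Prop) : K 0 ->
  (forall (c : R[i]) x y, K x -> K y -> K (c *: x + y)) ->
  (forall l m M, ix l m M -> K (ket l m M)) -> forall v, all_span N ket v -> K v.
Proof.
move=> K0 KD Kk v [p [c [l [m [M [h ->]]]]]].
elim/big_rec: _ => // i y _ Ky; apply: KD => //; apply: Kk; apply: (h i).2.
Qed.

Lemma ket_semilinear_ext (g : R[i] -> R[i]) A B :
  bounded_additive A -> bounded_additive B ->
  (forall c x y, A (c *: x + y) = g c *: A x + A y) ->
  (forall c x y, B (c *: x + y) = g c *: B x + B y) ->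
  (forall l m M, ix l m M -> A (ket l m M) = B (ket l m M)) ->
  forall x, A x = B x.
Proof.
move=> bA bB lA lB AB; apply: (bounded_additive_ext ket_dense bA bB).
apply: all_span_ind => //.
- have [aA _] := bA; have [aB _] := bB.
  by have := aA 0 0; have := aB 0 0; rewrite !subrr => -> ->.
- by move=> c x y Ex Ey; rewrite lA lB Ex Ey.
Qed.

Lemma ket_bounded_ext A B : bounded_op A -> bounded_op B ->
  (forall l m M, ix l m M -> A (ket l m M) = B (ket l m M)) -> A = B.
Proof.
move=> bA bB AB; apply/funext.
have [lA _ _ _ _] := bounded_opP bA; have [lB _ _ _ _] := bounded_opP bB.
exact: (@ket_semilinear_ext id _ _ (bounded_op_additive bA) (bounded_op_additive bB)).
Qed.

Lemma ket_dot_ext w z :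
  (forall l m M, ix l m M -> << w, ket l m M >> = << z, ket l m M >>) -> w = z.
Proof.
move=> h; apply/eqP; rewrite -subr_eq0 -(dnorm_eq0 (@hdot R H)) hdotBl subr_eq0.
apply/eqP; move: (w - z); apply: (hdot_additive_ext ket_dense).
- by split=> //; exists 1 => // x; rewrite mul1r.
- by split=> //; exists 1 => // x; rewrite mul1r.
- apply: all_span_ind => //; first by rewrite !hdot0r.
  by move=> c x y Ex Ey; rewrite !hdotDr !hdotZr Ex Ey.
Qed.

Definition flip (b : bool) M := if b then - M else M.

Lemma flipK b : involutive (flip b).
Proof. by case: b => M //=; rewrite opprK. Qed.

Lemma flip_index b l m M : ix l m M -> ix l m (flip b M).
Proof. by case: b => // /index_flip. Qed.

(** No boundary condition is imposed: a target outside the index set is the zero ket, and the value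
    of [c] at such a place is arbitrary. *)
Definition shift_op (c : R -> R -> R -> R[i]) (i j : int) (b : bool) T :=
  bounded_op T /\ forall l m M, ix l m M ->
    T (ket l m M) = c l m M *: ket (l + i%:~R) (m + j%:~R) (flip b M).

Lemma shift_op_exists (c : R -> R -> R -> R[i]) i j b (C : R) :
  (forall l m M, ix l m M -> `|c l m M| <= C%:C) -> exists T, shift_op c i j b T.
Proof.
move=> hc.
(* Triples (k, j, sign) code l = |N| + k, m = -l + j and M = N or -N. Codes with m > l give the zero
   ket and later the weight 0, so no subtype of valid indices is needed. Injectivity of [tr] uses N
   != -N. *)
pose tr (x : nat * nat * bool) : R * R * R :=
  let l := `|N| + x.1.1%:R in (l, - l + x.1.2%:R, flip x.2 N).
pose K (p : R * R * R) : H := ket p.1.1 p.1.2 p.2.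
have K_le1 p : `|K p| <= 1 by exact: ket_norm_le1.
have tr_inj : injective tr.
  move=> [[k j'] a] [[k' j''] a'] [] /addrI/eqP; rewrite eqr_nat => /eqP ->.
  move=> /addrI/eqP; rewrite eqr_nat => /eqP -> E; congr (_, _).
  case: a a' E => [] [] //= E; move: hN0; rewrite [N == 0](_ : _ = true)//.
    by apply/eqP; lra.
  by apply/eqP; lra.
pose fam (phi : R * R * R -> R * R * R) p : H :=
  if @pickle_inv (nat * nat * bool)%type p is Some x then K (phi (tr x)) else 0.
have fam_orth phi : injective phi -> forall p p', p <> p' -> << fam phi p, fam phi p' >> = 0.
  move=> phi_inj p p' pp'; rewrite /fam.
  have := @pickle_invK (nat * nat * bool)%type p.
  have := @pickle_invK (nat * nat * bool)%type p'.
  case: (pickle_inv p) => [x|]; case: (pickle_inv p') => [x'|] /=;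
    rewrite ?hdot0l ?hdot0r// => Ex' Ex.
  apply: ket_orth; rewrite -!surjective_pairing => /phi_inj/tr_inj E.
  by apply: pp'; rewrite -Ex -Ex' E.
have fam_le1 phi p : `|fam phi p| <= 1.
  by rewrite /fam; case: pickle_inv => [x|]; rewrite ?normr0.
pose s (p : R * R * R) := (p.1.1 + i%:~R, p.1.2 + j%:~R, flip b p.2).
have s_inj : injective s.
  move=> [[l m] M] [[l' m'] M'] [] /addIr -> /addIr -> /(congr1 (flip b)).
  by rewrite !flipK => ->.
pose t p : R[i] := if @pickle_inv (nat * nat * bool)%type p is Some x then
  let y := tr x in if `[< ix y.1.1 y.1.2 y.2 >] then c y.1.1 y.1.2 y.2 else 0 else 0.
have C0 : 0 <= C.
  have /hc : ix `|N| (- `|N|) N.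
    by split; [exists 0%N|exists 0%N|right]; rewrite ?addr0 ?ge0_cp.
  by move/(le_trans (normr_ge0 _)); rewrite lecR.
have t_le p : `|t p| <= C%:C.
  rewrite /t; case: pickle_inv => [x|]; last by rewrite normr0 lecR.
  by case: ifP => [/asboolP/hc|]; rewrite ?normr0 ?lecR.
have [T bT hT] := weighted_map (fam_orth id (@inj_id _)) (fam_orth s s_inj)
  (fam_le1 id) (fam_le1 s) t_le.
exists T; split=> // l m M lmM.
have [x E] : exists x : nat * nat * bool, tr x = (l, m, M).
  have /ket_indexP[k [j' [lk mj _ hM]]] := lmM.
  exists (k, j', `[< M = - N >]); rewrite /tr/= -lk -mj; congr (_, _).
  by case: asboolP => [->//|nM]; case: hM => // ->.
have := hT (pickle x); rewrite /fam /t pickleK_inv E /= asboolT//.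
by apply; rewrite ket_norm.
Qed.

End KetBasis.

(** * The Dirac operator and its absolute value *)

Section Dirac.
Context {R : realType} {H : hilbert R}.
Variables (N : R) (n : int) (ket : R -> R -> R -> H).
Hypotheses (hN : 2 * N = n%:~R) (hN0 : N != 0) (hket : ket_basis N ket).
Implicit Types (x y z w : H) (A B T : H -> H) (P : uop H) (l m M : R).
Local Notation "<< x , y >>" := (@hdot R H x y) (format "<< x ,  y >>").
Local Notation ix := (ket_index N).

Lemma ket_closed P A B : selfadjoint P -> bounded_op A -> bounded_op B ->
  (forall l m M, ix l m M ->
     udom P (A (ket l m M)) /\ P (A (ket l m M)) = B (ket l m M)) ->
  forall x, udom P (A x) /\ P (A x) = B x.
Proof.
move=> saP bA bB h.
have [lA _ _ _ [A0 _]] := bounded_opP bA; have [lB _ _ _ [B0 _]] := bounded_opP bB.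
have [[[d0 dlin] lin] _ _] := saP.
apply: (selfadjoint_closed saP (ket_dense hket)); [exact: bounded_op_additive..|].
apply: all_span_ind h.
- rewrite A0 B0; split=> //.
  by have := lin (-1) 0 0 d0 d0; rewrite scaler0 addr0 scaleN1r addNr.
- by move=> c x y [dx Ex] [dy Ey]; rewrite lA lB lin// Ex Ey; split=> //; exact: dlin.
Qed.

Definition lam l : R := l - `|N| + 1.

Lemma lam_ge1 l m M : ix l m M -> 1 <= lam l.
Proof. by move/index_ge => h; rewrite lerDr subr_ge0. Qed.

Lemma lam_neq0 l m M : ix l m M -> (lam l)%:C != 0.
Proof.
move=> /lam_ge1 h; rewrite gt_eqF// ltcR.
exact: lt_le_trans ltr01 h.
Qed.

(** [b = true] is the case of D and [b = false] that of |D|; both share the inverse and the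
    commutator criterion. *)
Definition diagonal_up_to_flip (b : bool) P := selfadjoint P /\
  forall l m M, ix l m M ->
    udom P (ket l m M) /\ P (ket l m M) = (lam l)%:C *: ket l m (flip b M).

Lemma dirac_diagonal P : dirac N ket P -> diagonal_up_to_flip true P.
Proof. by []. Qed.

(** Uniqueness of positive square roots is avoided. On a ket k the relation Q^2 = P^2 gives Q (Q k)
    = t^2 k with t = [lam l], so w = Q k - t k satisfies Q w = - t w, and positivity of Q forces w =
    0. *)
Lemma absolute_value_diagonal P Q : dirac N ket P -> absolute_value P Q ->
  diagonal_up_to_flip false Q.
Proof.
move=> [saP Pk] [saQ posQ QE]; split=> // l m M lmM.
have [[[_ Pdlin] Plin] _ Psa] := saP; have [[[Qd0 Qdlin] Qlin] _ _] := saQ.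
pose k := ket l m M; pose t : R[i] := (lam l)%:C.
have t_ge1 : 1 <= t by rewrite lecR (lam_ge1 lmM).
have [dk Pk1] := Pk _ _ _ lmM; have [dk' Pk2] := Pk _ _ _ (index_flip lmM).
rewrite opprK in Pk2.
have [dPk PPk] : udom P (P k) /\ P (P k) = t *: (t *: k).
  have [[[d0 _] lin] _ _] := saP.
  have P0 : P 0 = 0.
    by have := lin (-1) 0 0 d0 d0; rewrite scaler0 addr0 scaleN1r addNr.
  have := Pdlin t (ket l m (- M)) 0 dk' d0.
  have := Plin t (ket l m (- M)) 0 dk' d0.
  by rewrite P0 !addr0 Pk2 -/k -Pk1.
have [|dQ dQQ QQ] := (QE k (t *: (t *: k))).2.
  by split=> //; apply/Psa.
split=> //=; rewrite -/k -/t; apply/eqP; rewrite -subr_eq0; apply/eqP.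
pose w := Q k - t *: k.
have wE : w = - t *: k + Q k by rewrite addrC scaleNr.
have dw : udom Q w by rewrite wE; exact: Qdlin.
have Qw : Q w = - t *: w.
  by rewrite wE Qlin// QQ scalerDr !scalerA mulrNN addrC.
have := posQ _ dw; rewrite Qw hdotZl mulNr oppr_ge0 => h.
apply/eqP; rewrite -/w -(dnorm_eq0 (@hdot R H)) eq_le dnorm_ge0 andbT.
apply: le_trans h; rewrite ler_peMl ?dnorm_ge0//.
Qed.

Lemma diagonal_inverse b P : diagonal_up_to_flip b P ->
  exists2 G, shift_op N ket (fun l _ _ => (lam l)%:C^-1) 0 0 b G &
    forall x, udom P (G x) /\ P (G x) = x.
Proof.
move=> [saP Pk].
have [|G [bG hG]] := @shift_op_exists _ _ _ _ _ hN hN0 hket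
    (fun l _ _ => (lam l)%:C^-1) 0 0 b 1.
  move=> l m M lmM; rewrite normfV invf_le1 ?normr_gt0 ?(lam_neq0 lmM)//.
  by rewrite normcR lecR (le_trans (lam_ge1 lmM))// ler_norm.
exists G; first by split.
have bid : bounded_op (fun x : H => x).
  by split=> //; exists 1 => x; rewrite mul1r.
apply: (ket_closed saP bG bid) => l m M lmM.
have [[[d0 dlin] lin] _ _] := saP.
rewrite hG// !addr0.
have [dk Pk1] := Pk _ _ _ (flip_index b lmM).
have P0 : P 0 = 0.
  by have := lin (-1) 0 0 d0 d0; rewrite scaler0 addr0 scaleN1r addNr.
have := dlin (lam l)%:C^-1 _ _ dk d0; have := lin (lam l)%:C^-1 _ _ dk d0.
rewrite P0 !addr0 Pk1 flipK scalerA mulVf ?scale1r//.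
exact: lam_neq0 lmM.
Qed.

End Dirac.

(** * Bounded operators diagonal in m *)

Section Equivariance.
Context {R : realType} {H : hilbert R}.
Variables (N : R) (n : int) (ket : R -> R -> R -> H).
Hypotheses (hN : 2 * N = n%:~R) (hN0 : N != 0) (hket : ket_basis N ket).
Implicit Types (x y z w : H) (A B T : H -> H) (P : uop H) (l m M : R).
Local Notation "<< x , y >>" := (@hdot R H x y) (format "<< x ,  y >>").
Local Notation ix := (ket_index N).

Lemma adjoint_ext A B : bounded_op A -> bounded_op B ->
  (forall l m M l' m' M', ix l m M -> ix l' m' M' ->
     << A (ket l m M), ket l' m' M' >> = << ket l m M, B (ket l' m' M') >>) ->
  forall x y, << A x, y >> = << x, B y >>.
Proof.
move=> bA bB h.
have [lA _ _ _ [A0 _]] := bounded_opP bA; have [lB _ _ _ [B0 _]] := bounded_opP bB.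
have bid : bounded_additive (fun x : H => x).
  by split=> //; exists 1 => // x; rewrite mul1r.
have baA := bounded_op_additive bA; have baB := bounded_op_additive bB.
have dS := ket_dense hket.
have step l m M x : ix l m M -> << ket l m M, A x >> = << B (ket l m M), x >>.
  move=> lmM; move: x; apply: (hdot_additive_ext dS baA bid).
  apply: all_span_ind.
  - by rewrite A0 !hdot0r.
  - by move=> c x y Ex Ey; rewrite lA !hdotDr !hdotZr Ex Ey.
  - by move=> l' m' M' lmM'; rewrite hdotC h// [RHS]hdotC.
move=> x; apply: (hdot_additive_ext dS bid baB).
apply: all_span_ind.
- by rewrite B0 !hdot0r.
- by move=> c u v Eu Ev; rewrite lB !hdotDr !hdotZr Eu Ev.
- by move=> l m M lmM; rewrite hdotC step// [RHS]hdotC.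
Qed.

Definition diag_op (d : R -> R) A := bounded_op A /\
  forall l m M, ix l m M -> A (ket l m M) = (d m)%:C *: ket l m M.

Lemma diag_op_exists (d : R -> R) (C : R) :
  (forall m, `|d m| <= C) -> exists A, diag_op d A.
Proof.
move=> hd.
have [|A [bA hA]] := @shift_op_exists _ _ _ _ _ hN hN0 hket
    (fun _ m _ => (d m)%:C) 0 0 false C.
  by move=> l m M _; rewrite normcR lecR.
by exists A; split=> // l m M /hA ->; rewrite !addr0.
Qed.

Lemma diag_op_sym d A : diag_op d A -> forall x y, << A x, y >> = << x, A y >>.
Proof.
move=> [bA hA]; apply: adjoint_ext => // l m M l' m' M' a a'.
rewrite !hA// hdotZl hdotZr conjcR (ket_dot hket)//.
by case: eqP => [[_ -> _]|]; rewrite ?mulr1// !mulr0.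
Qed.

Lemma diag_op_mul d d' d'' A B C : diag_op d A -> diag_op d' B -> diag_op d'' C ->
  (forall m, d'' m = d m * d' m) -> forall x, C x = A (B x).
Proof.
move=> [bA hA] [bB hB] [bC hC] E x.
have [lA _ _ ZA _] := bounded_opP bA; have [lB _ _ ZB _] := bounded_opP bB.
have [lC _ _ _ _] := bounded_opP bC.
have bAB := bounded_additive_comp (bounded_op_additive bA) (bounded_op_additive bB).
apply: (ket_semilinear_ext hket (g := id) _ bAB) => //.
- exact: bounded_op_additive.
- by move=> c u v; rewrite lB lA.
- by move=> l m M lmM; rewrite hB// ZA hA// hC// E scalerA -realcM mulrC.
Qed.

End Equivariance.

(* An unbounded positive operator P is handled through the bounded operators
   G = 1 / (1 + P) and Q = P / (1 + P): P = Q G^-1 on the range of G. *)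
Section Quotient.
Context {R : realType} {H : hilbert R}.
Variables (G Q : H -> H) (S : set H).
Local Notation "<< x , y >>" := (@hdot R H x y) (format "<< x ,  y >>").
Hypotheses (bG : bounded_op G) (bQ : bounded_op Q)
  (symG : forall x y, << G x, y >> = << x, G y >>)
  (symQ : forall x y, << Q x, y >> = << x, Q y >>)
  (GQC : forall x, G (Q x) = Q (G x)) (GQ1 : forall x, G x + Q x = x)
  (G_inj : forall x, G x = 0 -> x = 0) (dS : dense S)
  (S_range : forall x, S x -> exists w, x = G w)
  (GQpos : forall x, 0 <= << Q (G x), x >>).
Implicit Types (x y z w : H).

Definition quotient_op : uop H :=
  Uop [set x | exists w, x = G w] (fun x => Q (xget 0 [set w | G w = x])).

Lemma quotient_opE w : quotient_op (G w) = Q w.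
Proof.
have [_ _ GB _ _] := bounded_opP bG.
rewrite /quotient_op /=; congr (Q _); case: xgetP => [w' _ /= E|]; last by move=> /(_ w)[].
by apply/eqP; rewrite -subr_eq0; apply/eqP/G_inj; rewrite GB E subrr.
Qed.

Lemma quotient_dom w : udom quotient_op (G w).
Proof. by exists w. Qed.

Lemma quotient_linear : linear_uop quotient_op.
Proof.
have [Gl _ _ _ [G0 _]] := bounded_opP bG; have [Ql _ _ _ _] := bounded_opP bQ.
split; [split|].
- by exists 0; rewrite G0.
- by move=> c _ _ [x ->] [y ->]; exists (c *: x + y); rewrite Gl.
- by move=> c _ _ [x ->] [y ->]; rewrite -Gl !quotient_opE Ql.
Qed.

Lemma quotient_selfadjoint : selfadjoint quotient_op.
Proof.
have [_ QD _ _ _] := bounded_opP bQ; have [_ GD _ _ _] := bounded_opP bG.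
split; first exact: quotient_linear.
  move=> O O0 oO; have [x [Ox Sx]] := dS O0 oO.
  by exists x; split=> //; have [w ->] := S_range Sx; exact: quotient_dom.
move=> x y; split=> [h|[[w ->] <-] z [v ->]]; last first.
  by rewrite !quotient_opE symQ -GQC symG.
(* Testing the adjoint relation on the range of [G] yields Q x = G y. Since G + Q = 1, this gives x
   = G x + Q x = G (x + y), which places x in the domain: the adjoint is no larger than the
   operator. *)
have QxGy : Q x = G y.
  apply/eqP; rewrite -subr_eq0 -(dnorm_eq0 (@hdot R H)) hdotBr.
  have := h _ (quotient_dom (Q x - G y)); rewrite quotient_opE.
  by rewrite symQ symG => ->; rewrite subrr.
have xE : x = G (x + y) by rewrite GD -QxGy GQ1.
split; first by exists (x + y).
by rewrite {1}xE quotient_opE QD QxGy GQ1.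
Qed.

Lemma quotient_positive : positive_uop quotient_op.
Proof. by move=> _ [w ->]; rewrite quotient_opE -symG GQC. Qed.

End Quotient.

(** * The real structure *)

Section RealStructure.
Context {R : realType} {H : hilbert R}.
Variables (N : R) (n : int) (ket : R -> R -> R -> H) (J : H -> H).
Hypotheses (hN : 2 * N = n%:~R) (hN0 : N != 0) (hket : ket_basis N ket)
  (hJa : antilinear J) (hJi : isometric J)
  (hJ : forall l m M, ket_index N l m M ->
     J (ket l m M) = (-1) ^ Num.floor (m + N) *: ket l (- m) (- M)).
Implicit Types (x y z w : H) (A B T : H -> H) (P : uop H) (l m M : R).
Local Notation "<< x , y >>" := (@hdot R H x y) (format "<< x ,  y >>").
Local Notation ix := (ket_index N).

Lemma sign_or (z : int) : (-1 : R[i]) ^ z = 1 \/ (-1 : R[i]) ^ z = -1.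
Proof.
have h k : (-1 : R[i]) ^+ k = 1 \/ (-1 : R[i]) ^+ k = -1.
  by rewrite -signr_odd; case: odd; rewrite ?expr1 ?expr0; auto.
case: z => k; first exact: h.
by rewrite NegzE -exprnN; case: (h k.+1) => ->; rewrite ?invrN invr1; auto.
Qed.

Lemma sign_conj (z : int) : ((-1 : R[i]) ^ z)^* = (-1) ^ z.
Proof. by case: (sign_or z) => ->; rewrite ?rmorphN rmorph1. Qed.

Lemma sign_sqr (z : int) : (-1 : R[i]) ^ z * (-1) ^ z = 1.
Proof. by case: (sign_or z) => ->; rewrite ?mulrNN mulr1. Qed.

Definition sg m : R[i] := (-1) ^ Num.floor (m + N).

(** The exponents m + N and -m + N add up to 2N = n; this is the source of the sign of J^2. *)
Lemma sg_opp l m M : ix l m M -> sg m * sg (- m) = (-1) ^ n.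
Proof.
move=> lmM; rewrite /sg (index_floor hN lmM) -expfzDr ?oppr_eq0 ?oner_eq0//.
by rewrite addrC subrK.
Qed.

Lemma J_ket l m M : ix l m M -> J (ket l m M) = sg m *: ket l (- m) (- M).
Proof. exact: hJ. Qed.

Lemma J_additive : bounded_additive J.
Proof. exact: antilinear_additive. Qed.

Lemma JZ (c : R[i]) x : J (c *: x) = c^* *: J x.
Proof.
have J0 : J 0 = 0 by have [h _] := J_additive; have := h 0 0; rewrite !subrr.
by have := hJa c x 0; rewrite J0 !addr0.
Qed.

Lemma JD x y : J (x + y) = J x + J y.
Proof. by have := hJa 1 x y; rewrite conjC1 !scale1r. Qed.

(** Polarization: isometry preserves the real part of the inner product. Applied to 'i x, where
    antilinearity gives J ('i x) = - 'i J x, the same fact shows that the imaginary part changes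
    sign. *)
Lemma J_dot x y : << J x, J y >> = << y, x >>.
Proof.
have polar a b : << a, b >> + << b, a >> = `|a + b| ^+ 2 - `|a| ^+ 2 - `|b| ^+ 2.
  by rewrite !hdotE !(hdotDl, hdotDr); ring.
have sym a b : << J a, J b >> + << J b, J a >> = << b, a >> + << a, b >>.
  by rewrite polar [RHS]addrC polar -JD !hJi.
have h : << J y, J x >> - << J x, J y >> = << x, y >> - << y, x >>.
  apply: (mulfI (neq0Ci R[i])); rewrite !mulrBr.
  have := sym ('i *: x) y; rewrite JZ !hdotZl !hdotZr conjCK !conjCi !mulNr.
  by rewrite ![- _ + _]addrC.
apply: (mulfI (_ : 2 != 0 :> R[i])); first by rewrite pnatr_eq0.
have -> : 2 * << J x, J y >> = << J x, J y >> + << J y, J x >>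
    - (<< J y, J x >> - << J x, J y >>) by ring.
by rewrite sym h; ring.
Qed.

Lemma J_sqr x : J (J x) = (-1) ^ n *: x.
Proof.
have ba := bounded_additive_comp J_additive J_additive.
have bs : bounded_additive (fun x : H => (-1) ^ n *: x).
  by apply: bounded_additiveZ; split=> //; exists 1 => // y; rewrite mul1r.
apply: (ket_semilinear_ext hket (g := id) ba bs).
- by move=> c u v; rewrite !hJa conjCK.
- by move=> c u v; rewrite scalerDr !scalerA mulrC.
- move=> l m M lmM; rewrite J_ket// JZ J_ket; last first.
    exact/(index_opp hN)/index_flip.
  by rewrite !opprK scalerA sign_conj (sg_opp lmM).
Qed.

Lemma J_surj y : exists x, J x = y.
Proof.
exists ((-1) ^ n *: J y).
by rewrite JZ sign_conj J_sqr scalerA sign_sqr scale1r.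
Qed.

Lemma opinvE y : opinv J y = (-1) ^ n *: J y.
Proof.
have J_inj u v : J u = J v -> u = v.
  move=> E; have [h _] := J_additive.
  by apply/eqP; rewrite -subr_eq0 -normr_eq0 -hJi h E subrr normr0.
apply: J_inj; rewrite JZ sign_conj J_sqr scalerA sign_sqr scale1r.
rewrite /opinv; case: xgetP => [x _ //|].
by have [x Jx] := J_surj y => /(_ x); case.
Qed.

Lemma J_grading gamma : grading N ket gamma ->
  forall x, J (gamma x) = - gamma (J x).
Proof.
move=> [bg g1 g2] x; have [lg _ _ gZ _] := bounded_opP bg.
have ba1 := bounded_additive_comp J_additive (bounded_op_additive bg).
have ba2 := bounded_additiveZ (-1)
  (bounded_additive_comp (bounded_op_additive bg) J_additive).
rewrite -scaleN1r; move: x.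
have sub l m M : ix l m M -> Hsub N ket M (ket l m M).
  move=> lmM; apply: subset_closure.
  exists 1%N, (fun=> 1), (fun=> l), (fun=> m), (fun=> M); split=> //.
  by rewrite big_ord1 scale1r.
apply: (ket_semilinear_ext hket (g := Num.Def.conjC) ba1 ba2).
- by move=> c u v; rewrite lg hJa.
- by move=> c u v; rewrite hJa lg scalerDr !scalerA mulrC.
- move=> l m M lmM; rewrite J_ket// gZ scaleN1r.
  have lmM' := index_flip (index_opp hN lmM).
  have sub' M' : M' = - M -> Hsub N ket M' (ket l (- m) (- M)).
    by move=> ->; exact: sub.
  have sub0 M' : M' = M -> Hsub N ket M' (ket l m M) by move=> ->; exact: sub.
  have [ME|ME] := index_M lmM.
  + have /g1 -> : Hsub N ket (- N) (ket l m M) by exact: sub0.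
    have /g2 -> : Hsub N ket N (ket l (- m) (- M)).
      by apply: sub'; rewrite ME opprK.
    by rewrite J_ket// scalerN opprK.
  + have /g2 -> : Hsub N ket N (ket l m M) by exact: sub0.
    have /g1 -> : Hsub N ket (- N) (ket l (- m) (- M)) by apply: sub'; rewrite ME.
    by rewrite -[- ket l m M]scaleN1r JZ rmorphN1 scaleN1r J_ket.
Qed.

(** [J] commutes with the bounded inverse [G] of [D], which can be checked on kets. Writing a domain
    vector as x = G (D x) then transfers this to [D]; the converse inclusion of domains follows from
    J^2 being a sign. *)
Lemma J_dirac D : dirac N ket D ->
  (forall x, udom D (J x) <-> udom D x) /\
  (forall x, udom D x -> J (D x) = D (J x)).
Proof.
move=> /dirac_diagonal dD; have [saD Dk] := dD.
have [G [bG hG] DG] := diagonal_inverse hN hN0 hket dD.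
have [lG _ _ GZ _] := bounded_opP bG; have baG := bounded_op_additive bG.
have GJ : forall x, J (G x) = G (J x).
  apply: (ket_semilinear_ext hket (g := Num.Def.conjC) (bounded_additive_comp J_additive baG)
    (bounded_additive_comp baG J_additive)).
  - by move=> c u v; rewrite lG hJa.
  - by move=> c u v; rewrite hJa lG.
  - move=> l m M lmM; have fo := index_flip (index_opp hN lmM).
    rewrite hG// !addr0 JZ (J_ket (index_flip lmM)) (J_ket lmM) GZ (hG _ _ _ fo).
    by rewrite /= !addr0 !scalerA mulrC -realcV conjcR.
have main x : udom D x -> udom D (J x) /\ J (D x) = D (J x).
  move=> dx.
  have <- : G (D x) = x.
    by apply: (left_inverse_dom saD (ket_dense hket)) => // y _.
  rewrite GJ; have [d1 ->] := DG (J (D x)); split=> //.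
  by have [_ ->] := DG (D x).
have [[[d0 dlin] _] _ _] := saD.
split=> [x|x dx]; last exact: (main x dx).2.
split=> [|/main[]//] /main[] /=; rewrite J_sqr => dx _.
have := dlin ((-1) ^ n) _ _ dx d0.
by rewrite addr0 scalerA sign_sqr scale1r.
Qed.

End RealStructure.

(** * Equivariance *)

Section EquivariantPart.
Context {R : realType} {H : hilbert R}.
Variables (q N : R) (n : int) (ket : R -> R -> R -> H) (J : H -> H)
  (act : uq q -> H -> H).
Hypotheses (hq : 0 < q < 1) (hN : 2 * N = n%:~R) (hN0 : N != 0)
  (hket : ket_basis N ket) (hact : uq_action N ket act)
  (hJa : antilinear J) (hJi : isometric J)
  (hJ : forall l m M, ket_index N l m M ->
     J (ket l m M) = (-1) ^ Num.floor (m + N) *: ket l (- m) (- M)).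
Implicit Types (x y z w v : H) (A B T : H -> H) (P : uop H) (l m M : R).
Local Notation "<< x , y >>" := (@hdot R H x y) (format "<< x ,  y >>").
Local Notation ix := (ket_index N).
Local Notation spn := (all_span N ket).

Let q0 : 0 < q. Proof. by case/andP: hq. Qed.

Lemma all_span_lin (c : R[i]) x y : spn x -> spn y -> spn (c *: x + y).
Proof.
move=> [n1 [c1 [l1 [m1 [M1 [h1 ->]]]]]] [n2 [c2 [l2 [m2 [M2 [h2 ->]]]]]].
pose J_ (X : Type) (f1 : 'I_n1 -> X) (f2 : 'I_n2 -> X) (i : 'I_(n1 + n2)) :=
  match split i with inl a => f1 a | inr b => f2 b end.
have Jl X f1 f2 a : @J_ X f1 f2 (lshift n2 a) = f1 a.
  by rewrite /J_ -[lshift _ _]/(unsplit (inl a)) unsplitK.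
have Jr X f1 f2 b : @J_ X f1 f2 (rshift n1 b) = f2 b.
  by rewrite /J_ -[rshift _ _]/(unsplit (inr b)) unsplitK.
exists (n1 + n2)%N, (J_ _ (fun i => c * c1 i) c2), (J_ _ l1 l2), (J_ _ m1 m2), (J_ _ M1 M2).
split; first by move=> i; rewrite /J_; case: split.
rewrite big_split_ord scaler_sumr /=; congr (_ + _); apply: eq_bigr => i _.
  by rewrite !Jl scalerA.
by rewrite !Jr.
Qed.

Lemma all_span0 : spn 0.
Proof.
exists 0%N, (fun=> 0), (fun=> 0), (fun=> 0), (fun=> 0).
by split; [case|rewrite big_ord0].
Qed.

(** * Intertwining of the quantum group action with h |-> star (antipode h) *)

Section Intertwining.
Variable T : H -> H.
Hypotheses
  (Tlin : forall (c : R[i]) x y, spn x -> spn y -> T (c *: x + y) = c^* *: T x + T y)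
  (Tket : forall l m M, ix l m M ->
     T (ket l m M) = (q `^ m)%:C *: (sg N m *: ket l (- m) (- M))).

Let T0 : T 0 = 0.
Proof.
have := Tlin (-1) all_span0 all_span0.
by rewrite scaler0 addr0 rmorphN1 scaleN1r addNr.
Qed.

Let TZ (c : R[i]) x : spn x -> T (c *: x) = c^* *: T x.
Proof. by move=> sx; have := Tlin c sx all_span0; rewrite T0 !addr0. Qed.

Let opp_index l m M : ix l m M -> ix l (- m) (- M).
Proof. by move=> h; exact: index_flip (index_opp hN h). Qed.

Lemma flip_span v : spn v -> spn (T v).
Proof.
suff h x : spn x -> spn x /\ spn (T x) by move=> /h[].
move: x; apply: all_span_ind.
- by rewrite T0; split; exact: all_span0.
- by move=> c x y [sx sTx] [sy sTy]; rewrite Tlin//; split; exact: all_span_lin.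
- move=> l m M lmM; split; first exact: ket_span_ket.
  rewrite Tket// scalerA -[_ *: _]addr0.
  apply: all_span_lin all_span0; exact/ket_span_ket/opp_index.
Qed.

Let intertwined h := forall v, spn v -> T (act h v) = act (star (antipode h)) (T v).

Let actD g h v : spn v -> act (g + h) v = act g v + act h v.
Proof.
by move=> sv; have [_ [_ [_ [_ [aL _]]]]] := hact; rewrite -[g]scale1r aL// !scale1r.
Qed.

Let actH0 v : spn v -> act 0 v = 0.
Proof. by move=> sv; apply: (addrI (act 0 v)); rewrite -actD// !addr0. Qed.

Let actZ (c : R[i]) h v : spn v -> act (c *: h) v = c *: act h v.
Proof.
move=> sv; have [_ [_ [_ [_ [aL _]]]]] := hact.
by rewrite -[c *: h]addr0 aL// actH0// addr0.
Qed.

Let act_v0 h : act h 0 = 0.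
Proof.
have [_ [aV _]] := hact; have := aV h (-1) _ _ all_span0 all_span0.
by rewrite scaler0 addr0 scaleN1r addNr.
Qed.

Let act_vZ h (c : R[i]) v : spn v -> act h (c *: v) = c *: act h v.
Proof.
move=> sv; have [_ [aV _]] := hact.
by have := aV h c _ _ sv all_span0; rewrite act_v0 !addr0.
Qed.

Let intertwined_ket h :
  (forall l m M, ix l m M ->
     T (act h (ket l m M)) = act (star (antipode h)) (T (ket l m M))) -> intertwined h.
Proof.
move=> hk x sx; have [aS [aV _]] := hact.
suff : spn x /\ T (act h x) = act (star (antipode h)) (T x) by case.
move: x sx; apply: all_span_ind.
- by split; [exact: all_span0|rewrite act_v0 T0 act_v0].
- move=> c x y [sx Ex] [sy Ey]; split; first exact: all_span_lin.
  rewrite aV// Tlin ?Ex ?Ey//; try exact: aS.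
  by rewrite Tlin// aV//; exact: flip_span.
- by move=> l m M lmM; split; [exact: ket_span_ket|exact: hk].
Qed.

Let qn0 : q != 0. Proof. by rewrite gt_eqF. Qed.

Let intertwinedD g h : intertwined g -> intertwined h -> intertwined (g + h).
Proof.
move=> hg hh v sv; have [aS _] := hact.
rewrite antipodeD// starD actD// actD; last exact: flip_span.
rewrite -hg// -hh// -[act g v]scale1r Tlin ?conjC1 ?scale1r//; exact: aS.
Qed.

(** Antipode and star both reverse products, so their composite preserves them, and the intertwined
    elements are closed under multiplication. *)
Let intertwinedM g h : intertwined g -> intertwined h -> intertwined (g * h).
Proof.
move=> hg hh v sv; have [aS [_ [_ [aM _]]]] := hact.
rewrite antipodeM// starM aM// aM; last exact: flip_span.
by rewrite hg ?hh//; exact: aS.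
Qed.

Let intertwined1 (c : R[i]) : intertwined (c *: (1 : uq q)).
Proof.
move=> v sv; have [_ [_ [a1 _]]] := hact.
rewrite antipodeZ// (_ : antipode 1 = 1); last by rewrite [LHS]antipodeE.
rewrite starC !actZ ?a1 ?TZ//; exact: flip_span.
Qed.

Let actKi_ket l m M : ix l m M ->
  act (uqKi q) (ket l m M) = (q `^ (- m))%:C *: ket l m M.
Proof.
move=> lmM; have [_ [_ [a1 [aM [_ [aK _]]]]]] := hact.
have sk := ket_span_ket ket lmM.
have := a1 _ sk; rewrite -(uqKiK q) aM// aK// act_vZ// => E.
rewrite -[in RHS]E scalerA -realcM -powRD ?addNr ?powRr0 ?scale1r//.
by rewrite (gt_eqF q0) implybT.
Qed.

Let intertwinedK : intertwined (uqK q).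
Proof.
apply: intertwined_ket => l m M lmM; have [_ [_ [_ [_ [_ [aK _]]]]]] := hact.
have sk := ket_span_ket ket lmM; have sk' := ket_span_ket ket (opp_index lmM).
rewrite antipodeK// uqKiS aK// TZ// conjcR Tket// scalerA [in RHS]act_vZ//.
rewrite actKi_ket; last exact: opp_index.
by rewrite opprK !scalerA; congr (_ *: _); ring.
Qed.

Let intertwinedKi : intertwined (uqKi q).
Proof.
apply: intertwined_ket => l m M lmM; have [_ [_ [_ [_ [_ [aK _]]]]]] := hact.
have sk := ket_span_ket ket lmM; have sk' := ket_span_ket ket (opp_index lmM).
rewrite [antipode _]antipodeE// -/(uqK q) uqKS actKi_ket// TZ// conjcR Tket//.
rewrite scalerA [in RHS]act_vZ// aK; last exact: opp_index.
by rewrite !scalerA; congr (_ *: _); ring.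
Qed.

Let sg_succ l m M : ix l m M -> sg N (m + 1) = - sg N m.
Proof.
move=> lmM; have [z mz] := index_int hN lmM; rewrite /sg addrAC mz.
have -> : z%:~R + 1 = (z + 1)%:~R :> R by rewrite intrD.
by rewrite !intrKfloor expfzDr ?oppr_eq0 ?oner_eq0// expr1z mulrN1.
Qed.

(* Holds also when m + 1 leaves the index set: both kets are then 0. *)
Let T_succ l m M : ix l m M -> T (ket l (m + 1) M) =
  - ((q `^ m)%:C * q%:C * sg N m) *: ket l (- m - 1) (- M).
Proof.
move=> lmM; have [h|h] := pselect (ix l (m + 1) M).
  rewrite Tket// (sg_succ lmM) opprD scalerA powRD ?(gt_eqF q0) ?implybT// powRr1 ?ltW//.
  by rewrite realcM mulrN.
rewrite (ket_out hket h) T0 (ket_out hket) ?scaler0// => h'.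
by apply: h; have := opp_index h'; rewrite opprD !opprK.
Qed.

Let T_pred l m M : ix l m M -> T (ket l (m - 1) M) =
  - ((q `^ m)%:C * (q^-1)%:C * sg N m) *: ket l (- m + 1) (- M).
Proof.
move=> lmM; have [h|h] := pselect (ix l (m - 1) M).
  have := sg_succ h; rewrite subrK => ->; rewrite Tket// opprD opprK scalerA.
  rewrite powRD ?(gt_eqF q0) ?implybT// powRN powRr1 ?ltW//.
  by rewrite realcM mulrN opprK.
rewrite (ket_out hket h) T0 (ket_out hket) ?scaler0// => h'.
by apply: h; have := opp_index h'; rewrite opprD !opprK.
Qed.

(** Raising m by 1 changes the sign [sg] and multiplies q^m by q; together this is the factor -q of
    S(E) = -qE. The power of q is what [J] alone would miss and the factor K of [T] provides. *)
Let intertwinedE : intertwined (uqE q).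
Proof.
apply: intertwined_ket => l m M lmM; have [_ [_ [_ [_ [_ [_ [aE aEs]]]]]]] := hact.
have lmM' := opp_index lmM; have sk' := ket_span_ket ket lmM'.
have sT := flip_span (ket_span_ket ket lmM).
rewrite antipode_E// starZ -realcN conjcR actZ// aE// TZ; last first.
  have [h|h] := pselect (ix l (m + 1) M); first exact: ket_span_ket.
  by rewrite (ket_out hket h); exact: all_span0.
rewrite conjcR T_succ// Tket// scalerA act_vZ// aEs// opprK !scalerA.
by congr (_ *: _); ring.
Qed.

Let intertwinedEs : intertwined (star (uqE q)).
Proof.
apply: intertwined_ket => l m M lmM; have [_ [_ [_ [_ [_ [_ [aE aEs]]]]]]] := hact.
have lmM' := opp_index lmM; have sk' := ket_span_ket ket lmM'.
have sT := flip_span (ket_span_ket ket lmM).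
rewrite antipode_Es// starZ starK -realcN conjcR actZ// aEs// TZ; last first.
  have [h|h] := pselect (ix l (m - 1) M); first exact: ket_span_ket.
  by rewrite (ket_out hket h); exact: all_span0.
rewrite conjcR T_pred// Tket// scalerA act_vZ// aE// opprK !scalerA.
by congr (_ *: _); ring.
Qed.

Lemma flip_intertwines h v : spn v -> T (act h v) = act (star (antipode h)) (T v).
Proof.
move: v; rewrite -/(intertwined h).
have [t ->] := sclass_surj h.
(* The claim is strengthened to h and its star at once, so that the induction on terms passes
   through [SStar]. *)
suff : intertwined (sclass (uq_rel q) t) /\ intertwined (star (sclass (uq_rel q) t)).
  by case.
elim: t => [g|c|t [ht hts] u [hu hus]|t [ht hts] u [hu hus]|t [ht hts]].
- case: g; rewrite -?[sclass _ _]/(uqK q) -?[sclass _ _]/(uqKi q) -?[sclass _ _]/(uqE q).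
  + by rewrite uqKS.
  + by rewrite uqKiS.
  + by [].
- by rewrite sclassC starC.
- by rewrite sclassD starD; split; exact: intertwinedD.
- by rewrite sclassM starM; split; exact: intertwinedM.
- by rewrite sclassS starK.
Qed.

End Intertwining.

(* 1 / (1 + |T|) and |T| / (1 + |T|) for |T| = q^m. *)
Let gw m := (1 + q `^ m)^-1.
Let qw m := q `^ m / (1 + q `^ m).
(** The square root of [gw m * qw m]: it exhibits [G Q] as the square of a symmetric operator,
    whence its positivity. *)
Let rw m := q `^ (m / 2) / (1 + q `^ m).

Let den m : 0 < 1 + q `^ m. Proof. by rewrite addr_gt0// powR_gt0. Qed.
Let gw0 m : 0 < gw m. Proof. by rewrite invr_gt0. Qed.
Let qw0 m : 0 < qw m. Proof. by rewrite divr_gt0// powR_gt0. Qed.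
Let rwE m : rw m * rw m = gw m * qw m.
Proof.
rewrite /rw /gw /qw; have -> : q `^ m = q `^ (m / 2) * q `^ (m / 2).
  by rewrite -powRD; [rewrite -splitr|rewrite (gt_eqF q0) implybT].
by ring.
Qed.

Lemma equivariant_antiunitary_part : equivariant N ket act J.
Proof.
have gq1 m : gw m + qw m = 1.
  by rewrite /gw /qw -{1}[_^-1]mul1r -mulrDl divff// gt_eqF.
have [G dG] : exists G, diag_op N ket gw G.
  apply: (diag_op_exists hN hN0 hket (C := 1)) => m.
  by rewrite gtr0_norm// -(gq1 m) lerDl ltW.
have [Q dQ] : exists Q, diag_op N ket qw Q.
  apply: (diag_op_exists hN hN0 hket (C := 1)) => m.
  by rewrite gtr0_norm// -(gq1 m) lerDr ltW.
have [U dU] : exists U, diag_op N ket rw U.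
  apply: (diag_op_exists hN hN0 hket (C := 1)) => m.
  rewrite -(@ler_pXn2r _ 2) ?nnegrE// -normrX expr2 rwE expr1n gtr0_norm; last exact: mulr_gt0.
  by have := gq1 m; have := gw0 m; have := qw0 m; nra.
have symG := diag_op_sym hket dG; have symQ := diag_op_sym hket dQ.
have symU := diag_op_sym hket dU.
have [GQ dGQ] : exists GQ, diag_op N ket (fun m => gw m * qw m) GQ.
  apply: (diag_op_exists hN hN0 hket (C := 1)) => m.
  rewrite gtr0_norm; last exact: mulr_gt0.
  by have := gq1 m; have := gw0 m; have := qw0 m; nra.
have GQ1 x : GQ x = G (Q x) by apply: (diag_op_mul hket dG dQ dGQ).
have GQ2 x : GQ x = Q (G x).
  by apply: (diag_op_mul hket dQ dG dGQ) => m; rewrite mulrC.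
have GQ3 x : GQ x = U (U x) by apply: (diag_op_mul hket dU dU dGQ) => m; rewrite rwE.
have [bG hG] := dG; have [bQ hQ] := dQ.
have [lG _ _ GZ [G0 _]] := bounded_opP bG.
have [lQ _ _ QZ [Q0 _]] := bounded_opP bQ.
have GQC x : G (Q x) = Q (G x) by rewrite -GQ1 GQ2.
have GQD : forall x, G x + Q x = x.
  have bD := bounded_additiveD (bounded_op_additive bG) (bounded_op_additive bQ).
  apply: (ket_semilinear_ext hket (g := id) bD).
  - by split=> //; exists 1 => // y; rewrite mul1r.
  - by move=> c u v; rewrite lG lQ scalerDr addrACA.
  - by [].
  - by move=> l m M lmM; rewrite hG// hQ// -scalerDl -realcD gq1 scale1r.
have inj d A : diag_op N ket d A -> (forall m, 0 < d m) -> forall x, A x = 0 -> x = 0.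
  move=> dA d0 x Ax; apply: (ket_dot_ext hket) => l m M lmM; rewrite hdot0l.
  have := diag_op_sym hket dA x (ket l m M); rewrite Ax hdot0l dA.2// hdotZr conjcR.
  move/esym/eqP; rewrite mulf_eq0 gt_eqF ?ltcR ?d0//= => /eqP //.
have G_inj := inj _ _ dG gw0; have Q_inj := inj _ _ dQ qw0.
have GQpos x : 0 <= << Q (G x), x >>.
  by rewrite -GQ2 GQ3 symU -hdotE exprn_ge0.
have kG l m M : ix l m M -> ket l m M = G ((1 + q `^ m)%:C *: ket l m M).
  by move=> lmM; rewrite GZ hG// scalerA -realcM divff ?scale1r// gt_eqF.
have span_range x : spn x -> exists w, x = G w.
  apply: (@all_span_ind _ _ N ket (fun x => exists w, x = G w)); first by exists 0; rewrite G0.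
    by move=> c u v [a ->] [b ->]; exists (c *: a + b); rewrite lG.
  by move=> l m M lmM; eexists; exact: kG.
pose P := quotient_op G Q.
have PE w : P (G w) = Q w by apply: quotient_opE.
have saP : selfadjoint P.
  exact: (quotient_selfadjoint bG bQ symG symQ GQC GQD G_inj (ket_dense hket)).
have posP : positive_uop P by exact: quotient_positive.
have [[Pd Plin] _ Psa] := saP; have [Pd0 Pdlin] := Pd.
pose T := Uop (udom P) (fun x => J (P x)).
have Tal : antilinear_uop T.
  split=> // c x y dx dy.
  by rewrite -[LHS]/(J (P (c *: x + y))) Plin// hJa.
have isoJ := J_dot hJa hJi.
have Tket l m M : ix l m M ->
    T (ket l m M) = (q `^ m)%:C *: (sg N m *: ket l (- m) (- M)).
  move=> lmM; rewrite -[LHS]/(J (P (ket l m M))) (kG _ _ _ lmM) PE QZ hQ//.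
  rewrite scalerA -realcM mulrC divfK ?gt_eqF// (JZ hJa hJi) conjcR.
  by rewrite (J_ket hJ lmM).
have spnT x : spn x -> udom P x by move=> /span_range[w ->]; exact: quotient_dom.
exists T.
  have Tlin (c : R[i]) x y : spn x -> spn y -> T (c *: x + y) = c^* *: T x + T y.
    by move=> sx sy; rewrite Tal.2//; exact: spnT.
  split=> // [v|h v]; [exact: flip_span Tlin Tket v|exact: flip_intertwines Tlin Tket h v].
split=> //; first exact: J_surj hN hket hJa hJi hJ.
  move=> _ [w ->]; rewrite -[T _]/(J (P (G w))) PE => /(congr1 Num.norm).
  by rewrite hJi normr0 => /normr0_eq0/Q_inj ->; rewrite G0.
(* For T = J P, [J_dot] turns the inner product of T z and T x into that of P x and P z. The
   antilinear adjoint relation for [T x] is thus the ordinary one for [P x], and self-adjointness of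
   [P] decides it. *)
exists P; split=> //; split=> // x y; split=> [[dx dPx PPx]|[dx h]].
  split=> // z dz; rewrite -[T z]/(J (P z)) -[T x]/(J (P x)) isoJ.
  by rewrite -PPx (selfadjoint_sym saP dPx dz).
have /Psa[dPx <-] : adjoint P (P x) y.
  move=> z dz; have := h z dz; rewrite -[T z]/(J (P z)) -[T x]/(J (P x)) isoJ => E.
  by rewrite [LHS]hdotC E -hdotC.
by split.
Qed.

End EquivariantPart.

(** * Finite sums of weighted shifts *)

Section ShiftAlgebra.
Context {R : realType} {H : hilbert R}.
Variables (N : R) (n : int) (ket : R -> R -> R -> H).
Hypotheses (hN : 2 * N = n%:~R) (hN0 : N != 0) (hket : ket_basis N ket).
Implicit Types (x y z w v : H) (A B T : H -> H) (P : uop H) (l m M : R).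
Local Notation "<< x , y >>" := (@hdot R H x y) (format "<< x ,  y >>").
Local Notation ix := (ket_index N).

Definition weight := R -> R -> R -> R.
Implicit Types (c : weight) (i j : int) (b : bool).

Definition real_shift c i j b T :=
  shift_op N ket (fun l m M => (c l m M)%:C) i j b T.

Definition index_ind l m M : R := if `[< ix l m M >] then 1 else 0.

Lemma flip_addb b b' M : flip (b (+) b') M = flip b (flip b' M).
Proof. by case: b; case: b' => //=; rewrite opprK. Qed.

Lemma flip_indexE b l m M : ix l m (flip b M) <-> ix l m M.
Proof. by split=> [/(flip_index b)|/(flip_index b)//]; rewrite flipK. Qed.

Lemma index_ind_bound l m M : 0 <= index_ind l m M <= 1.
Proof. by rewrite /index_ind; case: ifP => _; rewrite ?lexx ?ler01. Qed.

(** The indicator records that the intermediate ket vanishes outside the index set, where [c] may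
    take any value. It is evaluated at M because the index set is stable under flips. *)
Definition comp_weight c c' i' j' b' : weight := fun l m M =>
  c' l m M * (index_ind (l + i'%:~R) (m + j'%:~R) M *
              c (l + i'%:~R) (m + j'%:~R) (flip b' M)).

(** Changes the weight only where the target ket is 0, so the operator is the same; estimates may
    then assume that the final index is valid. *)
Definition cut_weight c i j : weight := fun l m M =>
  c l m M * index_ind (l + i%:~R) (m + j%:~R) M.

Lemma real_shift_cut c i j b T : real_shift c i j b T -> real_shift (cut_weight c i j) i j b T.
Proof.
move=> [bT hT]; split=> // l m M lmM; rewrite hT// /cut_weight /index_ind.
case: asboolP => h; first by rewrite mulr1.
by rewrite (ket_out hket) ?scaler0// => /flip_indexE.
Qed.

Lemma bounded_op_comp A B : bounded_op A -> bounded_op B ->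
  bounded_op (fun x => A (B x)).
Proof.
move=> bA bB; have [lA _ _ _ _] := bounded_opP bA; have [lB _ _ _ _] := bounded_opP bB.
split=> [k u v|]; first by rewrite lB lA.
have [_ [M _ hM]] := bounded_additive_comp (bounded_op_additive bA) (bounded_op_additive bB).
by exists M.
Qed.

Lemma bounded_opD A B : bounded_op A -> bounded_op B ->
  bounded_op (fun x => A x + B x).
Proof.
move=> bA bB; have [lA _ _ _ _] := bounded_opP bA; have [lB _ _ _ _] := bounded_opP bB.
split=> [k u v|]; first by rewrite lB lA scalerDr addrACA.
have [_ [M _ hM]] := bounded_additiveD (bounded_op_additive bA) (bounded_op_additive bB).
by exists M.
Qed.

Lemma bounded_opZ (k : R[i]) A : bounded_op A -> bounded_op (fun x => k *: A x).
Proof.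
move=> bA; have [lA _ _ _ _] := bounded_opP bA.
split=> [k' u v|]; first by rewrite lA scalerDr !scalerA mulrC.
by have [_ [M _ hM]] := bounded_additiveZ k (bounded_op_additive bA); exists M.
Qed.

Lemma real_shift_comp c i j b c' i' j' b' A B :
  real_shift c i j b A -> real_shift c' i' j' b' B ->
  real_shift (comp_weight c c' i' j' b') (i' + i) (j' + j) (b (+) b') (fun x => A (B x)).
Proof.
move=> [bA hA] [bB hB]; split; first exact: bounded_op_comp.
have [_ _ _ ZA [A0 _]] := bounded_opP bA.
move=> l m M lmM; rewrite hB// ZA /comp_weight /index_ind.
case: asboolP => h.
  rewrite hA; last exact/flip_indexE.
  by rewrite scalerA -realcM mul1r !intrD !addrA flip_addb.
by rewrite (ket_out hket) ?A0 ?mul0r ?mulr0 ?scaler0 ?scale0r// => /flip_indexE.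
Qed.

Lemma real_shiftB c c' i j b A B : real_shift c i j b A -> real_shift c' i j b B ->
  real_shift (fun l m M => c l m M - c' l m M) i j b (fun x => A x - B x).
Proof.
move=> [bA hA] [bB hB]; split.
  have := bounded_opD bA (bounded_opZ (-1) bB); congr bounded_op.
  by apply/funext => x; rewrite scaleN1r.
by move=> l m M lmM; rewrite hA// hB// -scalerBl -realcB.
Qed.

(** Finite complex combinations of real weighted shifts. [W] constrains weight, shift and flip
    jointly, since whether a constant weight is admissible on one side depends on the direction of
    its shift. *)
Inductive band (W : weight -> int -> int -> bool -> Prop) : (H -> H) -> Prop :=
| band_shift c i j b T of W c i j b & real_shift c i j b T : band W T
| band_add A B of band W A & band W B : band W (fun x => A x + B x)
| band_scale (k : R[i]) A of band W A : band W (fun x => k *: A x).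

Lemma band_sub (W W' : weight -> int -> int -> bool -> Prop) T :
  (forall c i j b, W c i j b -> W' c i j b) -> band W T -> band W' T.
Proof.
move=> WW'; elim=> [c i j b {}T Wc hT|A B _ hA _ hB|k A _ hA].
- by apply: band_shift hT; exact: WW'.
- exact: band_add.
- exact: band_scale.
Qed.

Lemma band_bounded W T : band W T -> bounded_op T.
Proof.
elim=> [c i j b {}T Wc [bT]//|A B _ hA _ hB|k A _ hA].
- exact: bounded_opD.
- exact: bounded_opZ.
Qed.

Lemma band_comp (W W' W'' : weight -> int -> int -> bool -> Prop) A B :
  (forall c i j b c' i' j' b', W c i j b -> W' c' i' j' b' ->
    W'' (comp_weight c c' i' j' b') (i' + i) (j' + j) (b (+) b')) ->
  band W A -> band W' B -> band W'' (fun x => A (B x)).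
Proof.
move=> hW hA hB; elim: hA => [c i j b {}A Wc sA|A1 A2 h1 ih1 h2 ih2|k A1 h1 ih1].
- have [_ DA _ ZA _] := bounded_opP sA.1.
  elim: hB => [c' i' j' b' {}B Wc' sB|B1 B2 _ ih1 _ ih2|k B1 _ ih1].
  + exact: band_shift (hW _ _ _ _ _ _ _ _ Wc Wc') (real_shift_comp sA sB).
  + have := band_add ih1 ih2; congr band; apply/funext => x.
    by rewrite DA.
  + by have := band_scale k ih1; congr band; apply/funext => x; rewrite ZA.
- exact: band_add.
- exact: band_scale.
Qed.

(** Shifts and flips commute, so both orders of composition have the same total shift and flip. The
    commutator of two weighted shifts is therefore one weighted shift, and only the difference of
    the composed weights matters. *)
Lemma band_comm (W W' W'' : weight -> int -> int -> bool -> Prop) A B :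
  (forall c i j b c' i' j' b', W c i j b -> W' c' i' j' b' ->
    W'' (cut_weight (fun l m M => comp_weight c c' i' j' b' l m M
                      - comp_weight c' c i j b l m M) (i' + i) (j' + j))
        (i' + i) (j' + j) (b (+) b')) ->
  band W A -> band W' B -> band W'' (opcomm A B).
Proof.
move=> hW hA hB; elim: hA => [c i j b {}A Wc sA|A1 A2 h1 ih1 h2 ih2|k A1 h1 ih1].
- have [_ DA _ ZA _] := bounded_opP sA.1.
  elim: hB => [c' i' j' b' {}B Wc' sB|B1 B2 _ ih1 _ ih2|k B1 _ ih1].
  + apply: (band_shift (hW _ _ _ _ _ _ _ _ Wc Wc')); apply: real_shift_cut.
    apply: (real_shiftB (real_shift_comp sA sB)).
    by rewrite addrC [j' + j]addrC addbC; exact: real_shift_comp.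
  + have := band_add ih1 ih2; congr band; apply/funext => x.
    by rewrite /opcomm DA opprD addrACA.
  + have := band_scale k ih1; congr band; apply/funext => x.
    by rewrite /opcomm ZA scalerBr.
- have [_ DB _ _ _] := bounded_opP (band_bounded hB).
  have := band_add ih1 ih2; congr band; apply/funext => x.
  by rewrite /opcomm DB opprD addrACA.
- have [_ _ _ ZB _] := bounded_opP (band_bounded hB).
  have := band_scale k ih1; congr band; apply/funext => x.
  by rewrite /opcomm ZB scalerBr.
Qed.

End ShiftAlgebra.

(** * Asymptotics of weights *)

Section Weights.
Context {R : realType}.
Variables (q N : R) (n : int).
Hypotheses (hq : 0 < q < 1) (hN : 2 * N = n%:~R) (hN0 : N != 0).
Implicit Types (c : @weight R) (i j : int) (b : bool) (l m M : R).
Local Notation ix := (ket_index N).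
Local Notation lam := (lam N).
Local Notation comp_weight := (comp_weight N).
Local Notation cut_weight := (cut_weight N).

Let q0 : 0 < q. Proof. by case/andP: hq. Qed.
Let q1 : q < 1. Proof. by case/andP: hq. Qed.

(** Induction on the degree: with t = r^2, one copy of r^k absorbs the extra factor k + 1, because
    (k + 1) r^k <= 1 / (1 - r), and the other copy is left to the induction hypothesis at r. *)
Lemma poly_geometric_bounded p (t : R) : 0 < t < 1 ->
  exists C : R, forall k : nat, (k%:R + 1) ^+ p * t ^+ k <= C.
Proof.
elim: p t => [|p IH] t /andP[t0 t1].
  by exists 1 => k; rewrite mul1r exprn_ile1// ltW.
pose r := Num.sqrt t.
have r0 : 0 < r by rewrite sqrtr_gt0.
have r1 : r < 1 by rewrite -[ltRHS]sqrtr1 ltr_sqrt.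
have rr : r ^+ 2 = t by rewrite sqr_sqrtr// ltW.
have [C hC] := IH r (introT andP (conj r0 r1)).
have C0 : 0 <= C by apply: le_trans (hC 0%N); rewrite expr0 mulr1 add0r expr1n.
exists (C * (1 - r)^-1) => k.
have -> : (k%:R + 1) ^+ p.+1 * t ^+ k =
    ((k%:R + 1) ^+ p * r ^+ k) * ((k%:R + 1) * r ^+ k).
  by rewrite -rr -exprM mulnC exprM expr2 exprS; ring.
have h1 : (k%:R + 1) * r ^+ k <= (1 - r)^-1.
  rewrite -[leRHS]mul1r ler_pdivlMr ?subr_gt0//.
  elim: k => [|k ih]; first by rewrite add0r mul1r expr0 mul1r gerBl ltW.
  have rk : r ^+ k.+1 <= 1 by rewrite exprn_ile1// ltW.
  have h1 : r * ((k%:R + 1) * r ^+ k * (1 - r)) <= r by rewrite ler_piMr// ltW.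
  have h2 : r ^+ k.+1 * (1 - r) <= 1 - r by rewrite ler_piMl// subr_ge0 ltW.
  by move: h1 h2; rewrite exprS -natr1; lra.
by rewrite ler_pM// ?mulr_ge0 ?exprn_ge0 ?addr_ge0// ltW.
Qed.

Definition bdd c := exists C : R, forall l m M, ix l m M -> `|c l m M| <= C.

Definition rapid c := forall p : nat, exists C : R, forall l m M, ix l m M ->
  `|c l m M| * lam l ^+ p <= C.

Lemma rapid_bdd c : rapid c -> bdd c.
Proof. by move=> /(_ 0%N)[C hC]; exists C => l m M /hC; rewrite expr0 mulr1. Qed.

Lemma lam_ge0 l m M : ix l m M -> 0 <= lam l.
Proof. by move=> /lam_ge1; exact: le_trans. Qed.

Lemma rapid_le c c' (C : R) : rapid c' ->
  (forall l m M, ix l m M -> `|c l m M| <= C * `|c' l m M|) -> rapid c.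
Proof.
move=> rc h p; have [K hK] := rc p; exists (`|C| * K) => l m M lmM.
apply: le_trans (_ : `|C| * (`|c' l m M| * lam l ^+ p) <= _).
  rewrite mulrA ler_wpM2r ?exprn_ge0 ?(lam_ge0 lmM)//.
  by apply: le_trans (h _ _ _ lmM) _; rewrite ler_wpM2r// ler_norm.
by rewrite ler_wpM2l// hK.
Qed.

Lemma rapid_eq c c' : rapid c' ->
  (forall l m M, ix l m M -> c l m M = c' l m M) -> rapid c.
Proof.
by move=> h E; apply: (@rapid_le c c' 1 h) => l m M lmM; rewrite E// mul1r.
Qed.

Lemma bdd_mul c c' : bdd c -> bdd c' -> bdd (fun l m M => c l m M * c' l m M).
Proof.
move=> [C hC] [K hK]; exists (C * K) => l m M lmM.
by rewrite normrM ler_pM// ?hC ?hK.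
Qed.

Lemma bdd_cst (a : R) : bdd (fun _ _ _ => a).
Proof. by exists `|a|. Qed.

Lemma rapid_mul c c' : rapid c -> bdd c' -> rapid (fun l m M => c l m M * c' l m M).
Proof.
move=> rc [C hC]; apply: (@rapid_le _ c C) => // l m M lmM.
by rewrite normrM mulrC ler_wpM2r// hC.
Qed.

Lemma rapidD c c' : rapid c -> rapid c' -> rapid (fun l m M => c l m M + c' l m M).
Proof.
move=> h h' p; have [C hC] := h p; have [C' hC'] := h' p.
exists (C + C') => l m M lmM; apply: le_trans (lerD (hC _ _ _ lmM) (hC' _ _ _ lmM)).
by rewrite -mulrDl ler_wpM2r ?exprn_ge0 ?(lam_ge0 lmM)// ler_normD.
Qed.

Lemma rapidN c : rapid c -> rapid (fun l m M => - c l m M).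
Proof.
by move=> h; apply: (@rapid_le _ c 1) => // l m M _; rewrite normrN mul1r.
Qed.

Lemma rapid_lam c : rapid c -> rapid (fun l m M => lam l * c l m M).
Proof.
move=> h p; have [C hC] := h p.+1; exists C => l m M lmM.
apply: le_trans (hC _ _ _ lmM); rewrite normrM (ger0_norm (lam_ge0 lmM)).
by rewrite exprS (_ : lam l * _ * _ = `|c l m M| * (lam l * lam l ^+ p))//; ring.
Qed.

Lemma rapid_sqrt c : rapid c -> rapid (fun l m M => Num.sqrt `|c l m M|).
Proof.
move=> h p; have [C hC] := h (p.*2); exists (Num.sqrt C) => l m M lmM.
rewrite ger0_norm ?sqrtr_ge0//.
have -> : lam l ^+ p = Num.sqrt (lam l ^+ p.*2).
  by rewrite -muln2 exprM sqrtr_sqr ger0_norm// exprn_ge0// (lam_ge0 lmM).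
by rewrite -sqrtrM// ler_wsqrtr// hC.
Qed.

Lemma powq_gt0 (x : R) : 0 < q `^ x. Proof. exact: powR_gt0. Qed.

Lemma powqD (x y : R) : q `^ (x + y) = q `^ x * q `^ y.
Proof. by rewrite powRD// (gt_eqF q0) implybT. Qed.

Lemma powq_le (x y : R) : x <= y -> q `^ y <= q `^ x.
Proof.
by apply: ger_powR; rewrite q0 ltW.
Qed.

Lemma powq_le1 (x : R) : 0 <= x -> q `^ x <= 1.
Proof. by move=> x0; rewrite -[leRHS](powRr0 q); exact: powq_le. Qed.

Lemma rapid_powq (a : R) : 0 < a -> rapid (fun l _ _ => q `^ (a * l)).
Proof.
move=> a0 p; have [|C hC] := @poly_geometric_bounded p (q `^ a).
  by by have := gt0_ltr_powR a0 _ _ q1; rewrite powR1 powq_gt0/=; apply; rewrite nnegrE ?ltW.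
exists C => l m M lmM; have [k lk] := index_lambda lmM.
apply: le_trans (hC k); rewrite /lam lk mulrC ger0_norm ?powR_ge0//.
rewrite ler_wpM2l ?exprn_ge0 ?addr_ge0// -powR_mulrn ?powR_ge0// -powRrM.
by apply: powq_le; rewrite ler_pM2l// -lk lerBlDl lerDr.
Qed.

Definition uv (e : bool) l m := if e then l + m else l - m.

Lemma uv_ge0 e l m M : ix l m M -> 0 <= uv e l m.
Proof. by move=> h; case: e; rewrite /uv; [have := index_u_ge0 h|have := index_v_ge0 hN h]. Qed.

Lemma rapid_uv c (C : R) :
  (forall l m M, ix l m M -> `|c l m M| <= C * (q `^ uv true l m * q `^ uv false l m)) ->
  rapid c.
Proof.
move=> h; apply: (@rapid_le _ _ C (rapid_powq (ltr0n R 2))) => l m M lmM.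
rewrite [`|q `^ _|]ger0_norm ?powR_ge0//; apply: le_trans (h _ _ _ lmM) _.
by rewrite -powqD (_ : 2 * l = uv true l m + uv false l m)// /uv; ring.
Qed.

Lemma rapid_cut c i j : rapid c -> rapid (cut_weight c i j).
Proof.
move=> h; apply: (@rapid_le _ _ 1 h) => l m M lmM; rewrite /cut_weight normrM mul1r.
have /andP[a b] := index_ind_bound N (l + i%:~R) (m + j%:~R) M.
by rewrite ler_piMr// ger0_norm.
Qed.

Lemma comp_bdd c c' i j b : bdd c -> bdd c' -> bdd (comp_weight c c' i j b).
Proof.
move=> [C hC] hc'; apply: bdd_mul => //; exists `|C| => l m M lmM; rewrite /index_ind.
case: asboolP => h; last by rewrite mul0r normr0.
rewrite mul1r; apply: le_trans (ler_norm C); apply: hC; exact: flip_index.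
Qed.

Lemma comp_rapid_r c c' i j b : bdd c -> rapid c' -> rapid (comp_weight c c' i j b).
Proof.
move=> [C hC] rc'; apply: rapid_mul => //; exists `|C| => l m M lmM.
rewrite /index_ind; case: asboolP => h; last by rewrite mul0r normr0.
rewrite mul1r; apply: le_trans (ler_norm C); apply: hC; exact: flip_index.
Qed.

(** A shift changes [lam] by an additive constant, which becomes a multiplicative one since
    [lam >= 1] on the index set; hence rapid decay survives translation. *)
Lemma lam_shift l m M i j : ix l m M -> ix (l + i%:~R) (m + j%:~R) M ->
  lam l <= (1 + `|i%:~R|) * lam (l + i%:~R).
Proof.
move=> h /lam_ge1 h'; have -> : lam l = lam (l + i%:~R) - i%:~R by rewrite /lam; ring.
have : - i%:~R <= `|i%:~R : R| by rewrite -normrN ler_norm.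
have := normr_ge0 (i%:~R : R); nra.
Qed.

Lemma comp_rapid_l c c' i j b : rapid c -> bdd c' -> rapid (comp_weight c c' i j b).
Proof.
move=> rc hc'.
suff : rapid (fun l m M => index_ind N (l + i%:~R) (m + j%:~R) M *
                     c (l + i%:~R) (m + j%:~R) (flip b M)).
  by move=> h; apply: rapid_eq (rapid_mul h hc') _ => l m M _; rewrite mulrC.
move=> p; have [C hC] := rc p; exists (`|C| * (1 + `|i%:~R|) ^+ p) => l m M lmM.
rewrite /index_ind; case: asboolP => h; last first.
  by rewrite mul0r normr0 mul0r mulr_ge0// exprn_ge0// addr_ge0.
rewrite mul1r; have hf := flip_index b h.
apply: le_trans (_ : `|c (l + i%:~R) (m + j%:~R) (flip b M)| *
    ((1 + `|i%:~R|) * lam (l + i%:~R)) ^+ p <= _).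
  rewrite ler_wpM2l// lerXn2r ?nnegrE ?(lam_ge0 lmM) ?(lam_shift lmM h)//.
  by apply: mulr_ge0; [exact: addr_ge0|exact: lam_ge0 h].
rewrite exprMn mulrCA mulrC ler_wpM2r ?exprn_ge0 ?addr_ge0//.
by apply: le_trans (ler_norm C); exact: hC.
Qed.

(* The three kinds of weights from which operators in the coordinate u = uv e
   are built: a translation of u at fixed uv (~~ e), an arbitrary shift with
   weight O(q^u) depending on u alone, an error rapidly decreasing in l. *)
Definition uweight (e : bool) c i j :=
  [\/ exists2 a : R, forall l m M, ix l m M -> c l m M = a & i = (if e then j else - j),
      exists2 g : R -> R, exists C : R, forall x : R, `|g x| <= C * q `^ x &
        forall l m M, ix l m M -> c l m M = g (uv e l m) |
      rapid c].

Lemma uweight_bdd e c i j : uweight e c i j -> bdd c.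
Proof.
case=> [[a ca _]|[g [C hg] cg]|/rapid_bdd//].
  by exists `|a| => l m M /ca ->.
exists `|C| => l m M lmM; rewrite cg//; apply: le_trans (hg _) _.
apply: le_trans (ler_wpM2r (powR_ge0 _ _) (ler_norm C)) _.
by rewrite ler_piMr// powq_le1// (uv_ge0 _ lmM).
Qed.

(* When one order of composition with a translation of u passes through the
   index set and the other does not, u is bounded. *)
Lemma uv_near (e : bool) i j i' j' : i = (if e then j else - j) ->
  exists U : R, forall l m M, ix l m M ->
  ix (l + (i' + i)%:~R) (m + (j' + j)%:~R) M ->
  index_ind N (l + i'%:~R) (m + j'%:~R) M != index_ind N (l + i%:~R) (m + j%:~R) M ->
  uv e l m <= U.
Proof.
move=> ij; pose nr (k : int) : R := `|k%:~R|.
exists (2 * `|N| + 2 * nr i + 2 * nr i' + nr j') => l m M lmM lmM' near.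
rewrite leNgt; apply: contra_neqN near => U.
have nle k : - k%:~R <= nr k by rewrite /nr -normrN ler_norm.
have nle' k : k%:~R <= nr k by rewrite /nr ler_norm.
have nge0 k : 0 <= nr k by exact: normr_ge0.
have ijR : i%:~R = (if e then j%:~R else - j%:~R) :> R by rewrite ij; case: (e); rewrite ?intrN.
have := (nle i, nle i', nle j', nle' j', nge0 i, nge0 i', nge0 j', index_v_ge0 hN lmM,
  index_v_ge0 hN lmM', index_u_ge0 lmM, index_u_ge0 lmM', index_ge lmM, normr_ge0 N).
case=> [[[[[[[[[[[[]]]]]]]]]]]].
move: (nr i) (nr i') (nr j') U ijR => a a' b' + +; rewrite /uv !intrD.
by case: (e) => U ijR *; rewrite /index_ind !asboolT//; apply: (index_shift lmM); lra.
Qed.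

Let coef_ge0 (g : R -> R) (C : R) : (forall x, `|g x| <= C * q `^ x) -> 0 <= C.
Proof.
by move/(_ 0); rewrite powRr0 mulr1; apply: le_trans.
Qed.

Let powq_near (U x : R) : x <= U -> 1 <= q `^ (- U) * q `^ x.
Proof.
by move=> xU; rewrite -powqD -[leLHS](powRr0 q) powq_le// addrC subr_le0.
Qed.

Let cut_bound c i j l m M (C : R) : 0 <= C ->
  (ix (l + i%:~R) (m + j%:~R) M -> `|c l m M| <= C) -> `|cut_weight c i j l m M| <= C.
Proof.
move=> C0; rewrite /cut_weight /index_ind; case: asboolP => h.
  by rewrite mulr1; apply.
by rewrite mulr0 normr0.
Qed.

Let ind_sub_le1 l m M l' m' M' : `|index_ind N l m M - index_ind N l' m' M'| <= 1.
Proof.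
by rewrite /index_ind; do 2 case: ifP => _;
  rewrite ?subrr ?subr0 ?sub0r ?normrN ?normr0 ?normr1 ?ler01.
Qed.

Local Notation comm_weight c i j b c' i' j' b' :=
  (cut_weight (fun l m M => comp_weight c c' i' j' b' l m M
                 - comp_weight c' c i j b l m M) (i' + i) (j' + j)).

Let mul_ind_eq (a b l m M : R) : (ix l m M -> a = b) ->
  index_ind N l m M * a = index_ind N l m M * b.
Proof. by rewrite /index_ind; case: asboolP => [h /(_ h) ->|]; rewrite ?mul0r. Qed.

(** Constant weights cancel unless exactly one of the two intermediate indices is valid. Then u <= U
    and v <= V, so the difference is dominated by a multiple of q^u q^v with constant q^(-U)
    q^(-V). *)
Lemma comm_rapid_const c i j b c' i' j' b' (a a' : R) :
  (forall l m M, ix l m M -> c l m M = a) -> i = j ->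
  (forall l m M, ix l m M -> c' l m M = a') -> i' = - j' ->
  rapid (comm_weight c i j b c' i' j' b').
Proof.
move=> hc ij hc' ij'.
have [U hU] := @uv_near true i j i' j' ij.
have [V hV] := @uv_near false i' j' i j ij'.
apply: (@rapid_uv _ (`|a' * a| * q `^ (- U) * q `^ (- V))) => l m M lmM.
apply: cut_bound => [|fin].
  by rewrite ?mulr_ge0 ?powR_ge0.
rewrite /comp_weight (hc' _ _ _ lmM) (hc _ _ _ lmM).
rewrite (mul_ind_eq (b := a)); last by move=> h; rewrite hc//; exact: flip_index.
rewrite [X in _ - _ * X](mul_ind_eq (b := a')); last by move=> h; rewrite hc'//; exact: flip_index.
rewrite (_ : _ - _ = a' * a * (index_ind N (l + i'%:~R) (m + j'%:~R) M -
  index_ind N (l + i%:~R) (m + j%:~R) M)); last by ring.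
have [E|near] := eqVneq (index_ind N (l + i'%:~R) (m + j'%:~R) M)
  (index_ind N (l + i%:~R) (m + j%:~R) M).
  by rewrite E subrr mulr0 normr0 !mulr_ge0 ?powR_ge0.
have u := powq_near (hU _ _ _ lmM fin near).
have v : 1 <= q `^ (- V) * q `^ uv false l m.
  by apply/powq_near/(hV _ _ _ lmM); [rewrite (addrC i) (addrC j)|rewrite eq_sym].
rewrite normrM -!mulrA ler_wpM2l//; apply: le_trans (ind_sub_le1 _ _ _ _ _ _) _.
rewrite [leRHS](_ : _ = (q `^ (- U) * q `^ uv true l m) *
  (q `^ (- V) * q `^ uv false l m)); [exact: mulr_ege1|ring].
Qed.

(** A translation of u leaves the argument v of [g] unchanged, so the weights differ only by the two
    indicators. Where these disagree u <= U, and the factor q^(-U) q^u >= 1 supplies the decay in u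
    that [g] lacks. *)
Lemma comm_rapid_l c i j b c' i' j' b' (a C : R) (g : R -> R) :
  (forall l m M, ix l m M -> c l m M = a) -> i = j ->
  (forall l m M, ix l m M -> c' l m M = g (uv false l m)) ->
  (forall x, `|g x| <= C * q `^ x) ->
  rapid (comm_weight c i j b c' i' j' b').
Proof.
move=> hc ij hc' hg; have C0 := coef_ge0 hg.
have [U hU] := @uv_near true i j i' j' ij.
apply: (@rapid_uv _ (`|a| * C * q `^ (- U))) => l m M lmM.
apply: cut_bound => [|fin]; first by rewrite !mulr_ge0 ?powR_ge0.
rewrite /comp_weight (hc' _ _ _ lmM) (hc _ _ _ lmM).
rewrite (mul_ind_eq (b := a)); last by move=> h; rewrite hc//; exact: flip_index.
rewrite [X in _ - _ * X](mul_ind_eq (b := g (uv false l m))); last first.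
  move=> h; rewrite hc'; last exact: flip_index.
  by rewrite /uv ij; congr g; ring.
rewrite (_ : _ - _ = a * g (uv false l m) * (index_ind N (l + i'%:~R) (m + j'%:~R) M -
  index_ind N (l + i%:~R) (m + j%:~R) M)); last by ring.
have [E|near] := eqVneq (index_ind N (l + i'%:~R) (m + j'%:~R) M)
  (index_ind N (l + i%:~R) (m + j%:~R) M).
  by rewrite E subrr mulr0 normr0 !mulr_ge0 ?powR_ge0.
have u := powq_near (hU _ _ _ lmM fin near).
rewrite normrM; apply: le_trans (ler_wpM2l _ (ind_sub_le1 _ _ _ _ _ _)) _ => //.
rewrite mulr1 normrM -!mulrA ler_wpM2l//; apply: le_trans (hg _) _.
rewrite ler_wpM2l// mulrA -[leLHS]mul1r ler_wpM2r ?powR_ge0//.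
Qed.

Lemma comm_rapid_r c i j b c' i' j' b' (a C : R) (g : R -> R) :
  (forall l m M, ix l m M -> c l m M = g (uv true l m)) ->
  (forall x, `|g x| <= C * q `^ x) ->
  (forall l m M, ix l m M -> c' l m M = a) -> i' = - j' ->
  rapid (comm_weight c i j b c' i' j' b').
Proof.
move=> hc hg hc' ij'; have C0 := coef_ge0 hg.
have [V hV] := @uv_near false i' j' i j ij'.
apply: (@rapid_uv _ (`|a| * C * q `^ (- V))) => l m M lmM.
apply: cut_bound => [|fin]; first by rewrite !mulr_ge0 ?powR_ge0.
rewrite /comp_weight (hc' _ _ _ lmM) (hc _ _ _ lmM).
rewrite (mul_ind_eq (b := g (uv true l m))); last first.
  move=> h; rewrite hc; last exact: flip_index.
  by rewrite /uv ij' intrN; congr g; ring.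
rewrite [X in _ - _ * X](mul_ind_eq (b := a)); last by move=> h; rewrite hc'//; exact: flip_index.
rewrite (_ : _ - _ = a * g (uv true l m) * (index_ind N (l + i'%:~R) (m + j'%:~R) M -
  index_ind N (l + i%:~R) (m + j%:~R) M)); last by ring.
have [E|near] := eqVneq (index_ind N (l + i'%:~R) (m + j'%:~R) M)
  (index_ind N (l + i%:~R) (m + j%:~R) M).
  by rewrite E subrr mulr0 normr0 !mulr_ge0 ?powR_ge0.
have v : 1 <= q `^ (- V) * q `^ uv false l m.
  by apply/powq_near/(hV _ _ _ lmM); [rewrite (addrC i) (addrC j)|rewrite eq_sym].
rewrite normrM; apply: le_trans (ler_wpM2l _ (ind_sub_le1 _ _ _ _ _ _)) _ => //.
rewrite mulr1 normrM -!mulrA ler_wpM2l//; apply: le_trans (hg _) _.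
rewrite ler_wpM2l// mulrCA -[leLHS]mulr1 ler_wpM2l ?powR_ge0//.
Qed.

Lemma comp_rapid_uv c c' i' j' b' (C C' : R) (g g' : R -> R) e e' :
  e' = ~~ e ->
  (forall l m M, ix l m M -> c l m M = g (uv e l m)) ->
  (forall x, `|g x| <= C * q `^ x) ->
  (forall l m M, ix l m M -> c' l m M = g' (uv e' l m)) ->
  (forall x, `|g' x| <= C' * q `^ x) ->
  rapid (comp_weight c c' i' j' b').
Proof.
move=> ee' hc hg hc' hg'; have C0 := coef_ge0 hg; have C'0 := coef_ge0 hg'.
(* The change of [uv e] under the first shift, at whose target [c] is evaluated. *)
pose d : R := i'%:~R + (if e then j'%:~R else - j'%:~R).
apply: (@rapid_uv _ (C' * (C * q `^ d))) => l m M lmM.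
rewrite /comp_weight (hc' _ _ _ lmM) normrM.
have -> : C' * (C * q `^ d) * (q `^ uv true l m * q `^ uv false l m) =
    (C' * q `^ uv e' l m) * (C * (q `^ d * q `^ uv e l m)).
  by rewrite ee'; case: (e); ring.
apply: ler_pM; rewrite ?normr_ge0// /index_ind; case: asboolP => h; last first.
  by rewrite mul0r normr0 !mulr_ge0// powR_ge0.
rewrite mul1r hc; last exact: flip_index.
apply: le_trans (hg _) _; rewrite -powqD (_ : uv e _ _ = d + uv e l m)//.
by rewrite /uv /d; case: (e); ring.
Qed.

Lemma comm_rapid c i j b c' i' j' b' : uweight true c i j -> uweight false c' i' j' ->
  rapid (comm_weight c i j b c' i' j' b').
Proof.
move=> wc wc'; have bc := uweight_bdd wc; have bc' := uweight_bdd wc'.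
case: wc => [[a ca ij]|[g [C hg] cg]|rc]; last first.
- by apply/rapid_cut/rapidD; [exact: comp_rapid_l|apply: rapidN; exact: comp_rapid_r].
- case: wc' => [[a' ca' ij']|[g' [C' hg'] cg']|rc'].
  + exact: comm_rapid_r cg hg ca' ij'.
  + apply/rapid_cut/rapidD.
      exact: (comp_rapid_uv _ _ _ _ cg hg cg' hg').
    by apply: rapidN; exact: (comp_rapid_uv _ _ _ _ cg' hg' cg hg).
  + by apply/rapid_cut/rapidD; [exact: comp_rapid_r|apply: rapidN; exact: comp_rapid_l].
- case: wc' => [[a' ca' ij']|[g' [C' hg'] cg']|rc'].
  + exact: comm_rapid_const ca ij ca' ij'.
  + exact: comm_rapid_l ca ij cg' hg'.
  + by apply/rapid_cut/rapidD; [exact: comp_rapid_r|apply: rapidN; exact: comp_rapid_l].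
Qed.

End Weights.

(** * Banded, smoothing and one-sided operators *)

Section OperatorClasses.
Context {R : realType} {H : hilbert R}.
Variables (q N : R) (n : int) (ket : R -> R -> R -> H).
Hypotheses (hq : 0 < q < 1) (hN : 2 * N = n%:~R) (hN0 : N != 0)
  (hket : ket_basis N ket).
Implicit Types (x y z w v : H) (A B T : H -> H) (P : uop H) (l m M : R).
Implicit Types (c : @weight R) (i j : int) (b : bool).
Local Notation "<< x , y >>" := (@hdot R H x y) (format "<< x ,  y >>").
Local Notation ix := (ket_index N).
Local Notation lam := (lam N).
Local Notation diagonal := (diagonal_up_to_flip N ket).

Definition banded := band N ket (fun c _ _ _ => bdd N c).
Definition smoothing := band N ket (fun c _ _ _ => rapid N c).
Definition sided (e : bool) := band N ket (fun c i j _ => uweight q N e c i j).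
Definition sided_even (e : bool) :=
  band N ket (fun c i j b => uweight q N e c i j /\ b = false).

Lemma smoothing_banded T : smoothing T -> banded T.
Proof. by apply: band_sub => c i j b; exact: rapid_bdd. Qed.

Lemma sided_banded e T : sided e T -> banded T.
Proof. by apply: band_sub => c i j b; exact: (uweight_bdd hq hN). Qed.

Lemma sided_even_sided e T : sided_even e T -> sided e T.
Proof. by apply: band_sub => c i j b []. Qed.

Lemma banded_comp A B : banded A -> banded B -> banded (fun x => A (B x)).
Proof. by apply: (band_comp hket) => *; exact: comp_bdd. Qed.

Lemma smoothing_banded_comp A B : smoothing A -> banded B ->
  smoothing (fun x => A (B x)).
Proof. by apply: (band_comp hket) => *; exact: comp_rapid_l. Qed.

Lemma banded_smoothing_comp A B : banded A -> smoothing B ->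
  smoothing (fun x => A (B x)).
Proof. by apply: (band_comp hket) => *; exact: comp_rapid_r. Qed.

Lemma sided_comm A B : sided true A -> sided false B -> smoothing (opcomm A B).
Proof. by apply: (band_comm hket) => *; exact: (comm_rapid hq hN). Qed.

Lemma linear_uop0 P : linear_uop P -> udom P 0 /\ P 0 = 0.
Proof.
move=> [[d0 _] lin]; split=> //.
by have := lin (-1) 0 0 d0 d0; rewrite scaler0 addr0 scaleN1r addNr.
Qed.

Lemma linear_uopZ P (k : R[i]) x : linear_uop P -> udom P x ->
  udom P (k *: x) /\ P (k *: x) = k *: P x.
Proof.
move=> lP dx; have [d0 P0] := linear_uop0 lP; have [[_ dlin] lin] := lP.
by have := dlin k _ _ dx d0; have := lin k _ _ dx d0; rewrite P0 !addr0.
Qed.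

Lemma linear_uopD P x y : linear_uop P -> udom P x -> udom P y ->
  udom P (x + y) /\ P (x + y) = P x + P y.
Proof.
move=> [[_ dlin] lin] dx dy.
by have := dlin 1 _ _ dx dy; have := lin 1 _ _ dx dy; rewrite !scale1r.
Qed.

Lemma diagonal_ketZ b P (k : R[i]) l m M : diagonal b P ->
  udom P (k *: ket l m M) /\
  P (k *: ket l m M) = (k * (lam l)%:C) *: ket l m (flip b M).
Proof.
move=> [[lP _ _] Pk]; have [h|h] := pselect (ix l m M).
  have [dk Ek] := Pk _ _ _ h; have [? ->] := linear_uopZ k lP dk.
  by rewrite Ek scalerA.
have h' : ~ ix l m (flip b M) by move/flip_indexE.
rewrite (ket_out hket h) (ket_out hket h') !scaler0; exact: linear_uop0.
Qed.

Section BoundedComm.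
Variable P : uop H.
Hypothesis lP : linear_uop P.

Lemma bounded_commD A A' C C' : bounded_comm P A C -> bounded_comm P A' C' ->
  bounded_comm P (fun x => A x + A' x) (fun x => C x + C' x).
Proof.
move=> [bA bC dA hA] [bA' bC' dA' hA'].
split; [exact: bounded_opD|exact: bounded_opD| |] => x dx.
  exact: (linear_uopD lP (dA _ dx) (dA' _ dx)).1.
have [_ ->] := linear_uopD lP (dA _ dx) (dA' _ dx).
have [_ DA _ _ _] := bounded_opP bA; have [_ DA' _ _ _] := bounded_opP bA'.
by rewrite -hA// -hA'// opprD addrACA.
Qed.

Lemma bounded_commZ (k : R[i]) A C : bounded_comm P A C ->
  bounded_comm P (fun x => k *: A x) (fun x => k *: C x).
Proof.
move=> [bA bC dA hA].
split; [exact: bounded_opZ|exact: bounded_opZ| |] => x dx.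
  exact: (linear_uopZ k lP (dA _ dx)).1.
by have [_ ->] := linear_uopZ k lP (dA _ dx); rewrite -hA// scalerBr.
Qed.

Lemma bounded_commM A A' C C' : bounded_comm P A C -> bounded_comm P A' C' ->
  bounded_comm P (fun x => A (A' x)) (fun x => C (A' x) + A (C' x)).
Proof.
move=> [bA bC dA hA] [bA' bC' dA' hA'].
split; [exact: bounded_op_comp|apply: bounded_opD; exact: bounded_op_comp| |] => x dx.
  exact/dA/dA'.
have [_ _ BA _ _] := bounded_opP bA.
rewrite -hA//; last exact: dA'.
by rewrite -hA'// BA addrA subrK.
Qed.

End BoundedComm.

(** The condition is posed at [flip b M] because the inverse of [P] sends the ket at M to [lam l]^-1
    times the ket there; dividing by [lam l] gives the relation P T G = C G + T. *)
Lemma diagonal_bounded_comm b P T C : diagonal b P -> bounded_op T -> bounded_op C ->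
  (forall l m M, ix l m M -> udom P (T (ket l m (flip b M))) /\
     P (T (ket l m (flip b M))) = C (ket l m (flip b M)) + (lam l)%:C *: T (ket l m M)) ->
  bounded_comm P T C.
Proof.
move=> dP bT bC h; have [saP _] := dP; have [lP _ _] := saP.
have [G [bG hG] PG] := diagonal_inverse hN hN0 hket dP.
have [_ _ _ ZT _] := bounded_opP bT; have [_ _ _ ZC _] := bounded_opP bC.
apply: (bounded_commP saP (ket_dense hket) (bounded_op_additive bG)) => //.
move=> x _; move: x; apply: (ket_closed hket saP (bounded_op_comp bT bG)
  (bounded_opD (bounded_op_comp bC bG) bT)) => l m M lmM.
rewrite hG// !addr0 ZT ZC; have [d E] := h _ _ _ lmM.
have [? ->] := linear_uopZ (lam l)%:C^-1 lP d; split=> //.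
by rewrite E scalerDr scalerA mulVf ?scale1r// (lam_neq0 lmM).
Qed.

(** For a single shift of l by i the commutator with |D| is i times the operator, whatever its
    weight. Bounded weights therefore suffice for all iterated commutators. *)
Lemma banded_bounded_comm P T : diagonal false P -> banded T ->
  exists2 C, banded C & bounded_comm P T C.
Proof.
move=> dP; have [[lP _ _] _] := dP.
elim=> [c i j b {}T Wc sT|A B _ [C hC1 hC2] _ [C' hC1' hC2']|k A _ [C hC1 hC2]].
- have hT := band_shift (Wc : (fun c _ _ _ => bdd N c) c i j b) sT.
  exists (fun x => (i%:~R : R)%:C *: T x); first exact: band_scale.
  have [bT Tk] := sT.
  apply: (diagonal_bounded_comm dP) => //; first exact: bounded_opZ.
  move=> l m M lmM; rewrite Tk//=; have [? ->] := diagonal_ketZ (c l m M)%:C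
    (l + i%:~R) (m + j%:~R) (flip b M) dP; split=> //=.
  by rewrite !scalerA -scalerDl -!realcM -realcD; congr (_%:C *: _); rewrite /lam; ring.
- exists (fun x => C x + C' x); first exact: band_add.
  exact: bounded_commD.
- exists (fun x => k *: C x); first exact: band_scale.
  exact: bounded_commZ.
Qed.

Lemma banded_OP0 P T : diagonal false P -> banded T -> OP0 P T.
Proof.
move=> dP bT j; elim: j T bT => [|j IH] T bT; first exact: band_bounded bT.
by have [C bC hC] := banded_bounded_comm dP bT; exists C; split=> //; exact: IH.
Qed.

Lemma smoothing_comp_diagonal P T : diagonal false P -> smoothing T ->
  exists2 T', smoothing T' & forall x, udom P (T x) /\ P (T x) = T' x.
Proof.
move=> dP; have [saP _] := dP; have [lP _ _] := saP.
elim=> [c i j b {}T rc sT|A B _ [A' hA1 hA2] _ [B' hB1 hB2]|k A _ [A' hA1 hA2]].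
(* This is [lam (l + i) * c l m M], expanded so that both terms are visibly rapid at the starting
   index. *)
- pose d : weight := fun l m M => lam l * c l m M + c l m M * i%:~R.
  have rd : rapid N d.
    apply: rapidD; first exact: rapid_lam.
    by apply: rapid_mul => //; exact: bdd_cst.
  have [C hC] := rapid_bdd rd.
  have [|T' sT'] := @shift_op_exists _ _ _ _ _ hN hN0 hket
      (fun l m M => (d l m M)%:C) i j b C.
    by move=> l m M lmM; rewrite normcR lecR hC.
  exists T'; first exact: band_shift rd sT'.
  apply: (ket_closed hket saP sT.1 sT'.1) => l m M lmM.
  rewrite sT.2// sT'.2//; have [? ->] := diagonal_ketZ (c l m M)%:C
    (l + i%:~R) (m + j%:~R) (flip b M) dP; split=> //=.
  by rewrite -realcM; congr (_%:C *: _); rewrite /d /lam; ring.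
- exists (fun x => A' x + B' x); first exact: band_add.
  move=> x; have [dA <-] := hA2 x; have [dB <-] := hB2 x; exact: linear_uopD.
- exists (fun x => k *: A' x); first exact: band_scale.
  move=> x; have [dA <-] := hA2 x; exact: linear_uopZ.
Qed.

Lemma smoothing_OPminfty P T : diagonal false P -> smoothing T -> OPminfty P T.
Proof.
move=> dP sT; split=> [|k]; first exact: band_bounded sT.
suff [S sS hS] : exists2 S, smoothing S &
    forall x, udom (upow P k) (T x) /\ upow P k (T x) = S x.
  by exists S => //; apply: banded_OP0 => //; exact: smoothing_banded.
elim: k => [|k [S sS hS]]; first by exists T.
have [S' sS' hS'] := smoothing_comp_diagonal dP sS.
exists S' => // x /=; have [d1 E1] := hS x; have [d2 E2] := hS' x.
by rewrite E1.
Qed.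

(** The weight of [D, T] compares [c] at M and at -M, multiplied by the unbounded [lam]. It stays
    bounded because constants and functions of [uv e] do not depend on M, leaving i times the
    weight, while a rapid weight absorbs the factor [lam]. *)
Lemma sided_dirac_comm e D T : diagonal true D -> sided_even e T ->
  exists2 C, sided e C & bounded_comm D T C.
Proof.
move=> dD; have [[lD _ _] _] := dD.
elim=> [c i j b {}T [Wc ->] sT|A B _ [C hC1 hC2] _ [C' hC1' hC2']|k A _ [C hC1 hC2]].
- pose d : weight := fun l m M =>
    lam (l + i%:~R) * c l m M - lam l * c l m (- M).
  have Wd : uweight q N e d i j.
    case: Wc => [[a ca ij]|[g [C hg] cg]|rc].
    + apply: Or31; exists (i%:~R * a) => // l m M lmM.
      by rewrite /d !ca//; [rewrite /lam; ring|exact: index_flip].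
    + apply: Or32; exists (fun x : R => i%:~R * g x).
        exists (`|i%:~R| * C) => x.
        by rewrite normrM -mulrA ler_wpM2l.
      move=> l m M lmM.
      by rewrite /d !cg//; [rewrite /lam; ring|exact: index_flip].
    + apply: Or33.
      have rc' : rapid N (fun l m M => c l m (- M)).
        by move=> p; have [C hC] := rc p; exists C => l m M /index_flip/hC.
      have h1 := rapidD (rapid_lam rc)
        (rapid_mul rc (bdd_cst N (i%:~R : R))).
      apply: rapid_eq (rapidD h1 (rapidN (rapid_lam rc'))) _ => l m M _.
      by rewrite /d /lam; ring.
  have [C hC] := uweight_bdd hq hN Wd.
  have [|T' sT'] := @shift_op_exists _ _ _ _ _ hN hN0 hket
      (fun l m M => (d l m M)%:C) i j true C.
    by move=> l m M lmM; rewrite normcR lecR hC.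
  exists T'; first exact: band_shift Wd sT'.
  have [bT Tk] := sT; have [bT' Tk'] := sT'.
  apply: (diagonal_bounded_comm dD) => // l m M lmM.
  have lmM' := index_flip lmM.
  rewrite /= (Tk _ _ _ lmM') (Tk' _ _ _ lmM') (Tk _ _ _ lmM) /=.
  have [? ->] := diagonal_ketZ (c l m (- M))%:C
    (l + i%:~R) (m + j%:~R) (- M) dD; split=> //=.
  rewrite opprK scalerA -scalerDl -!realcM -realcD; congr (_%:C *: _).
  by rewrite /d opprK; ring.
- exists (fun x => C x + C' x); first exact: band_add.
  exact: bounded_commD.
- exists (fun x => k *: C x); first exact: band_scale.
  exact: bounded_commZ.
Qed.

(** The adjoint is the opposite shift with weight [c] taken at the shifted-back index. This
    determines [d] only where that index is valid; elsewhere [d] is extended so as to remain of the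
    same kind: the same constant, a translate of [g], or 0. *)
Lemma sided_even_adjoint e T : sided_even e T ->
  exists2 T', sided_even e T' & forall x y, << T x, y >> = << x, T' y >>.
Proof.
elim=> [c i j b {}T [Wc ->] sT|A B _ [A' hA1 hA2] _ [B' hB1 hB2]|k A _ [A' hA1 hA2]].
- have [d Wd dE] : exists2 d : weight, uweight q N e d (- i) (- j) &
      forall l m M, ix l m M -> ix (l - i%:~R) (m - j%:~R) M ->
        d l m M = c (l - i%:~R) (m - j%:~R) M.
    case: Wc => [[a ca ij]|[g [C hg] cg]|rc].
    + exists (fun _ _ _ => a); last by move=> l m M _ /ca.
      by apply: Or31; exists a => //; rewrite ij; case: (e).
    + pose t : R := i%:~R + (if e then j%:~R else - j%:~R).
      exists (fun l m _ => g (uv e l m - t)).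
        apply: Or32; exists (fun x : R => g (x - t)) => //.
        exists (C * q `^ (- t)) => x; apply: le_trans (hg _) _.
        by rewrite addrC (powqD hq) mulrA.
      move=> l m M _ /cg ->; congr g; rewrite /uv /t.
      by case: (e); ring.
    + exists (fun l m M => index_ind N (l - i%:~R) (m - j%:~R) M *
                           c (l - i%:~R) (m - j%:~R) M); last first.
        by move=> l m M _ h; rewrite /index_ind asboolT// mul1r.
      apply: Or33.
      apply: rapid_eq (comp_rapid_l (- i) (- j) false rc (bdd_cst N 1)) _ => l m M _.
      by rewrite /comp_weight mul1r !intrN.
  have [C hC] := uweight_bdd hq hN Wd.
  have [|T' sT'] := @shift_op_exists _ _ _ _ _ hN hN0 hket
      (fun l m M => (d l m M)%:C) (- i) (- j) false C.
    by move=> l m M lmM; rewrite normcR lecR hC.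
  exists T'; first exact: band_shift (conj Wd erefl) sT'.
  have [bT Tk] := sT; have [bT' Tk'] := sT'.
  apply: (adjoint_ext hket) => // l m M l' m' M' h h'.
  rewrite Tk// Tk'// hdotZl hdotZr conjcR /= !intrN.
  have [E|nE] := pselect ((l', m', M') = (l + i%:~R, m + j%:~R, M)).
    case: E h' => -> -> -> h'; rewrite dE ?addrK//.
    by rewrite !(ket_dot hket)// ?eqxx ?addrK//.
  rewrite !(ket_orth hket) ?mulr0//.
    by move=> [lE mE ME]; apply: nE; rewrite lE mE ME !subrK.
  by move=> [lE mE ME]; apply: nE; rewrite lE mE ME.
- exists (fun x => A' x + B' x); first exact: band_add.
  by move=> x y; rewrite hdotDl hdotDr hA2 hB2.
- exists (fun x => k^* *: A' x); first exact: band_scale.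
  by move=> x y; rewrite hdotZl hdotZr conjCK hA2.
Qed.

(** * Conjugation of weighted shifts by J *)

Section RealConjugation.
Variable J : H -> H.
Hypotheses (hJa : antilinear J) (hJi : isometric J)
  (hJ : forall l m M, ket_index N l m M ->
     J (ket l m M) = (-1) ^ Num.floor (m + N) *: ket l (- m) (- M)).

Let opconjE T x : opconj J T x = J (T ((-1) ^ n *: J x)).
Proof. by rewrite /opconj (opinvE hN hket hJa hJi hJ). Qed.

Lemma opconj_bounded T : bounded_op T -> bounded_op (opconj J T).
Proof.
move=> bT; have [lT _ _ ZT _] := bounded_opP bT.
rewrite (_ : opconj J T = fun x => J (T ((-1) ^ n *: J x))); last first.
  by apply/funext => x; rewrite opconjE.
split=> [k u v|].
  by rewrite hJa scalerDr scalerA mulrC -scalerA lT hJa conjCK.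
have bJ := J_additive hJa hJi.
have bid : bounded_additive (fun x : H => (-1) ^ n *: J x) by exact: bounded_additiveZ.
have [_ [C _ hC]] := bounded_additive_comp bJ
  (bounded_additive_comp (bounded_op_additive bT) bid).
by exists C.
Qed.

(** The signs of the two applications of [J] and of its inverse multiply to (-1)^j, which depends on
    the shift alone and so does not disturb the kind of the weight. It is written with [if] to keep
    weights real. Replacing m by -m is what exchanges u and v. *)
Lemma opconj_rshift c i j b T : real_shift N ket c i j b T ->
  real_shift N ket (fun l m M => (if odd `|j|%N then -1 else 1) * c l (- m) (- M))
    i (- j) b (opconj J T).
Proof.
move=> [bT hT]; split; first exact: opconj_bounded.
have [_ _ _ ZT _] := bounded_opP bT.
move=> l m M lmM; rewrite opconjE (J_ket hJ lmM) scalerA ZT.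
have lmM' : ix l (- m) (- M) by exact: index_flip (index_opp hN lmM).
rewrite hT// scalerA (JZ hJa hJi) intrN.
have [h|h] := pselect (ix (l + i%:~R) (- m + j%:~R) (flip b (- M))); last first.
  rewrite (ket_out hket h) (ket_out hket) ?scaler0; last first.
    move=> h'; apply: h; have := index_flip (index_opp hN h').
    by rewrite opprB [_ - m]addrC; case: (b); rewrite /= ?opprK.
  have [JB _] := J_additive hJa hJi.
  by have := JB 0 0; rewrite !subrr => ->; rewrite scaler0.
rewrite (J_ket hJ h) scalerA opprD opprK.
rewrite (_ : - flip b (- M) = flip b M); last by case: (b); rewrite /= ?opprK.
congr (_ *: _).
rewrite !rmorphM /= !sign_conj conjcR.
have -> : sg N (- m + j%:~R) = sg N (- m) * (-1) ^ j.
  have [z mz] := index_int hN lmM'; rewrite /sg addrAC mz -intrD !intrKfloor.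
  by rewrite expfzDr ?oppr_eq0 ?oner_eq0.
have -> : ((if odd `|j|%N then -1 else 1 : R)%:C = (-1) ^ j :> R[i]).
  have -> : (-1) ^ j = (-1) ^+ `|j|%N :> R[i].
    by case: (j) => k //; rewrite NegzE -exprnN -exprVn invrN1.
  by rewrite -signr_odd; case: odd; rewrite ?expr0 ?expr1 ?realcN.
have E := sg_opp hN lmM.
rewrite -/(sg N m); set t := (_%:C).
transitivity (((-1) ^ n * (sg N m * sg N (- m))) * ((-1) ^ j * t)); first by ring.
by rewrite E sign_sqr mul1r.
Qed.

Lemma sided_opconj e T : sided e T -> sided (~~ e) (opconj J T).
Proof.
elim=> [c i j b {}T Wc sT|A B hA ihA hB ihB|k A hA ihA].
- apply: band_shift (opconj_rshift sT).
  have opp l m M : ix l m M -> ix l (- m) (- M).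
    by move=> h; exact: index_flip (index_opp hN h).
  pose sj : R := if odd `|j|%N then -1 else 1.
  have sj1 : `|sj| = 1 by rewrite /sj; case: odd; rewrite ?normrN normr1.
  case: Wc => [[a ca ij]|[g [C hg] cg]|rc].
  + apply: Or31; exists (sj * a); first by move=> l m M /opp/ca ->.
    by rewrite ij; case: (e); rewrite ?opprK.
  + apply: Or32; exists (fun x : R => sj * g x).
      by exists C => x; rewrite normrM sj1 mul1r.
    move=> l m M /opp/cg ->; rewrite /uv.
    by case: (e); rewrite ?opprK.
  + apply: Or33 => p; have [C hC] := rc p; exists C => l m M /opp/hC.
    by rewrite normrM sj1 mul1r.
- have := band_add ihA ihB; congr band; apply/funext => x.
  by rewrite !opconjE (JD hJa).
- have := band_scale k^* ihA; congr band; apply/funext => x.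
  by rewrite !opconjE (JZ hJa hJi).
Qed.

Lemma opconjM A B x : opconj J (fun x => A (B x)) x = opconj J A (opconj J B x).
Proof.
rewrite ![in RHS]opconjE opconjE (J_sqr hN hket hJa hJi hJ) scalerA.
by rewrite sign_sqr scale1r.
Qed.

Lemma opconjD A B x : opconj J (fun x => A x + B x) x = opconj J A x + opconj J B x.
Proof. by rewrite !opconjE (JD hJa). Qed.

Lemma opconjZ (k : R[i]) A x : opconj J (fun x => k *: A x) x = k^* *: opconj J A x.
Proof. by rewrite !opconjE (JZ hJa hJi). Qed.

End RealConjugation.

End OperatorClasses.

(** * Asymptotics of the representation *)

Section Asymptotics.
Context {R : realType}.
Variables (q s N : R) (n : int).
Hypotheses (hq : 0 < q < 1) (hN : 2 * N = n%:~R) (hN0 : N != 0).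
Implicit Types (f g c : @weight R) (l m M a x : R).
Local Notation ix := (ket_index N).
Local Notation qn := (qnum q).

Let q0 : 0 < q. Proof. by case/andP: hq. Qed.
Let q1 : q < 1. Proof. by case/andP: hq. Qed.

Definition tends f a := rapid N (fun l m M => f l m M - a).

Lemma tends_bdd f a : tends f a -> bdd N f.
Proof.
move=> /rapid_bdd[C hC]; exists (C + `|a|) => l m M lmM.
by rewrite -[f l m M](subrK a) (le_trans (ler_normD _ _))// lerD2r hC.
Qed.

Lemma tends_eq f g a : tends g a -> (forall l m M, ix l m M -> f l m M = g l m M) ->
  tends f a.
Proof. by move=> h E; apply: rapid_eq h _ => l m M /E ->. Qed.

Lemma tends_cst a : tends (fun _ _ _ => a) a.
Proof.
by move=> p; exists 0 => l m M _; rewrite subrr normr0 mul0r.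
Qed.

Lemma tends0 f : rapid N f -> tends f 0.
Proof. by move=> h; apply: rapid_eq h _ => *; rewrite subr0. Qed.

Lemma tendsD f g a b : tends f a -> tends g b ->
  tends (fun l m M => f l m M + g l m M) (a + b).
Proof.
by move=> hf hg; apply: rapid_eq (rapidD hf hg) _ => *; rewrite opprD addrACA.
Qed.

Lemma tendsN f a : tends f a -> tends (fun l m M => - f l m M) (- a).
Proof. by move=> hf; apply: rapid_eq (rapidN hf) _ => *; rewrite opprB opprK addrC. Qed.

Lemma tendsM f g a b : tends f a -> tends g b ->
  tends (fun l m M => f l m M * g l m M) (a * b).
Proof.
move=> hf hg.
apply: rapid_eq (rapidD (rapid_mul hf (tends_bdd hg)) (rapid_mul hg (bdd_cst N a))) _.
by move=> l m M _; ring.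
Qed.

Lemma sqrt_sub_le (x y : R) : 0 <= x -> 0 <= y ->
  `|Num.sqrt x - Num.sqrt y| <= Num.sqrt `|x - y|.
Proof.
wlog : x y / y <= x => [W x0 y0|yx x0 y0].
  have [/W|/ltW/W] := leP y x; first exact.
  by rewrite distrC [`|x - y|]distrC; exact.
rewrite !ger0_norm ?subr_ge0 ?ler_wsqrtr//.
have xy0 : 0 <= x - y by rewrite subr_ge0.
rewrite -(@ler_pXn2r _ 2) ?nnegrE ?sqrtr_ge0 ?subr_ge0 ?ler_wsqrtr//.
rewrite sqr_sqrtr// sqrrB !sqr_sqrtr//.
have : y <= Num.sqrt x * Num.sqrt y.
  by rewrite -{1}(sqr_sqrtr y0) expr2 ler_wpM2r ?sqrtr_ge0 ?ler_wsqrtr.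
by lra.
Qed.

Lemma tends_sqrt f a : (forall l m M, ix l m M -> 0 <= f l m M) -> 0 <= a ->
  tends f a -> tends (fun l m M => Num.sqrt (f l m M)) (Num.sqrt a).
Proof.
move=> f0 a0 hf; apply: (rapid_le (C := 1) (rapid_sqrt hf)) => l m M lmM.
rewrite mul1r [leRHS]ger0_norm ?sqrtr_ge0//.
by apply: sqrt_sub_le => //; exact: f0 lmM.
Qed.

(* The value f = 0 is allowed because 0^-1 = 0. *)
Lemma tends_inv f (d : R) : 0 < d ->
  (forall l m M, ix l m M -> f l m M = 0 \/ d <= f l m M) ->
  tends f 1 -> tends (fun l m M => (f l m M)^-1) 1.
Proof.
move=> d0 hd hf; apply: (rapid_le (C := Num.max 1 d^-1) hf) => l m M lmM.
have [->|df] := hd _ _ _ lmM.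
  by rewrite invr0 !sub0r normrN1 mulr1 le_max lexx.
have f0 : 0 < f l m M by exact: lt_le_trans df.
have -> : (f l m M)^-1 - 1 = - ((f l m M)^-1 * (f l m M - 1)).
  by rewrite mulrBr mulVf ?gt_eqF// mulr1 opprB.
rewrite normrN normrM ler_wpM2r// gtr0_norm ?invr_gt0// le_max.
by rewrite lef_pV2 ?posrE// df orbT.
Qed.

Lemma tends_shift f a (i j : int) :
  (forall l m M, ix l m M -> ix (l + i%:~R) (m + j%:~R) M) ->
  tends f a -> tends (fun l m M => f (l + i%:~R) (m + j%:~R) M) a.
Proof.
move=> hix hf.
apply: rapid_eq (comp_rapid_l i j false hf (bdd_cst N 1)) _ => l m M /hix h.
by rewrite /comp_weight mul1r /index_ind asboolT// mul1r.
Qed.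

Let h : R := (q^-1 - q)^-1.

Let h0 : 0 < h.
Proof.
rewrite invr_gt0 subr_gt0; apply: lt_trans q1 _.
by rewrite -invr1 ltf_pV2 ?posrE.
Qed.

(** Separates the growth of the q-number for large x from a correction tending to 1; all asymptotics
    below rest on this factorization. *)
Lemma qnumE x : (qn x) = h * q `^ (- x) * (1 - q `^ (2 * x)).
Proof.
have -> : q `^ (2 * x) = q `^ x * q `^ x by rewrite -powqD//; congr (_ `^ _); ring.
have e : q `^ (- x) * q `^ x = 1 by rewrite -powqD// addNr powRr0.
rewrite /qnum /h -[q - _]opprB invrN mulrN -mulNr opprB mulrC -!mulrA; congr (_ * _).
by rewrite mulrBr mulr1 mulrA e mul1r.
Qed.

Lemma qnum2_gt0 : 0 < (qn 2).
Proof.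
rewrite qnumE !mulr_gt0 ?powR_gt0// subr_gt0 (_ : 2 * 2 = 4%:R); last by rewrite -natrM.
by rewrite powR_mulrn ?(ltW q0)// exprn_ilt1 ?(ltW q0).
Qed.

Lemma sqrt_qnumM x y : Num.sqrt ((qn x) * (qn y)) =
  h * q `^ (- (x + y) / 2) * Num.sqrt ((1 - q `^ (2 * x)) * (1 - q `^ (2 * y))).
Proof.
have k0 : 0 <= h * q `^ (- (x + y) / 2) by rewrite mulr_ge0 ?powR_ge0 ?(ltW h0).
rewrite -(ger0_norm k0) -sqrtr_sqr -sqrtrM ?exprn_ge0//; congr Num.sqrt.
rewrite !qnumE exprMn [q `^ (_ / 2) ^+ 2]expr2 -powqD//.
have -> : - (x + y) / 2 + - (x + y) / 2 = - x + - y by lra.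
by rewrite powqD//; ring.
Qed.

Lemma sqrt_qnum2M x y : Num.sqrt ((qn 2) * (qn x) * (qn y)) = Num.sqrt (qn 2) *
  (h * q `^ (- (x + y) / 2) * Num.sqrt ((1 - q `^ (2 * x)) * (1 - q `^ (2 * y)))).
Proof. by rewrite -mulrA sqrtrM ?(ltW qnum2_gt0)// sqrt_qnumM. Qed.

Lemma rapid_powq_affine (a b : R) : 0 < a -> rapid N (fun l _ _ => q `^ (a * l + b)).
Proof.
move=> a0; apply: rapid_eq (rapid_mul (rapid_powq N hq a0) (bdd_cst N (q `^ b))) _.
by move=> l m M _; rewrite powqD.
Qed.

Lemma tends_1powq (a b : R) : 0 < a -> tends (fun l _ _ => 1 - q `^ (a * l + b)) 1.
Proof.
move=> a0; apply: rapid_eq (rapidN (rapid_powq_affine b a0)) _ => l m M _.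
by rewrite addrC addKr.
Qed.

Lemma index_2l l m M : ix l m M -> exists k : nat, 2 * l = k.+1%:R.
Proof.
move=> lmM; have [a ua] := index_u lmM; have [b vb] := index_v hN lmM.
have l1 := index_gt0 hN hN0 lmM.
have E : 2 * l = (a + b)%:R by rewrite natrD -ua -vb; ring.
move: E l1; case: (a + b)%N => [->|k ->]; first by rewrite ler10.
by exists k.
Qed.

Lemma bdd_M (F : R -> R) : bdd N (fun _ _ M => F M).
Proof.
exists (`|F N| + `|F (- N)|) => l m M lmM.
by have [->|->] := index_M lmM; rewrite ?lerDl ?lerDr.
Qed.

Lemma tends_1powqM (a b c' : R) : 0 < a ->
  tends (fun l _ M => 1 - q `^ (a * l + b + c' * M)) 1.
Proof.
move=> a0.
apply: rapid_eq (rapidN (rapid_mul (rapid_powq_affine b a0) (bdd_M (fun M => q `^ (c' * M))))) _.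
by move=> l m M _; rewrite -powqD// addrC addKr.
Qed.

Lemma tends_inv_1powq (k : nat) :
  tends (fun l _ _ => (1 - q `^ (4 * l + 2 * k%:R - 2))^-1) 1.
Proof.
have d0 : 0 < 1 - q ^+ 2 by rewrite subr_gt0 exprn_ilt1 ?(ltW q0).
apply: (tends_inv d0) => [l m M lmM|]; last first.
  by apply: tends_eq (tends_1powq (2 * k%:R - 2) (ltr0n R 4)) _ => l m M _; rewrite addrA.
have [p lp] := index_2l lmM.
have -> : 4 * l + 2 * k%:R - 2 = (2 * (p + k))%:R.
  have -> : 4 * l = 2 * (2 * l) by ring.
  by rewrite lp natrM natrD -natr1; ring.
rewrite powR_mulrn ?(ltW q0)//; case: (p + k)%N => [|r].
  (* The exceptional case k = 0, l = 1/2: there [2l - 1] = 0 in the denominator of alpha, and its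
     inverse is 0 by convention. *)
  by left; rewrite muln0 expr0 subrr.
right; rewrite lerD2l lerN2 exprM exprS.
by rewrite ler_piMr ?exprn_ge0 ?exprn_ile1 ?exprn_ge0 ?(ltW q0) ?(ltW q1).
Qed.

Lemma alpha_tends :
  tends (fun l _ M => alpha q s M l * q `^ (- (2 * l))) (h^-1 * Num.sqrt (qn 2) * `|s|).
Proof.
(* [A1] and [A2] are the two roots in alpha freed of their powers q^l and q^(-l), so the rate q^(2l)
   comes from 1 / [2l] alone. The summands [+ 0] only match the affine exponents of the preceding
   lemmas. *)
pose A1 : weight := fun l _ M => Num.sqrt ((qn 2) *
  (1 - q `^ (2 * l + 0 + 2 * M)) * (1 - q `^ (2 * l + 0 + (- 2) * M)) *
  (1 - q `^ (4 * l + 2 * 0%:R - 2))^-1 * (1 - q `^ (4 * l + 2 * 2%:R - 2))^-1).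
pose A2 : weight := fun l _ M => Num.sqrt (s ^+ 2 +
  q `^ (2 * l + 0) * (q `^ (2 * M) + q `^ ((- 2) * M) * s ^+ 4) +
  q `^ (4 * l + 0) * s ^+ 2).
have nn l m M : ix l m M -> 0 <= (1 - q `^ (2 * l + 0 + 2 * M)) /\
    0 <= (1 - q `^ (2 * l + 0 + (- 2) * M)).
  move=> lmM; have lN := index_ge lmM; have := ler_norm N; have := ler_norm (- N).
  rewrite normrN => n1 n2; rewrite !subr_ge0 !powq_le1//;
    by have [->|->] := index_M lmM; lra.
have nk (k : nat) l m M : ix l m M -> 0 <= (1 - q `^ (4 * l + 2 * k%:R - 2))^-1.
  move=> lmM; have := index_gt0 hN hN0 lmM; have := ler0n R k => k0 l1.
  by rewrite invr_ge0 subr_ge0 powq_le1//; lra.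
have hA1 : tends A1 (Num.sqrt (qn 2)).
  have := tendsM (tendsM (tendsM (tendsM (tends_cst (qn 2))
    (tends_1powqM 0 2 (ltr0n R 2))) (tends_1powqM 0 (- 2) (ltr0n R 2)))
    (tends_inv_1powq 0)) (tends_inv_1powq 2).
  rewrite !mulr1; apply: tends_sqrt; last exact/ltW/qnum2_gt0.
  move=> l m M lmM; have [? ?] := nn _ _ _ lmM.
  apply: mulr_ge0 (nk 2 _ _ _ lmM); apply: mulr_ge0 (nk 0 _ _ _ lmM).
  by do 2 apply: mulr_ge0 => //; exact/ltW/qnum2_gt0.
have hA2 : tends A2 `|s|.
  rewrite -sqrtr_sqr.
  apply: tends_sqrt; [|exact: sqr_ge0|].
    move=> l m M lmM.
    have s2 := sqr_ge0 s; have s4 : 0 <= s ^+ 4 by rewrite exprn_even_ge0.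
    have pw x : 0 <= q `^ x by exact: powR_ge0.
    apply: addr_ge0; last exact: mulr_ge0.
    by apply: addr_ge0 => //; apply: mulr_ge0 => //; apply: addr_ge0 => //; exact: mulr_ge0.
  have b1 := bdd_M (fun M => q `^ (2 * M) + q `^ ((- 2) * M) * s ^+ 4).
  have := tendsD (tendsD (tends_cst (s ^+ 2))
    (tends0 (rapid_mul (rapid_powq_affine 0 (ltr0n R 2)) b1)))
    (tends0 (rapid_mul (rapid_powq_affine 0 (ltr0n R 4)) (bdd_cst N (s ^+ 2)))).
  by rewrite !addr0.
have := tendsM (tendsM (tendsM (tends_cst h^-1) (tends_inv_1powq 1)) hA1) hA2.
rewrite mulr1; move/tends_eq; apply=> l m M lmM.
have hh : h * h^-1 = 1 by rewrite divff// gt_eqF.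
have E1 : Num.sqrt ((qn 2) * qn (l + M) * qn (l - M) / (qn (2 * l - 1) * qn (2 * l + 1))) =
    q `^ l * A1 l m M.
  rewrite -[q `^ l](ger0_norm (powR_ge0 q l)) -sqrtr_sqr /A1 -sqrtrM ?sqr_ge0//.
  congr Num.sqrt; set t2 := (qn 2).
  rewrite !qnumE // !invfM -!powRN !opprK.
  have -> : 2 * (l + M) = 2 * l + 0 + 2 * M by ring.
  have -> : 2 * (l - M) = 2 * l + 0 + (- 2) * M by ring.
  have -> : 2 * (2 * l - 1) = 4 * l + 2 * 0%:R - 2 by ring.
  have -> : 2 * (2 * l + 1) = 4 * l + 2 * 2%:R - 2 by ring.
  set X1 := 1 - q `^ (2 * l + 0 + 2 * M); set X2 := 1 - q `^ (2 * l + 0 + (- 2) * M).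
  set X3 := (1 - q `^ (4 * l + 2 * 0%:R - 2))^-1.
  set X4 := (1 - q `^ (4 * l + 2 * 2%:R - 2))^-1.
  transitivity ((h * h^-1) ^+ 2 * (q `^ (- (l + M)) * q `^ (- (l - M)) *
    q `^ (2 * l - 1) * q `^ (2 * l + 1)) * (t2 * X1 * X2 * X3 * X4)).
    by ring.
  rewrite hh expr1n mul1r; congr (_ * _); rewrite expr2 -!powqD//; congr powR; ring.
have E2 : Num.sqrt ((q `^ (l + M) + q `^ (- (l + M)) * s ^+ 2) *
    (q `^ (l - M) * s ^+ 2 + q `^ (- (l - M)))) = q `^ (- l) * A2 l m M.
  rewrite -[q `^ (- l)](ger0_norm (powR_ge0 q _)) -sqrtr_sqr /A2 -sqrtrM ?sqr_ge0//.
  congr Num.sqrt.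
  have sq x : q `^ (2 * x) = q `^ x ^+ 2 by rewrite expr2 -powqD//; congr powR; ring.
  have -> : q `^ (4 * l + 0) = q `^ l ^+ 4.
    by rewrite (_ : 4 * l + 0 = 2 * (2 * l)) ?sq -?exprM//; ring.
  rewrite addr0 mulNr !(opprD, opprK) !powqD// !powRN !sq.
  have : q `^ l != 0 by rewrite gt_eqF// powR_gt0.
  have : q `^ M != 0 by rewrite gt_eqF// powR_gt0.
  by move: (q `^ l) (q `^ M) => a c c0 a0; field; rewrite a0 c0.
rewrite /alpha E1 E2 qnumE !invfM -powRN opprK.
have -> : 2 * (2 * l) = 4 * l + 2 * 1%:R - 2 by ring.
transitivity ((q `^ (2 * l) * q `^ l * q `^ (- l) * q `^ (- (2 * l))) *
  (h^-1 / (1 - q `^ (4 * l + 2 * 1%:R - 2)) * A1 l m M * A2 l m M)); first by ring.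
rewrite -!powqD// (_ : 2 * l + l + - l + - (2 * l) = 0) ?powRr0 ?mul1r//; ring.
Qed.

Lemma beta_tends :
  tends (fun l _ M => beta q s M l * q `^ (- (2 * l))) (h^-1 * (1 - s ^+ 2)).
Proof.
(* The numerator of beta divided by its growth h q^(-2l). The terms containing M keep a factor of
   order q^(2l), so the limit does not depend on M. *)
pose B1 : weight := fun l _ M =>
  (1 - q `^ (4 * l + 0) - q `^ (2 * l + 1) * (q `^ (2 * M)
    * ((qn 2) * (1 - q `^ (2 * l + 0 + (- 2) * M))))) * (1 - s ^+ 2)
  + q `^ (2 * l + 0) * (h^-1 * qn (2 * M) * (q * (qn 2) * s ^+ 2)).
have hB1 : tends B1 (1 - s ^+ 2).
  have b1 : bdd N (fun l _ M => q `^ (2 * M) * ((qn 2) * (1 - q `^ (2 * l + 0 + (- 2) * M)))).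
    apply: bdd_mul; first exact: (bdd_M (fun M => q `^ (2 * M))).
    exact: bdd_mul (bdd_cst N (qn 2)) (tends_bdd (tends_1powqM 0 (- 2) (ltr0n R 2))).
  have b2 := bdd_M (fun M => h^-1 * qn (2 * M) * (q * (qn 2) * s ^+ 2)).
  have := tendsD (tendsM (tendsD (tends_1powq 0 (ltr0n R 4))
      (tendsN (tends0 (rapid_mul (rapid_powq_affine 1 (ltr0n R 2)) b1))))
      (tends_cst (1 - s ^+ 2)))
    (tends0 (rapid_mul (rapid_powq_affine 0 (ltr0n R 2)) b2)).
  by rewrite oppr0 !addr0 mul1r.
rewrite -[h^-1 * _]mulr1 -[h^-1 * _ * 1]mulr1.
apply: tends_eq (tendsM (tendsM (tendsM (tends_cst h^-1) hB1)
  (tends_inv_1powq 1)) (tends_inv_1powq 3)) _ => l m M lmM; rewrite /beta /B1.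
set t2 := (qn 2); set t3 := qn (2 * M).
rewrite !qnumE.
have -> : 2 * (2 * l) = 4 * l + 2 * 1%:R - 2 by ring.
have -> : 2 * (2 * l + 2) = 4 * l + 2 * 3%:R - 2 by ring.
have -> : 4 * l + 0 = 4 * l + 2 * 1%:R - 2 by ring.
have -> : 2 * (l - M) = 2 * l + 0 + (- 2) * M by ring.
set Y1 := q `^ (4 * l + 2 * 1%:R - 2); set Y3 := q `^ (4 * l + 2 * 3%:R - 2).
set Z := q `^ (2 * l + 0 + _).
rewrite !invfM; set iY1 := (1 - Y1)^-1; set iY3 := (1 - Y3)^-1.
have sq x : q `^ (2 * x) = q `^ x ^+ 2 by rewrite expr2 -powqD//; congr powR; ring.
rewrite addr0 !(opprD, opprK) !powqD// !powRN !sq powRr1 ?(ltW q0)//.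
have : q `^ l != 0 by rewrite gt_eqF// powR_gt0.
have : q `^ M != 0 by rewrite gt_eqF// powR_gt0.
have hn0 : h != 0 by rewrite gt_eqF.
have qn0 : q != 0 by rewrite gt_eqF.
move: (q `^ l) (q `^ M) (iY1) (iY3) (t2) (t3) (Y1) (Z) (h) hn0 => a c x1' x3 t t' y z k k0 c0 a0.
by field; rewrite ?a0 ?c0 ?k0 ?qn0.
Qed.

End Asymptotics.

(** * The generators as one-sided operators in u *)

Section Generators.
Context {R : realType} {H : hilbert R}.
Variables (q s N : R) (n : int) (ket : R -> R -> R -> H) (pi : podles q s -> H -> H).
Hypotheses (hq : 0 < q < 1) (hN : 2 * N = n%:~R) (hN0 : N != 0)
  (hket : ket_basis N ket) (hpi : podles_rep N ket pi).
Implicit Types (A B T : H -> H) (P : uop H) (l m M : R).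
Implicit Types (c : @weight R) (i j : int) (b : bool).
Local Notation "<< x , y >>" := (@hdot R H x y) (format "<< x ,  y >>").
Local Notation ix := (ket_index N).
Local Notation qn := (qnum q).
Local Notation sided_even := (sided_even q N ket).

Let q0 : 0 < q. Proof. by case/andP: hq. Qed.
Let q1 : q < 1. Proof. by case/andP: hq. Qed.

(** Allows the formulas for x1 and x0 to be treated term by term: the representation yields only
    their sum, and each term is realized here by a bounded operator of its own. *)
Definition acts (F : R -> R -> R -> H) := exists2 T, sided_even true T &
  forall l m M, ix l m M -> T (ket l m M) = F l m M.

Lemma acts_sided T F : bounded_op T -> acts F ->
  (forall l m M, ix l m M -> T (ket l m M) = F l m M) -> sided_even true T.
Proof.
move=> bT [T' sT' hT'] hT; rewrite (_ : T = T')//.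
apply: (ket_bounded_ext hket) => //; first exact: band_bounded sT'.
by move=> l m M lmM; rewrite hT// hT'.
Qed.

Lemma acts_eq F F' : acts F -> (forall l m M, ix l m M -> F' l m M = F l m M) -> acts F'.
Proof. by move=> [T sT hT] E; exists T => // l m M lmM; rewrite E// hT. Qed.

Lemma actsD F F' : acts F -> acts F' -> acts (fun l m M => F l m M + F' l m M).
Proof.
move=> [T sT hT] [T' sT' hT']; exists (fun x => T x + T' x); first exact: band_add.
by move=> l m M lmM; rewrite hT// hT'.
Qed.

Lemma actsN F : acts F -> acts (fun l m M => - F l m M).
Proof.
move=> [T sT hT]; exists (fun x => -1 *: T x); first exact: band_scale.
by move=> l m M lmM; rewrite hT// scaleN1r.
Qed.

Lemma acts_uweight c i j : uweight q N true c i j ->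
  acts (fun l m M => (c l m M)%:C *: ket (l + i%:~R) (m + j%:~R) M).
Proof.
move=> wc; have [C hC] := uweight_bdd hq hN wc.
have [|T sT] := @shift_op_exists _ _ _ _ _ hN hN0 hket
    (fun l m M => (c l m M)%:C) i j false C.
  by move=> l m M lmM; rewrite normcR lecR hC.
exists T; first exact: (band_shift (conj wc erefl) sT).
by move=> l m M /(sT.2).
Qed.

(** The weight is split into a constant, a function of u and a rapid error, one for each kind of
    [uweight]. A nonzero constant needs i = j, that is, a shift fixing v. *)
Lemma acts_tends c i j (a C : R) (g : R -> R) : a = 0 \/ i = j ->
  (forall x, 0 <= x -> `|g x| <= C * q `^ x) ->
  rapid N (fun l m M => c l m M - a - g (l + m)) ->
  acts (fun l m M => (c l m M)%:C *: ket (l + i%:~R) (m + j%:~R) M).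
Proof.
move=> aij hg rc.
have C0 : 0 <= C.
  by have := hg 0 (lexx _); rewrite powRr0 mulr1; apply: le_trans.
(* [uweight] asks for the bound at every real argument, while [g] is controlled only for u >= 0,
   where the index set lies. *)
pose g' x := if 0 <= x then g x else 0.
have w1 : uweight q N true (fun _ _ _ => a) i j.
  case: aij => [->|ij]; last by apply: Or31; exists a.
  by apply: Or33 => p; exists 0 => l m M _; rewrite normr0 mul0r.
have w2 : uweight q N true (fun l m M => g' (l + m)) i j.
  apply: Or32; exists g' => //; exists C => x; rewrite /g'.
  by case: ifP => [/hg//|_]; rewrite normr0 mulr_ge0// powR_ge0.
have w3 : uweight q N true (fun l m M => c l m M - a - g (l + m)) i j by exact: Or33.
apply: acts_eq (actsD (actsD (acts_uweight w1) (acts_uweight w2)) (acts_uweight w3)) _.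
move=> l m M lmM; rewrite -!scalerDl -!realcD /g' (index_u_ge0 lmM).
by congr (_%:C *: _); ring.
Qed.

(** Replacing S(v) by 1 costs O(q^u q^v), and replacing B by its limit b costs a rapid error. What
    remains is b G(u), a function of u alone. *)
Lemma acts_prod c i j (G S : R -> R) (B : weight) (C K b : R) :
  (forall x, 0 <= x -> `|G x| <= C * q `^ x) ->
  (forall x, 0 <= x -> `|S x - 1| <= K * q `^ x) ->
  tends N B b ->
  (forall l m M, ix l m M -> c l m M = G (l + m) * S (l - m) * B l m M) ->
  acts (fun l m M => (c l m M)%:C *: ket (l + i%:~R) (m + j%:~R) M).
Proof.
move=> hG hS hB hc.
have C0 : 0 <= C.
  by have := hG 0 (lexx _); rewrite powRr0 mulr1; apply: le_trans.
apply: (@acts_tends c i j 0 (`|b| * C) (fun x => b * G x)); first by left.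
  by move=> x x0; rewrite normrM -mulrA ler_wpM2l// hG.
have bG : bdd N (fun l m _ => G (l + m)).
  exists C => l m M lmM; have u := index_u_ge0 lmM.
  by apply: le_trans (hG _ u) _; rewrite ler_piMr// powq_le1.
have r1 : rapid N (fun l m _ => G (l + m) * (S (l - m) - 1)).
  apply: (@rapid_uv _ q N hq _ (C * K)) => l m M lmM.
  rewrite normrM /uv; apply: le_trans (ler_pM _ _ (hG _ (index_u_ge0 lmM))
    (hS _ (index_v_ge0 hN lmM))) _ => //.
  by apply/eqP/eqP; lra.
apply: rapid_eq (rapidD (rapid_mul r1 (tends_bdd hB)) (rapid_mul hB bG)) _.
by move=> l m M lmM; rewrite hc//; ring.
Qed.

Let h : R := (q^-1 - q)^-1.

Lemma sqrt_sub1_le (x : R) : `|Num.sqrt x - 1| <= `|x - 1|.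
Proof.
have [x0|x0] := leP 0 x; last first.
  rewrite ler0_sqrtr ?ltW// sub0r normrN1 ler0_norm; last by lra.
  by lra.
have -> : x - 1 = (Num.sqrt x - 1) * (Num.sqrt x + 1).
  by rewrite -[in LHS](sqr_sqrtr x0); ring.
rewrite normrM ler_peMr// ger0_norm ?addr_ge0 ?sqrtr_ge0//.
by rewrite lerDr sqrtr_ge0.
Qed.

Let sqrt_1powqM (x y : R) : 0 <= x ->
  Num.sqrt ((1 - q `^ (2 * x)) * (1 - q `^ (2 * y))) =
  Num.sqrt (1 - q `^ (2 * x)) * Num.sqrt (1 - q `^ (2 * y)).
Proof. by move=> x0; rewrite sqrtrM// subr_ge0 powq_le1// mulr_ge0. Qed.

Lemma powq_2le (x : R) : 0 <= x -> q `^ (2 * x) <= q `^ x.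
Proof. by move=> x0; apply: powq_le => //; rewrite ler_peMl// ler1n. Qed.

Definition alpha_t : weight := fun l _ M => alpha q s M l * q `^ (- (2 * l)).
Definition beta_t : weight := fun l _ M => beta q s M l * q `^ (- (2 * l)).

Lemma alpha_t_tends : exists a, tends N alpha_t a.
Proof. by eexists; exact: (alpha_tends s hq hN hN0). Qed.

Lemma alpha_t_succ_tends : exists a, tends N (fun l m M => alpha_t (l + 1) m M) a.
Proof.
have [a ha] := alpha_t_tends; exists a.
have hix l m M : ix l m M -> ix (l + 1%:~R) (m + 1%:~R) M.
  move=> lmM; have := (index_u_ge0 lmM, index_v_ge0 hN lmM, index_ge lmM) => -[] [] *.
  by apply: (index_shift lmM); rewrite ?mulr1z; lra.
exact: (tends_shift hix ha).
Qed.

Lemma beta_t_tends : exists b0 : R, tends N beta_t b0.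
Proof. by eexists; exact: (beta_tends s hq hN hN0). Qed.

Let Gexp (k : R) (F : R -> R) : (forall x, 0 <= x -> `|F x| <= 1) ->
  forall x, 0 <= x -> `|k * q `^ x * F x| <= `|k| * q `^ x.
Proof.
move=> hF x x0; rewrite normrM normrM (ger0_norm (powR_ge0 _ _)).
by rewrite ler_piMr ?hF// mulr_ge0 ?powR_ge0.
Qed.

Let sqrt_norm (a : R) : `|Num.sqrt (1 - q `^ a)| <= 1.
Proof.
rewrite ger0_norm ?sqrtr_ge0// -[leRHS]sqrtr1 ler_wsqrtr//.
by rewrite gerBl powR_ge0.
Qed.

Let sqrt_near1 (k x : R) : 0 <= k -> 0 <= x ->
  `|Num.sqrt (1 - q `^ (2 * (x + k))) - 1| <= 1 * q `^ x.
Proof.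
move=> k0 x0; apply: le_trans (sqrt_sub1_le _) _.
rewrite addrAC subrr sub0r normrN ger0_norm ?powR_ge0// mul1r.
by apply: powq_le => //; lra.
Qed.

Let powq_norm (x : R) : 0 <= x -> `|q `^ x| <= 1.
Proof. by move=> x0; rewrite ger0_norm ?powR_ge0// powq_le1. Qed.

(* The only term of x1 that does not decay in u = l + m: asymptotically it is a
   multiple of the translation of u by 2, at fixed v = l - m. *)
Lemma acts_x1_up : acts (fun l m M =>
  (q `^ (- l + m) * Num.sqrt (qn (l + m + 1) * qn (l + m + 2)) * alpha q s M (l + 1))%:C
    *: ket (l + 1%:~R) (m + 1%:~R) M).
Proof.
have [a ha] := alpha_t_succ_tends.
(* The prefactor q^(-l + m) and the power of q extracted from the root multiply to q^(1/2) q^(-2 (l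
   + 1)); the second factor normalizes alpha at l + 1. *)
pose k := h * q `^ 2^-1.
pose F x := Num.sqrt ((1 - q `^ (2 * (x + 1))) * (1 - q `^ (2 * (x + 2)))).
have hF x : 0 <= x -> `|F x - 1| <= 2 * q `^ x.
  move=> x0; apply: le_trans (sqrt_sub1_le _) _.
  have := powq_le hq (_ : x <= 2 * (x + 1)); have := powq_le hq (_ : x <= 2 * (x + 2)).
  have := powq_le1 hq (_ : 0 <= 2 * (x + 1)).
  have := powR_ge0 q (2 * (x + 1)); have := powR_ge0 q (2 * (x + 2)).
  move: (q `^ (2 * (x + 1))) (q `^ (2 * (x + 2))) => p r p0 r0 p1 rx px.
  have {}p1 : p <= 1 by apply: p1; lra.
  have {}px : p <= q `^ x by apply: px; lra.
  have {}rx : r <= q `^ x by apply: rx; lra.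
  have pr : 0 <= p * r <= r by rewrite mulr_ge0//= ler_piMl.
  by case/andP: pr => pr1 pr2; rewrite ler_norml; apply/andP; split; lra.
apply: (@acts_tends _ _ _ (k * a) (`|k * a| * 2) (fun x => k * a * (F x - 1))).
- by right.
- by move=> x x0 /=; rewrite normrM -[leRHS]mulrA ler_wpM2l// hF.
have bF : bdd N (fun l m _ => k * F (l + m)).
  exists (`|k| * 1) => l m M lmM; rewrite normrM ler_wpM2l//.
  by rewrite /F ger0_norm ?sqrtr_ge0// -[leRHS]sqrtr1 ler_wsqrtr// mulr_ile1//;
    rewrite ?subr_ge0 ?powq_le1 ?gerBl ?powR_ge0//; have := index_u_ge0 lmM; lra.
apply: rapid_eq (rapid_mul ha bF) _ => l m M lmM.
rewrite sqrt_qnumM// -/h /alpha_t -/(F (l + m)).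
have -> : q `^ (- l + m) * (h * q `^ (- (l + m + 1 + (l + m + 2)) / 2) * F (l + m)) *
   alpha q s M (l + 1) =
   (q `^ (- l + m) * q `^ (- (l + m + 1 + (l + m + 2)) / 2)) *
     (h * F (l + m) * alpha q s M (l + 1)).
  by ring.
rewrite -powqD//.
have -> : - l + m + - (l + m + 1 + (l + m + 2)) / 2 = - (2 * (l + 1)) + 2^-1 by lra.
by rewrite powqD// /k; ring.
Qed.

(** The powers of q from the prefactor and the root combine to q^(3/2) q^u q^(-2l). The factor
    q^(-2l) normalizes beta, so q^u is the decay that remains. The same bookkeeping settles the
    other decaying terms, some of which leave q^(2u). *)
Lemma acts_x1_mid : acts (fun l m M =>
  (q `^ (m + 2) * Num.sqrt ((qn 2) * qn (l - m) * qn (l + m + 1)) * beta q s M l)%:C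
    *: ket (l + 0%:~R) (m + 1%:~R) M).
Proof.
have [b hb] := beta_t_tends.
pose k := q `^ (3 / 2) * Num.sqrt (qn 2) * h.
apply: (@acts_prod _ _ _ (fun x => k * q `^ x * Num.sqrt (1 - q `^ (2 * (x + 1))))
  (fun x => Num.sqrt (1 - q `^ (2 * (x + 0)))) beta_t (`|k|) 1 b) => //.
- by apply: Gexp => x x0.
- by move=> x; exact: sqrt_near1.
move=> l m M lmM; rewrite sqrt_qnum2M// -/h /beta_t addr0.
have v0 := index_v_ge0 hN lmM; rewrite sqrt_1powqM//.
set S1 := Num.sqrt (1 - q `^ (2 * (l - m))); set S2 := Num.sqrt (1 - q `^ (2 * (l + m + 1))).
transitivity ((q `^ (m + 2) * q `^ (- (l - m + (l + m + 1)) / 2)) *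
  (Num.sqrt (qn 2) * h * S1 * S2 * beta q s M l)); first by ring.
transitivity ((q `^ (3 / 2) * q `^ (l + m) * q `^ (- (2 * l))) *
  (Num.sqrt (qn 2) * h * S1 * S2 * beta q s M l)); last by rewrite /k; ring.
by rewrite -!powqD//; congr (powR _ _ * _); lra.
Qed.

Lemma acts_x1_down : acts (fun l m M =>
  (q `^ (l + m + 1) * Num.sqrt (qn (l - m) * qn (l - m - 1)) * alpha q s M l)%:C
    *: ket (l + (-1)%:~R) (m + 1%:~R) M).
Proof.
have [a ha] := alpha_t_tends.
pose k := q `^ (3 / 2) * h.
pose S x := Num.sqrt ((1 - q `^ (2 * x)) * (1 - q `^ (2 * (x - 1)))).
have hS x : 0 <= x -> `|S x - 1| <= (1 + 2 * q `^ (- 2)) * q `^ x.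
  move=> x0; apply: le_trans (sqrt_sub1_le _) _.
  rewrite (_ : 2 * (x - 1) = 2 * x + - 2); last by ring.
  rewrite powqD//; have := powq_2le x0; have := powR_ge0 q (2 * x).
  have := powq_le1 hq (_ : 0 <= 2 * x); rewrite mulr_ge0// => /(_ isT).
  have t0 := powR_ge0 q (- 2).
  move: (q `^ (2 * x)) (q `^ x) (q `^ (- 2)) t0 => p r t t0 p1 p0 pr.
  have -> : (1 - p) * (1 - p * t) - 1 = - p - p * t + p * (p * t) by ring.
  have h1 : 0 <= p * (p * t) <= p * t by rewrite !mulr_ge0//= ler_piMl// mulr_ge0.
  have h2 : p * t <= r * t by rewrite ler_wpM2r.
  have h3 : 0 <= p * t by rewrite mulr_ge0.
  by case/andP: h1 => h1 h4; rewrite ler_norml; apply/andP; split; lra.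
apply: (@acts_prod _ _ _ (fun x => k * q `^ x * q `^ x) S alpha_t (`|k|) _ a _ hS) => //.
  by apply: Gexp => x x0; exact: powq_norm.
move=> l m M lmM; rewrite sqrt_qnumM// -/h /alpha_t -/(S (l - m)).
transitivity ((q `^ (l + m + 1) * q `^ (- (l - m + (l - m - 1)) / 2)) *
  (h * S (l - m) * alpha q s M l)); first by ring.
transitivity ((q `^ (3 / 2) * q `^ (l + m) * q `^ (l + m) * q `^ (- (2 * l))) *
  (h * S (l - m) * alpha q s M l)); last by rewrite /k; ring.
by rewrite -!powqD//; congr (powR _ _ * _); lra.
Qed.

Lemma acts_x0_up : acts (fun l m M =>
  (q `^ m * Num.sqrt ((qn 2) * qn (l - m + 1) * qn (l + m + 1)) * alpha q s M (l + 1))%:C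
    *: ket (l + 1%:~R) (m + 0%:~R) M).
Proof.
have [a ha] := alpha_t_succ_tends.
pose k := Num.sqrt (qn 2) * h * q.
apply: (@acts_prod _ _ _ (fun x => k * q `^ x * Num.sqrt (1 - q `^ (2 * (x + 1))))
  (fun x => Num.sqrt (1 - q `^ (2 * (x + 1)))) _ (`|k|) 1 a _ _ ha) => //.
- by apply: Gexp => x x0.
- by move=> x; exact: sqrt_near1.
move=> l m M lmM; rewrite sqrt_qnum2M// -/h /alpha_t.
have v0 := index_v_ge0 hN lmM.
rewrite sqrt_1powqM; last exact: addr_ge0.
set S1 := Num.sqrt (1 - q `^ (2 * (l - m + 1))); set S2 := Num.sqrt (1 - q `^ (2 * (l + m + 1))).
transitivity ((q `^ m * q `^ (- (l - m + 1 + (l + m + 1)) / 2)) *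
  (Num.sqrt (qn 2) * h * S1 * S2 * alpha q s M (l + 1))); first by ring.
transitivity ((q `^ 1 * q `^ (l + m) * q `^ (- (2 * (l + 1)))) *
  (Num.sqrt (qn 2) * h * S1 * S2 * alpha q s M (l + 1))); last first.
  by rewrite powRr1 ?(ltW q0)// /k; ring.
by rewrite -!powqD//; congr (powR _ _ * _); lra.
Qed.

Lemma acts_x0_mid : acts (fun l m M =>
  ((qn (2 * l) - q `^ (l + m + 1) * (qn 2) * qn (l - m)) * beta q s M l)%:C
    *: ket (l + 0%:~R) (m + 0%:~R) M).
Proof.
have [b hb] := beta_t_tends.
(* The part that does not decay in u: [2l] cancels the rate of beta and leaves the constant h b,
   admissible as a translation by 0. *)
have a1 : acts (fun l m M => (qn (2 * l) * beta q s M l)%:C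
    *: ket (l + 0%:~R) (m + 0%:~R) M).
  apply: (@acts_tends _ _ _ (h * b) 0 (fun=> 0)); first by right.
    by move=> x _; rewrite normr0 mul0r.
  have := tendsM (tendsM (tends_cst N h) (tends_1powq N hq 0 (ltr0n R 4))) hb.
  rewrite mulr1 => ht; apply: rapid_eq ht _ => l m M lmM.
  rewrite subr0 qnumE// -/h /beta_t; congr (_ - _).
  by rewrite addr0 (_ : 2 * (2 * l) = 4 * l); ring.
have a2 : acts (fun l m M => (q `^ (l + m + 1) * (qn 2) * qn (l - m) * beta q s M l)%:C
    *: ket (l + 0%:~R) (m + 0%:~R) M).
  pose k := q * (qn 2) * h.
  apply: (@acts_prod _ _ _ (fun x => k * q `^ x * q `^ x)
    (fun x => 1 - q `^ (2 * x)) _ (`|k|) 1 b _ _ hb).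
  - by apply: Gexp => x x0; exact: powq_norm.
  - move=> x x0; rewrite addrAC subrr sub0r normrN ger0_norm ?powR_ge0// mul1r.
    exact: powq_2le.
  move=> l m M lmM; rewrite [qn (l - m)]qnumE// -/h /beta_t.
  set S := 1 - _.
  transitivity ((q `^ (l + m + 1) * q `^ (- (l - m))) * ((qn 2) * h * S * beta q s M l)).
    by ring.
  transitivity ((q `^ 1 * q `^ (l + m) * q `^ (l + m) * q `^ (- (2 * l))) *
    ((qn 2) * h * S * beta q s M l)); last by rewrite powRr1 ?(ltW q0)// /k; ring.
  by rewrite -!powqD//; congr (powR _ _ * _); lra.
apply: acts_eq (actsD a1 (actsN a2)) _ => l m M lmM.
by rewrite -scalerBl -realcB mulrBl.
Qed.

Lemma acts_x0_down : acts (fun l m M =>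
  (q `^ m * Num.sqrt ((qn 2) * qn (l - m) * qn (l + m)) * alpha q s M l)%:C
    *: ket (l + (-1)%:~R) (m + 0%:~R) M).
Proof.
have [a ha] := alpha_t_tends.
pose k := Num.sqrt (qn 2) * h.
apply: (@acts_prod _ _ _ (fun x => k * q `^ x * Num.sqrt (1 - q `^ (2 * x)))
  (fun x => Num.sqrt (1 - q `^ (2 * (x + 0)))) _ (`|k|) 1 a _ _ ha) => //.
- by apply: Gexp => x x0.
- by move=> x; exact: sqrt_near1.
move=> l m M lmM; rewrite sqrt_qnum2M// -/h /alpha_t addr0.
have v0 := index_v_ge0 hN lmM.
rewrite sqrt_1powqM//.
set S1 := Num.sqrt (1 - q `^ (2 * (l - m))); set S2 := Num.sqrt (1 - q `^ (2 * (l + m))).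
transitivity ((q `^ m * q `^ (- (l - m + (l + m)) / 2)) *
  (Num.sqrt (qn 2) * h * S1 * S2 * alpha q s M l)); first by ring.
transitivity ((q `^ (l + m) * q `^ (- (2 * l))) *
  (Num.sqrt (qn 2) * h * S1 * S2 * alpha q s M l)); last by rewrite /k; ring.
by rewrite -!powqD//; congr (powR _ _ * _); lra.
Qed.

Lemma x1_sided : sided_even true (pi (x1 q s)).
Proof.
have [[bpi _] hx1 _] := hpi.
apply: acts_sided (bpi _)
  (actsD (actsD acts_x1_up (actsN acts_x1_mid)) (actsN acts_x1_down)) _.
by move=> l m M lmM; rewrite hx1// !addr0 mulrN1z mulr1z.
Qed.

Lemma x0_sided : sided_even true (pi (x0 q s)).
Proof.
have [[bpi _] _ hx0] := hpi.
apply: acts_sided (bpi _) (actsD (actsD acts_x0_up acts_x0_mid) acts_x0_down) _.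
by move=> l m M lmM; rewrite hx0// !addr0 mulrN1z mulr1z.
Qed.

(** By uniqueness of adjoints, the one-sided adjoint built from the weights is the image of star x1;
    no formula for star x1 on kets is required. *)
Lemma x1S_sided : sided_even true (pi (star (x1 q s))).
Proof.
have [[_ [_ [_ [_ adj]]]] _ _] := hpi.
have [T' sT' hT'] := sided_even_adjoint hq hN hN0 hket x1_sided.
rewrite (_ : pi _ = T')//; apply/funext => y.
apply/eqP; rewrite -subr_eq0 -(dnorm_eq0 (@hdot R H)) hdotBr -adj hT' subrr.
by [].
Qed.

Lemma id_sided : sided_even true id.
Proof.
apply: acts_sided (_ : acts (fun l m M => (1 : R)%:C *: ket (l + 0%:~R) (m + 0%:~R) M)) _.
- by split=> //; exists 1 => x; rewrite mul1r.
- by apply: acts_uweight; apply: Or31; exists 1.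
- by move=> l m M _; rewrite !addr0 scale1r.
Qed.

End Generators.

(** * Commutators *)

(** [K] need not be stable under star: A is self-adjoint and affine in x0, B is a multiple of x1,
    and star x1 is supplied separately. *)
Lemma podles_ind (R : realType) (q s : R) (K : podles q s -> Prop) : 0 < q < 1 ->
  K (x0 q s) -> K (x1 q s) -> K (star (x1 q s)) -> K 1 ->
  (forall a b, K a -> K b -> K (a + b)) -> (forall (c : R[i]) a, K a -> K (c *: a)) ->
  (forall a b, K a -> K b -> K (a * b)) -> forall a, K a.
Proof.
move=> /andP[q0 q1] K0 K1 K1s Kone KD KZ KM a.
have t0 : 0 < q * qnum q 2 by rewrite mulr_gt0// qnum2_gt0// q0.
have c0 : (q * qnum q 2)%:C != 0 by rewrite gt_eqF// ltcR.
have r0 : (Num.sqrt (q * qnum q 2))%:C != 0 by rewrite gt_eqF// ltcR sqrtr_gt0.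
have KA : K (podA q s).
  rewrite (_ : podA q s = (q * qnum q 2)%:C^-1 *:
      ((1 - s ^+ 2)%:C *: (1 : podles q s) + (-1) *: x0 q s)).
    exact/KZ/KD/KZ/K0/KZ.
  by rewrite /x0 scaleN1r opprB addrC subrK scalerA mulVf// scale1r.
have KB : K (podB q s).
  rewrite (_ : podB q s = (Num.sqrt (q * qnum q 2))%:C^-1 *: x1 q s); first exact: KZ.
  by rewrite /x1 scalerA mulVf// scale1r.
have KBs : K (star (podB q s)).
  rewrite (_ : star (podB q s) = (Num.sqrt (q * qnum q 2))%:C^-1 *: star (x1 q s)).
    exact: KZ.
  by rewrite /x1 starZ conjcR scalerA mulVf// scale1r.
have [t ->] := sclass_surj a.
(* An element and its star are treated together, so that the case [SStar] only exchanges the two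
   halves. *)
suff : K (sclass (podles_rel q s) t) /\ K (star (sclass (podles_rel q s) t)) by case.
elim: t => [g|c|t [ht hts] u [hu hus]|t [ht hts] u [hu hus]|t [ht hts]].
- case: g; rewrite -?[sclass _ _]/(podA q s) -?[sclass _ _]/(podB q s) //.
  by rewrite podAS.
- by rewrite sclassC starC; split; exact: KZ.
- by rewrite sclassD starD; split; exact: KD.
- by rewrite sclassM starM; split; exact: KM.
- by rewrite sclassS starK.
Qed.

Section Commutators.
Context {R : realType} {H : hilbert R}.
Variables (q s N : R) (n : int) (ket : R -> R -> R -> H) (pi : podles q s -> H -> H)
  (D : uop H) (J : H -> H).
Hypotheses (hq : 0 < q < 1) (hN : 2 * N = n%:~R) (hN0 : N != 0)
  (hket : ket_basis N ket) (hpi : podles_rep N ket pi) (hD : dirac N ket D)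
  (hJa : antilinear J) (hJi : isometric J)
  (hJ : forall l m M, ket_index N l m M ->
     J (ket l m M) = (-1) ^ Num.floor (m + N) *: ket l (- m) (- M)).
Implicit Types (A B T X : H -> H).

Local Notation banded := (banded N ket).
Local Notation smoothing := (smoothing N ket).
Local Notation sided := (sided q N ket).

Let lD : linear_uop D. Proof. by case: hD => -[]. Qed.

Lemma opcommDr T A B x : bounded_op T ->
  opcomm T (fun x => A x + B x) x = opcomm T A x + opcomm T B x.
Proof.
by move=> /bounded_opP[_ DT _ _ _]; rewrite /opcomm DT opprD addrACA.
Qed.

Lemma opcommZr T (k : R[i]) A x : bounded_op T ->
  opcomm T (fun x => k *: A x) x = k *: opcomm T A x.
Proof. by move=> /bounded_opP[_ _ _ ZT _]; rewrite /opcomm ZT scalerBr. Qed.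

Lemma opcommMr T A B x : bounded_op A ->
  opcomm T (fun x => A (B x)) x = opcomm T A (B x) + A (opcomm T B x).
Proof.
by move=> /bounded_opP[_ _ BA _ _]; rewrite /opcomm BA addrA subrK.
Qed.

Lemma opcommC A B x : opcomm A B x = - opcomm B A x.
Proof. by rewrite /opcomm opprB. Qed.

(** Bandedness belongs to the definition because smoothing operators form an ideal in the banded
    ones, which the Leibniz rule uses for products. *)
Definition essential_commutant T X := banded X /\ smoothing (opcomm T X).

Lemma commutantD T A B : banded T -> essential_commutant T A ->
  essential_commutant T B -> essential_commutant T (fun x => A x + B x).
Proof.
move=> bT [bA sA] [bB sB]; split; first exact: band_add.
have := band_add sA sB; congr smoothing.
by apply/funext => x; rewrite opcommDr//; exact: band_bounded bT.
Qed.

Lemma commutantZ T (k : R[i]) A : banded T -> essential_commutant T A ->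
  essential_commutant T (fun x => k *: A x).
Proof.
move=> bT [bA sA]; split; first exact: band_scale.
have := band_scale k sA; congr smoothing.
by apply/funext => x; rewrite opcommZr//; exact: band_bounded bT.
Qed.

Lemma commutantM T A B : essential_commutant T A -> essential_commutant T B ->
  essential_commutant T (fun x => A (B x)).
Proof.
move=> [bA sA] [bB sB]; split; first exact: banded_comp.
have := band_add (smoothing_banded_comp hket sA bB) (banded_smoothing_comp hket bA sB).
by congr smoothing; apply/funext => x; rewrite (opcommMr T B x (band_bounded bA)).
Qed.

Lemma commutant_sym A B : banded A -> essential_commutant A B -> essential_commutant B A.
Proof.
move=> bA [bB sAB]; split=> //; have := band_scale (-1) sAB; congr smoothing.
by apply/funext => x; rewrite scaleN1r opcommC opprK.
Qed.

(** Stable under sums, scalars and products, the last because [D, AB] = [D, A] B + A [D, B] stays in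
    the commutant. All one-sided X are quantified at once, so conjugated generators and their stars
    are covered before b is considered. *)
Definition regular T := exists2 C, bounded_comm D T C &
  [/\ banded T, banded C & forall X, sided false X ->
      essential_commutant X T /\ essential_commutant X C].

Let sided_band e T : sided e T -> banded T.
Proof. exact: (sided_banded hq hN). Qed.

Lemma sided_regular T : sided_even q N ket true T -> regular T.
Proof.
move=> sT; have [C sC hC] := sided_dirac_comm hq hN hN0 hket (dirac_diagonal hD) sT.
have sT' := sided_even_sided sT.
have bT := sided_band sT'; have bC := sided_band sC.
exists C => //; split=> // X sX; have bX := sided_band sX.
split; apply: commutant_sym => //; split=> //;
  exact: (sided_comm hq hN hket).
Qed.

Lemma regularD A B : regular A -> regular B -> regular (fun x => A x + B x).
Proof.
move=> [CA hA [bA bCA kA]] [CB hB [bB bCB kB]].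
exists (fun x => CA x + CB x); first exact: bounded_commD.
split; [exact: band_add|exact: band_add|] => X sX; have bX := sided_band sX.
by have [a1 a2] := kA X sX; have [b1 b2] := kB X sX; split; exact: commutantD.
Qed.

Lemma regularZ (k : R[i]) A : regular A -> regular (fun x => k *: A x).
Proof.
move=> [CA hA [bA bCA kA]].
exists (fun x => k *: CA x); first exact: bounded_commZ.
split; [exact: band_scale|exact: band_scale|] => X sX; have bX := sided_band sX.
by have [a1 a2] := kA X sX; split; exact: commutantZ.
Qed.

Lemma regularM A B : regular A -> regular B -> regular (fun x => A (B x)).
Proof.
move=> [CA hA [bA bCA kA]] [CB hB [bB bCB kB]].
exists (fun x => CA (B x) + A (CB x)); first exact: bounded_commM.
split; [exact: banded_comp|by apply: band_add; exact: banded_comp|] => X sX.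
have bX := sided_band sX; have [a1 a2] := kA X sX; have [b1 b2] := kB X sX.
by split; [|apply: commutantD => //]; exact: commutantM.
Qed.

Let piD a b : pi (a + b) = fun x => pi a x + pi b x.
Proof.
have [[_ [_ [_ [L _]]]] _ _] := hpi; apply/funext => x.
by have := L 1 a b x; rewrite !scale1r.
Qed.

Let piZ (c : R[i]) a : pi (c *: a) = fun x => c *: pi a x.
Proof.
have [[_ [_ [_ [L _]]]] _ _] := hpi; apply/funext => x.
have p0 : pi 0 x = 0.
  by have := L (-1) 0 0 x; rewrite scaler0 addr0 scaleN1r addNr.
by have := L c a 0 x; rewrite addr0 p0 addr0.
Qed.

Let piM a b : pi (a * b) = fun x => pi a (pi b x).
Proof. by have [[_ [_ [M _]]] _ _] := hpi; apply/funext => x. Qed.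

Let pi1 : pi 1 = id.
Proof. by have [[_ [one _]] _ _] := hpi; apply/funext => x. Qed.

Lemma pi_regular a : regular (pi a).
Proof.
move: a; apply: (podles_ind hq).
- exact/sided_regular/(x0_sided hq hN hN0 hket hpi).
- exact/sided_regular/(x1_sided hq hN hN0 hket hpi).
- exact/sided_regular/(x1S_sided hq hN hN0 hket hpi).
- by rewrite pi1; exact/sided_regular/(id_sided hq hN hN0 hket).
- by move=> a b; rewrite piD; exact: regularD.
- by move=> c a; rewrite piZ; exact: regularZ.
- by move=> a b; rewrite piM; exact: regularM.
Qed.

Lemma commutant_opconj T b : banded T ->
  (forall X, sided false X -> essential_commutant T X) ->
  essential_commutant T (opconj J (pi b)).
Proof.
move=> bT hT.
have gen a : sided_even q N ket true (pi a) -> essential_commutant T (opconj J (pi a)).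
  by move=> /sided_even_sided/(sided_opconj hN hket hJa hJi hJ)/hT.
move: b; apply: (podles_ind hq).
- exact/gen/(x0_sided hq hN hN0 hket hpi).
- exact/gen/(x1_sided hq hN hN0 hket hpi).
- exact/gen/(x1S_sided hq hN hN0 hket hpi).
- by apply: gen; rewrite pi1; exact: (id_sided hq hN hN0 hket).
- move=> a b ha hb; have := commutantD bT ha hb; congr essential_commutant.
  by apply/funext => x; rewrite piD (opconjD hN hket hJa hJi hJ).
- move=> c a ha; have := commutantZ c^* bT ha; congr essential_commutant.
  by apply/funext => x; rewrite piZ (opconjZ hN hket hJa hJi hJ).
- move=> a b ha hb; have := commutantM ha hb; congr essential_commutant.
  by apply/funext => x; rewrite piM (opconjM hN hket hJa hJi hJ (pi a) (pi b)).
Qed.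

(** Two inductions over the algebra: regularity of [pi a] treats all a against one-sided operators,
    and [commutant_opconj], with [pi a] now fixed, extends from conjugated generators to all b.
    Antisymmetry of the commutator exchanges the roles between them. *)
Lemma commutators_smoothing a b : smoothing (opcomm (pi a) (opconj J (pi b))).
Proof.
have [C _ [bT _ hT]] := pi_regular a.
apply: (commutant_opconj b bT _).2 => X sX.
by apply: commutant_sym; [exact: sided_band sX|exact: (hT X sX).1].
Qed.

Lemma dirac_commutators_smoothing a b : exists2 C, bounded_comm D (pi a) C &
  smoothing (opcomm C (opconj J (pi b))).
Proof.
have [C hC [_ bC hT]] := pi_regular a; exists C => //.
apply: (commutant_opconj b bC _).2 => X sX.
by apply: commutant_sym; [exact: sided_band sX|exact: (hT X sX).2].
Qed.

End Commutators.

Unset Implicit Arguments.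

Theorem proposition3p15 (R : realType) (q s N : R) (n : int)
    (hq : 0 < q < 1) (hs : 0 <= s <= 1) (hN : 2 * N = n%:~R) (hN0 : N != 0)
    (H : hilbert R) (ket : R -> R -> R -> H) (hket : ket_basis N ket)
    (pi : podles q s -> H -> H) (hpi : podles_rep N ket pi)
    (gamma : H -> H) (hgamma : grading N ket gamma)
    (D : uop H) (hD : dirac N ket D)
    (absD : uop H) (habsD : absolute_value D absD)
    (act : uq q -> H -> H) (hact : uq_action N ket act)
    (J : H -> H) (hJa : antilinear J) (hJi : isometric J)
    (hJ : forall l m M, ket_index N l m M ->
       J (ket l m M) = (-1) ^ Num.floor (m + N) *: ket l (- m) (- M)) :
  [/\ equivariant N ket act J,
      forall x, J (J x) = (-1) ^ n *: x,
      forall x, J (gamma x) = - gamma (J x) &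
      (forall x, udom D (J x) <-> udom D x) /\
      (forall x, udom D x -> J (D x) = D (J x))] /\
  (forall a b, OPminfty absD (opcomm (pi a) (opconj J (pi (star b))))) /\
  (forall a b, exists2 Da, bounded_comm D (pi a) Da &
     OPminfty absD (opcomm Da (opconj J (pi (star b))))) /\
  weak_real_structure pi D absD gamma J /\
  (odd `|n|%N -> KO_dimension_2 D gamma J) /\
  (~~ odd `|n|%N -> KO_dimension_6 D gamma J).
Proof.
have dP := absolute_value_diagonal hD habsD.
have JJ := J_sqr hN hket hJa hJi hJ.
have Jg := J_grading hN hket hJa hJi hJ hgamma.
have Jd := J_dirac hN hN0 hket hJa hJi hJ hD.
have c1 a b : OPminfty absD (opcomm (pi a) (opconj J (pi b))).
  apply: (smoothing_OPminfty hN hN0 hket dP).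
  exact: (commutators_smoothing hq hN hN0 hket hpi hD hJa hJi hJ).
have c2 a b : exists2 Da, bounded_comm D (pi a) Da &
    OPminfty absD (opcomm Da (opconj J (pi b))).
  have [C hC sC] := dirac_commutators_smoothing hq hN hN0 hket hpi hD hJa hJi hJ a b.
  by exists C => //; exact: (smoothing_OPminfty hN hN0 hket dP).
have signs (e : R[i]) : (-1) ^ n = e -> real_signs D gamma J e 1 (-1).
  move=> ne; split.
  - by move=> x; rewrite JJ ne.
  - by split; [exact: Jd.1|move=> x dx; rewrite scale1r; exact: Jd.2].
  - by move=> x; rewrite Jg scaleN1r.
have parity : (-1) ^ n = (-1) ^+ odd `|n|%N :> R[i].
  rewrite signr_odd; case: (n) => k //.
  by rewrite NegzE -exprnN -exprVn invrN1.
split; first by split=> //; exact: (equivariant_antiunitary_part hq hN hN0 hket).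
split; first by move=> a b; exact: c1.
split; first by move=> a b; exact: c2.
split.
  split=> //; exists ((-1) ^ n), 1, (-1); split; last exact: signs.
  - exact: sign_or.
  - by left.
  - by right.
split=> [odd_n|even_n]; apply: signs; rewrite parity.
  by rewrite odd_n expr1.
by rewrite (negbTE even_n) expr0.
Qed.
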